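(* Let $a,b,c,d,e,f$ be positive real numbers. Then $$\frac1{\pi}\int_0^\infty\left|\frac{\Gamma(a+is)\Gamma(b+is)\Gamma(c+is)\Gamma(d+is)\Gamma(e+is)\Gamma(f+is)}{\Gamma(2is)}\right|^2ds$$ $$=\frac1{2\pi i}\,\Gamma(a+c)\Gamma(a+d)\Gamma(c+d)\Gamma(b+e)\Gamma(b+f)\Gamma(e+f)\;\times$$ $$\times\;\int_{-i\infty}^{i\infty}\frac{\Gamma(a+b+s)\Gamma(a+e+s)\Gamma(a+f+s)\Gamma(d-a-s)\Gamma(c-a-s)\Gamma(-s)}{\Gamma(c+d-s)\,\Gamma(a+b+e+f+s)}\,ds .$$
   Context: $\Gamma$ is Euler's gamma function. The integral $\int_{-i\infty}^{i\infty}$ is a Mellin–Barnes integral: it is taken over a contour going from $-i\infty$ to $+i\infty$ that separates the left series of poles of the numerator (poles of the factors $\Gamma(\cdot+s)$, here $s=-a-b-j,\ -a-e-j,\ -a-f-j$, $j=0,1,2,\dots$) from the right series (poles of the factors $\Gamma(\cdot-s)$, here $s=d-a+j,\ c-a+j,\ j$, $j=0,1,2,\dots$). The factor $1/\Gamma(2is)$ in the first integral is understood as $0$ at $s=0$.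
   Formalization: The factor 1/π before the first integral is corrected to 1/(2π): as printed, the left-hand side is exactly twice the right-hand side for all positive a, b, c, d, e, f. *)

(* Defs.v *)
From HB Require Import structures.
From mathcomp Require Import all_boot all_order all_algebra.
From mathcomp Require Import all_classical all_reals all_analysis.
From mathcomp Require Export complex.
Set Implicit Arguments.
Unset Strict Implicit.
Unset Printing Implicit Defensive.
Import Order.TTheory GRing.Theory Num.Theory.
Import numFieldNormedType.Exports.
Local Open Scope classical_set_scope.
Local Open Scope ring_scope.
Local Open Scope complex_scope.

Definition cintegral {R : realType} (D : set R) (f : R -> R[i]) : R[i] :=
  (\int[@lebesgue_measure R]_(t in D) complex.Re (f t)) +i*
  (\int[@lebesgue_measure R]_(t in D) complex.Im (f t)).

(* t ^ z = exp (z * ln t), with the real logarithm; meaningful for 0 < t. *)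
Definition cpowR {R : realType} (t : R) (z : R[i]) : R[i] :=
  (t `^ complex.Re z)%:C *
  (cos (complex.Im z * ln t) +i* sin (complex.Im z * ln t)).

(* Euler's integral of the second kind; meaningful for 0 < Re z. *)
Definition Gamma_integral {R : realType} (z : R[i]) : R[i] :=
  cintegral `]0, +oo[ (fun t : R => cpowR t (z - 1) * (expR (- t))%:C).

(* The meromorphic Gamma function: Euler's integral for 0 < Re z, continued to
   Re z <= 0 by Gamma z = Gamma (z + n) / (z (z + 1) ... (z + n - 1)), where n
   is the least natural number such that 0 < Re z + n.
   At the poles 0, -1, -2, ... the product vanishes and, since x / 0 = 0, both
   [Gamma z] and [(Gamma z)^-1] are 0: the latter is the right value of the
   entire function 1 / Gamma, the former is a junk value. *)
Definition Gamma {R : realType} (z : R[i]) : R[i] :=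
  let n := if 0 < complex.Re z then 0%N
           else (Num.truncn (- complex.Re z)).+1 in
  Gamma_integral (z + n%:R) / \prod_(k < n) (z + k%:R).

Definition piecewise_C1 {R : realType} (x : R -> R) : Prop :=
  continuous x /\
  exists s : seq R,
    (forall t, t \notin s -> derivable x t 1 /\ {for t, continuous (derive1 x)}) /\
    (forall t, t \in s -> cvg (derive1 x y @[y --> t^'-]) /\
                          cvg (derive1 x y @[y --> t^'+])).

(* Piecewise C^1 paths from -i oo to +i oo, staying in a vertical strip. *)
Definition imaginary_contour {R : realType} (g : R -> R[i]) : Prop :=
  [/\ piecewise_C1 (fun t => complex.Re (g t)),
      piecewise_C1 (fun t => complex.Im (g t)),
      exists M : R, forall t, `|complex.Re (g t)| <= M,
      complex.Im (g t) @[t --> -oo] --> -oo &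
      complex.Im (g t) @[t --> +oo] --> +oo].

(* [ls] and [rs] list the real parameters l and r of the factors Gamma (l + s)
   and Gamma (r - s). Their poles -l - j and r + j (j = 0, 1, 2, ...) are all
   real; the contour separates the two series when, wherever it meets the real
   axis, all the poles of the first series are on its left and all the poles
   of the second series are on its right. *)
Definition separates_poles {R : realType} (ls rs : seq R) (g : R -> R[i]) :
    Prop :=
  forall t, complex.Im (g t) = 0 ->
    (forall l (j : nat), l \in ls -> - l - j%:R < complex.Re (g t)) /\
    (forall r (j : nat), r \in rs -> complex.Re (g t) < r + j%:R).

(* Integral of F over the part of the contour g with parameters in [u, v]. *)
Definition arc_integral {R : realType} (g : R -> R[i]) (F : R[i] -> R[i])
    (u v : R) : R[i] :=
  cintegral `[u, v] (fun t : R => F (g t) *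
    (derive1 (fun t => complex.Re (g t)) t +i*
     derive1 (fun t => complex.Im (g t)) t)).

(* Improper integrals: the two ends of the contour go to infinity
   independently of each other. *)
Definition contour_integrable {R : realType} (g : R -> R[i])
    (F : R[i] -> R[i]) : Prop :=
  cvg (complex.Re (arc_integral g F uv.1 uv.2)
        @[uv --> filter_prod (ninfty_nbhs R) (pinfty_nbhs R)]) /\
  cvg (complex.Im (arc_integral g F uv.1 uv.2)
        @[uv --> filter_prod (ninfty_nbhs R) (pinfty_nbhs R)]).

Definition contour_integral {R : realType} (g : R -> R[i])
    (F : R[i] -> R[i]) : R[i] :=
  lim (complex.Re (arc_integral g F uv.1 uv.2)
        @[uv --> filter_prod (ninfty_nbhs R) (pinfty_nbhs R)]) +i*
  lim (complex.Im (arc_integral g F uv.1 uv.2)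
        @[uv --> filter_prod (ninfty_nbhs R) (pinfty_nbhs R)]).

(* Main.v *)
(* Choose a vertical line of abscissa s0 in the gap between the two series of
   poles. Multiply the integrand at s0 + i t by the integrand of the de
   Branges-Wilson integral with parameters a + s0 + i t, b, e, f, in a variable s.
   The integral in s is evaluated by the de Branges-Wilson formula and gives the
   right-hand side; the integral in t is evaluated by Barnes' second lemma and gives
   the left-hand side; Fubini's theorem exchanges them.

   Both evaluations have the same proof. Shifting the line of integration by 1
   gives a first-order recurrence in one of the parameters, which the closed form
   also satisfies; letting this parameter tend to infinity in the ratio of the two
   shows that the ratio does not depend on it, nor, by symmetry, on any of the
   parameters; and when all of them are 1/2 the integral is elementary, since
   |Gamma (1/2 + i y)|^2 = pi / ch (pi y).

   A contour that separates the poles avoids the cuts of a slit plane which is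
   star-shaped around s0. There the integrand has a primitive, namely its integral
   along segments from s0; hence, by the exponential decay of Gamma on vertical
   lines, the integral along the contour is the one along the vertical line. *)
Require Import Defs.
From HB Require Import structures.
From mathcomp Require Import all_boot all_order all_algebra.
From mathcomp Require Import all_classical all_reals all_analysis.
From mathcomp Require Import measurable_realfun complex ring lra zify.
Import Order.TTheory GRing.Theory Num.Theory.
Import numFieldNormedType.Exports.
Local Open Scope classical_set_scope.
Local Open Scope ring_scope.
Local Open Scope complex_scope.
Set Implicit Arguments.
Unset Strict Implicit.
Unset Printing Implicit Defensive.


(** * Complex modulus, limits and integrals *)

(** No asymptotic expansion of [Gamma] is used. A variance estimate shows that Gamma (n + z) is
    equivalent to n^z Gamma n; this excludes zeros and writes |Gamma (x + i y) / Gamma x|^2 as a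
    limit of products of rational factors that increase with x. From the exact value of |Gamma (1 +
    i y)|, monotonicity in x and the functional equation then bound |Gamma| above and below on every
    strip.

    The obstacle in both evaluations is domination: the quotient of the integrand by the closed form
    has to be bounded by one integrable function for all n. For the de Branges-Wilson integral,
    |Gamma (x + i y)| <= Gamma x is enough. In Barnes' lemma the moving parameter also occurs in a
    denominator, at another height, and |Gamma| has to be compared at different heights.

    Exponential rates are kept as rational multiples of pi, with 2/5 and 3/5 around 1/2, so that the
    decay of a product is a linear computation. The tightest budget, six [Gamma] factors against sin
    (2 pi z) and a factor z, leaves pi / 5. *)

Section ComplexNorm.
Context {R : realType}.
Implicit Types z w : R[i].

(** Real-valued, unlike the norm of the numeric field [R[i]], so that all estimates are inequalities
    in the ordered field [R]. *)
Definition nc z : R := Normc.normc z.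

Lemma nc_ge0 z : 0 <= nc z.
Proof. by case: z => x y; rewrite /nc /= sqrtr_ge0. Qed.

Lemma nc0 : nc 0 = 0.
Proof. exact: Normc.normc0. Qed.

Lemma nc1 : nc 1 = 1.
Proof. exact: Normc.normc1. Qed.

Lemma ncM z w : nc (z * w) = nc z * nc w.
Proof. exact: Normc.normcM. Qed.

Lemma ncV z : nc z^-1 = (nc z)^-1.
Proof. exact: Normc.normcV. Qed.

Lemma ncX z n : nc (z ^+ n) = nc z ^+ n.
Proof. by elim: n => [|n IH]; rewrite ?expr0 ?nc1// !exprS ncM IH. Qed.

Lemma nc_prod (I : Type) (s : seq I) (P : pred I) (F : I -> R[i]) :
  nc (\prod_(i <- s | P i) F i) = \prod_(i <- s | P i) nc (F i).
Proof. exact: (big_morph nc ncM nc1). Qed.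

Lemma ncD z w : nc (z + w) <= nc z + nc w.
Proof. exact: le_normcD. Qed.

Lemma ncN z : nc (- z) = nc z.
Proof. exact: normcN. Qed.

Lemma ncB z w : nc (z - w) <= nc z + nc w.
Proof. by rewrite -(ncN w) ncD. Qed.

Lemma ncC z w : nc (z - w) = nc (w - z).
Proof. by rewrite -ncN opprB. Qed.

Lemma nc_lerB z w : nc z - nc w <= nc (z - w).
Proof. by rewrite lerBlDr -{1}(subrK w z) ncD. Qed.

Lemma nc_eq0 z : (nc z == 0) = (z == 0).
Proof.
by apply/eqP/eqP => [/Normc.eq0_normc//|->]; exact: nc0.
Qed.

Lemma nc_gt0 z : (0 < nc z) = (z != 0).
Proof. by rewrite lt0r nc_ge0 nc_eq0 andbT. Qed.

Lemma nc_sqr z : nc z ^+ 2 = complex.Re z ^+ 2 + complex.Im z ^+ 2.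
Proof. by case: z => x y; rewrite /nc /= sqr_sqrtr// addr_ge0// sqr_ge0. Qed.

Lemma nc_Re z : `|complex.Re z| <= nc z.
Proof.
rewrite -ler_sqr ?nnegrE ?nc_ge0// nc_sqr real_normK ?num_real//.
by rewrite lerDl sqr_ge0.
Qed.

Lemma nc_Im z : `|complex.Im z| <= nc z.
Proof.
rewrite -ler_sqr ?nnegrE ?nc_ge0// nc_sqr real_normK ?num_real//.
by rewrite lerDr sqr_ge0.
Qed.

Lemma nc_le z : nc z <= `|complex.Re z| + `|complex.Im z|.
Proof.
rewrite -ler_sqr ?nnegrE ?nc_ge0 ?addr_ge0// nc_sqr.
rewrite sqrrD !real_normK ?num_real// -addrA lerD2l lerDr mulrn_wge0//.
Qed.

Lemma nc_real (x : R) : nc x%:C = `|x|.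
Proof. by rewrite /nc /= expr0n /= addr0 sqrtr_sqr. Qed.

Lemma ncMconj z : z * conjc z = (nc z ^+ 2)%:C.
Proof. by rewrite nc_sqr; case: z => x y; simpc; congr (_ +i* _); ring. Qed.

Lemma ReM z w : complex.Re (z * w) =
  complex.Re z * complex.Re w - complex.Im z * complex.Im w.
Proof. by case: z => a b; case: w. Qed.

Lemma ImM z w : complex.Im (z * w) =
  complex.Re z * complex.Im w + complex.Im z * complex.Re w.
Proof. by case: z => a b; case: w => c d /=. Qed.

Lemma ReD z w : complex.Re (z + w) = complex.Re z + complex.Re w.
Proof. by case: z => a b; case: w. Qed.

Lemma ImD z w : complex.Im (z + w) = complex.Im z + complex.Im w.
Proof. by case: z => a b; case: w. Qed.

Lemma ReN z : complex.Re (- z) = - complex.Re z.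
Proof. by case: z. Qed.

Lemma ImN z : complex.Im (- z) = - complex.Im z.
Proof. by case: z. Qed.

Lemma ReB z w : complex.Re (z - w) = complex.Re z - complex.Re w.
Proof. by rewrite ReD ReN. Qed.

Lemma ImB z w : complex.Im (z - w) = complex.Im z - complex.Im w.
Proof. by rewrite ImD ImN. Qed.

Lemma complex_ext z w : complex.Re z = complex.Re w ->
  complex.Im z = complex.Im w -> z = w.
Proof. by case: z => a b; case: w => c d /= -> ->. Qed.

Lemma Re_nat n : complex.Re (n%:R : R[i]) = n%:R.
Proof. by elim: n => //= n IH; rewrite -!natr1 ReD IH. Qed.

Lemma Im_nat n : complex.Im (n%:R : R[i]) = 0.
Proof. by elim: n => //= n IH; rewrite -!natr1 ImD IH addr0. Qed.

Lemma natC n : n%:R = (n%:R : R)%:C.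
Proof. by apply: complex_ext; rewrite ?Re_nat ?Im_nat. Qed.

End ComplexNorm.

(** * Integration on the real line *)

Section RealIntegral.
Context {R : realType}.
Implicit Types f g : R -> R.
Local Notation mu := (@lebesgue_measure R).

Definition intg f := mu.-integrable [set: R] (EFin \o f).

Lemma intg_measurable f : intg f -> measurable_fun setT f.
Proof. by move=> /measurable_int/measurable_EFinP. Qed.

Lemma intg_dom f g : measurable_fun setT f -> (forall x, `|f x| <= g x) ->
  intg g -> intg f.
Proof.
move=> mf fg ig; apply: le_integrable ig => //; first exact/measurable_EFinP.
by move=> x _ /=; rewrite lee_fin (le_trans (fg x))// ler_norm.
Qed.

Lemma intgD f g : intg f -> intg g -> intg (fun x => f x + g x).
Proof. by move=> fi gi; have := integrableD measurableT fi gi. Qed.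

Lemma intgZ c f : intg f -> intg (fun x => c * f x).
Proof. by move=> fi; have := integrableZl measurableT c fi. Qed.

Lemma intgN f : intg f -> intg (fun x => - f x).
Proof. by move=> fi; have := integrableN fi. Qed.

Lemma intgB f g : intg f -> intg g -> intg (fun x => f x - g x).
Proof. by move=> fi gi; apply: intgD => //; exact: intgN. Qed.

Lemma intg_norm f : intg f -> intg (fun x => `|f x|).
Proof. by move=> /integrable_norm. Qed.

Lemma eq_intg f g : f =1 g -> intg f -> intg g.
Proof. by move=> /funext ->. Qed.

Lemma le_Rint f g : intg f -> intg g -> (forall x, f x <= g x) ->
  \int[mu]_x f x <= \int[mu]_x g x.
Proof. by move=> fi gi fg; apply: le_Rintegral. Qed.

Lemma norm_Rint_le f g : intg f -> intg g -> (forall x, `|f x| <= g x) ->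
  `|\int[mu]_x f x| <= \int[mu]_x g x.
Proof.
move=> fi gi fg; apply: (le_trans (le_normr_Rintegral measurableT fi)).
by apply: le_Rint => //; exact: intg_norm.
Qed.

Lemma intgS f (D : set R) : measurable D -> intg f ->
  mu.-integrable D (EFin \o f).
Proof. by move=> mD; apply: integrableS. Qed.

Lemma is_derive_continuous f (x df : R) : is_derive x 1 f df ->
  {for x, continuous f}.
Proof.
by move=> fx; apply/differentiable_continuous/derivable1_diffP; exact: ex_derive.
Qed.

Lemma bigcup_itvNn : \bigcup_n `[(- n%:R)%R, n%:R%R]%classic = [set: R].
Proof.
apply/seteqP; split => // x _; exists (Num.truncn `|x|).+1 => //=.
rewrite in_itv/= -ler_norml ltW//.
exact: truncnS_gt.
Qed.

Lemma nondecreasing_itvNn : nondecreasing_seq (fun n => `[(- n%:R)%R, n%:R%R]%classic : set R).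
Proof.
move=> m n mn; apply/subsetPset => x /=; rewrite !in_itv/= -!ler_norml => /le_trans.
by apply; rewrite ler_nat.
Qed.

Lemma ge0_cvg_trunc f : measurable_fun setT f -> (forall x, 0 <= f x) ->
  (\int[mu]_(x in `[(- n%:R)%R, n%:R%R]) (f x)%:E @[n --> \oo] --> \int[mu]_x (f x)%:E)%E.
Proof.
move=> mf f0; rewrite -bigcup_itvNn; apply: ge0_nondecreasing_set_cvg_integral => //.
- exact: nondecreasing_itvNn.
- by move=> i; apply/measurable_EFinP; exact: measurable_funTS.
- by move=> i x _; rewrite lee_fin.
Qed.

(** Monotone convergence handles |f| + f and |f|, which are nonnegative and integrable, and [f] is
    their difference. *)
Lemma cvg_trunc f : intg f ->
  \int[mu]_(x in `[- n%:R, n%:R]) f x @[n --> \oo] --> \int[mu]_x f x.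
Proof.
move=> fi.
have h g : (forall x, 0 <= g x) -> intg g ->
    \int[mu]_(x in `[- n%:R, n%:R]) g x @[n --> \oo] --> \int[mu]_x g x.
  move=> g0 gi; apply: fine_cvg; rewrite fineK; last exact: integrable_fin_num.
  by apply: ge0_cvg_trunc => //; exact: intg_measurable.
have fpi : intg (fun x => `|f x| + f x) by apply: intgD => //; exact: intg_norm.
have fni : intg (fun x => `|f x|) by exact: intg_norm.
have fp0 x : 0 <= `|f x| + f x by rewrite -lerBlDr sub0r -normrN ler_norm.
have E (D : set R) : measurable D -> \int[mu]_(x in D) f x =
    \int[mu]_(x in D) (`|f x| + f x) - \int[mu]_(x in D) `|f x|.
  move=> mD; rewrite -RintegralB//; try by exact: intgS.
  by apply: eq_Rintegral => x _; rewrite addrAC subrr add0r.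
rewrite E//.
under eq_fun do rewrite E//.
by apply: cvgB; exact: h.
Qed.

(** The dominating function of the decay estimates below. By evenness it is enough to integrate on
    the half-line, where [- k^-1 * expR (- (k * x))] is an antiderivative. *)
Lemma cvg_expR_norm_intg (k : R) : 0 < k -> intg (fun y => expR (- (k * `|y|))).
Proof.
move=> k0; have cf : continuous (fun y : R => expR (- (k * `|y|))).
  move=> y; apply: continuous_comp; last exact: continuous_expR.
  apply: continuousN; apply: continuousM; first exact: cvg_cst.
  exact: norm_continuous.
apply/integrableP; split; first by apply/measurable_EFinP; exact: continuous_measurable_fun.
under eq_integral do rewrite /= ger0_norm ?expR_ge0//.
rewrite ge0_symfun_integralT//; last first.
  by move=> x /=; rewrite normrN.
have -> : [set x : R | 0 <= x] = `[0, +oo[%classic.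
  by apply/seteqP; split => x /=; rewrite in_itv/= andbT.
have dF (x : R) : is_derive x 1 (fun x => - k^-1 * expR (- (k * x))) (expR (- (k * x))).
  by apply: is_derive_eq; rewrite /GRing.scale /=; field; rewrite gt_eqF.
have -> : (\int[mu]_(x in `[0%R, +oo[) (expR (- (k * `|x|)))%:E =
    \int[mu]_(x in `[0%R, +oo[) (expR (- (k * x)))%:E)%E.
  apply: eq_integral => x; rewrite inE/= in_itv/= andbT => x0.
  by rewrite ger0_norm.
rewrite (@ge0_continuous_FTC2y _ _ (fun x => - k^-1 * expR (- (k * x))) 0 0).
- by rewrite -EFinB -EFinM ltry.
- by move=> x _; exact: expR_ge0.
- apply: continuous_subspaceT => x; apply: continuous_comp; last exact: continuous_expR.
  by apply: continuousN; apply: continuousM; [exact: cvg_cst|exact: cvg_id].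
- rewrite -(mulr0 (- k^-1)); apply: cvgM; first exact: cvg_cst.
  apply: (@cvg_comp _ _ _ (fun x => k * x) (fun x => expR (- x)) _ +oo%R); last exact: cvgr_expR.
  exact: gt0_cvgMry.
- by move=> x _; exact: ex_derive.
- apply: cvg_at_right_filter.
  exact: is_derive_continuous.
- by move=> x _; rewrite derive1E derive_val.
Qed.

End RealIntegral.


Section RealIntegral2.
Context {R : realType}.
Implicit Types f F : R -> R.
Local Notation mu := (@lebesgue_measure R).

Lemma rcvg_unique (V : normedModType R) (u : nat -> V) (l m : V) :
  u @ \oo --> l -> u @ \oo --> m -> l = m.
Proof. by move=> /cvg_lim <-// /cvg_lim <-. Qed.

Lemma cont_within f (D : set R) : continuous f -> {within D, continuous f}.
Proof. exact: continuous_subspaceT. Qed.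

Lemma cont_itv_intg f (a b : R) : continuous f ->
  mu.-integrable `[a, b] (EFin \o f).
Proof.
move=> cf; apply: continuous_compact_integrable; first exact: segment_compact.
exact: cont_within.
Qed.

Lemma FTC_itv f F (a b : R) : a <= b -> continuous f ->
  (forall x : R, is_derive x 1 F (f x)) ->
  \int[mu]_(x in `[a, b]) f x = F b - F a.
Proof.
rewrite le_eqVlt => /predU1P[-> _ _|ab cf dF].
  by rewrite set_itv1 Rintegral_set1 subrr.
rewrite /Rintegral (continuous_FTC2 ab (cont_within cf) (F := F))//.
  split; first by move=> x _; exact: ex_derive.
    by apply: cvg_at_right_filter; exact: is_derive_continuous.
  by apply: cvg_at_left_filter; exact: is_derive_continuous.
by move=> x _; rewrite derive1E derive_val.
Qed.

(** Integrability being assumed, the truncations to [-n, n] determine the integral, so limits of [F]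
    along the integers suffice. *)
Lemma FTC_R f F (lp lm : R) : continuous f -> intg f ->
  (forall x : R, is_derive x 1 F (f x)) ->
  F n%:R @[n --> \oo] --> lp -> F (- n%:R) @[n --> \oo] --> lm ->
  \int[mu]_x f x = lp - lm.
Proof.
move=> cf fi dF Fp Fm; have := cvg_trunc fi.
under eq_fun => n.
  rewrite (@FTC_itv _ _ (- n%:R) n%:R _ cf dF); last first.
    by rewrite (@le_trans _ _ 0)// oppr_le0.
  over.
move=> h.
exact: (rcvg_unique h (cvgB Fp Fm)).
Qed.

Lemma Rint_opp f : continuous f -> intg f -> intg (fun x => f (- x)) ->
  \int[mu]_x f (- x) = \int[mu]_x f x.
Proof.
move=> cf fi gi; apply: (rcvg_unique (cvg_trunc gi)).
apply: cvg_trans (cvg_trunc fi); apply: near_eq_cvg; apply: nearW => n.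
rewrite /Rintegral; have := @integration_by_substitution_oppr R f (- n%:R) n%:R.
rewrite opprK => ->//; first by rewrite (@le_trans _ _ 0)// oppr_le0.
exact: cont_within.
Qed.

End RealIntegral2.

(** * Limits of complex sequences *)

Section ComplexLimit.
Context {R : realType}.
Implicit Types (u v : nat -> R[i]) (l m : R[i]).

Definition ccvg u l := (fun n => nc (u n - l)) @ \oo --> (0 : R).

Lemma ccvg_cst l : ccvg (fun=> l) l.
Proof.
rewrite /ccvg (_ : (fun _ => _) = fun=> 0); first exact: cvg_cst.
by apply/funext => n; rewrite subrr nc0.
Qed.

Lemma ccvg_squeeze u l (d : nat -> R) : (forall n, nc (u n - l) <= d n) ->
  d @ \oo --> (0 : R) -> ccvg u l.
Proof.
move=> h; apply: (@squeeze_cvgr _ _ _ _ (fun=> 0)); last exact: cvg_cst.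
by apply: nearW => n; rewrite nc_ge0 h.
Qed.

Lemma ccvg_squeeze_near u l (d : nat -> R) :
  (\forall n \near \oo, nc (u n - l) <= d n) ->
  d @ \oo --> (0 : R) -> ccvg u l.
Proof.
move=> h; apply: (@squeeze_cvgr _ _ _ _ (fun=> 0)); last exact: cvg_cst.
by apply: filterS h => n ->; rewrite nc_ge0.
Qed.

Lemma ccvg_nc u l : ccvg u l -> (fun n => nc (u n)) @ \oo --> nc l.
Proof.
move=> ul; apply/cvgrPdist_le => e e0.
move/cvgrPdist_le : ul => /(_ _ e0); apply: filterS => n.
rewrite sub0r normrN ger0_norm ?nc_ge0//; apply: le_trans.
have h1 := nc_lerB l (u n); have h2 := nc_lerB (u n) l.
by rewrite (ncC l) in h1; rewrite ler_norml; apply/andP; split; lra.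
Qed.

Lemma ccvgM u v l m : ccvg u l -> ccvg v m -> ccvg (fun n => u n * v n) (l * m).
Proof.
move=> ul vm; apply: (@ccvg_squeeze _ _
  (fun n => nc (u n - l) * nc (v n) + nc l * nc (v n - m))).
  move=> n; rewrite -!ncM (_ : u n * v n - l * m = (u n - l) * v n + l * (v n - m)).
    exact: ncD.
  by ring.
rewrite (_ : 0 = 0 * nc m + nc l * 0); last by rewrite mul0r mulr0 addr0.
by apply: cvgD; apply: cvgM => //; [exact: ccvg_nc|exact: cvg_cst].
Qed.

Lemma ccvg_neq0 u l : ccvg u l -> l != 0 -> \forall n \near \oo, u n != 0.
Proof.
rewrite -nc_gt0 => /ccvg_nc/cvgr_gt/[apply]; apply: filterS => n.
by rewrite nc_gt0.
Qed.

Lemma ccvgV u l : l != 0 -> ccvg u l -> ccvg (fun n => (u n)^-1) l^-1.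
Proof.
move=> l0 ul; have lp : 0 < nc l by rewrite nc_gt0.
apply: (@ccvg_squeeze_near _ _ (fun n => nc (u n - l) * (nc (u n))^-1 * (nc l)^-1)).
  apply: filterS (ccvg_neq0 ul l0) => n un0.
  rewrite (_ : (u n)^-1 - l^-1 = - ((u n - l) * (u n)^-1 * l^-1)).
    by rewrite ncN !ncM !ncV.
  by field; rewrite l0 un0.
rewrite -(mul0r ((nc l)^-1)) -(mul0r ((nc l)^-1)) -[X in _ --> X]mulrA mul0r.
rewrite -(mul0r (nc l)^-1); apply: cvgM; last exact: cvg_cst.
rewrite -(mul0r (nc l)^-1); apply: cvgM => //.
by apply: cvgV; [rewrite gt_eqF|exact: ccvg_nc].
Qed.

Lemma ccvg_unique u l m : ccvg u l -> ccvg u m -> l = m.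
Proof.
move=> ul um; apply/eqP; rewrite -subr_eq0 -nc_eq0; apply/eqP.
have h : (fun n => nc (u n - l) + nc (u n - m)) @ \oo --> (0 : R).
  by rewrite -(addr0 0); exact: cvgD.
apply/le_anti; rewrite nc_ge0 andbT -(cvg_lim _ h)//.
apply: limr_ge; first by apply/cvg_ex; exists 0.
apply: nearW => n; rewrite (_ : l - m = (u n - m) - (u n - l)); last by ring.
by rewrite [leRHS]addrC; exact: ncB.
Qed.

Lemma eq_ccvg u v l : u =1 v -> ccvg u l -> ccvg v l.
Proof. by move=> /funext ->. Qed.

Lemma near_ccvg u v l : (\forall n \near \oo, u n = v n) -> ccvg u l -> ccvg v l.
Proof.
move=> uv; apply: cvg_trans; apply: near_eq_cvg.
by apply: filterS uv => n ->.
Qed.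

End ComplexLimit.

(** * Integrals of complex functions of a real variable *)

Section ComplexIntegral.
Context {R : realType}.
Implicit Types (f g : R -> R[i]) (c : R[i]).
Local Notation mu := (@lebesgue_measure R).

Definition ccont f := continuous (fun x => complex.Re (f x)) /\
  continuous (fun x => complex.Im (f x)).

Definition cmeas f := measurable_fun setT (fun x => complex.Re (f x)) /\
  measurable_fun setT (fun x => complex.Im (f x)).

Definition cig f := intg (fun x => complex.Re (f x)) /\
  intg (fun x => complex.Im (f x)).

Definition CI f := cintegral [set: R] f.

Lemma ReCI f : complex.Re (CI f) = \int[mu]_x complex.Re (f x).
Proof. by []. Qed.

Lemma ImCI f : complex.Im (CI f) = \int[mu]_x complex.Im (f x).
Proof. by []. Qed.

Lemma ccont_meas f : ccont f -> cmeas f.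
Proof. by move=> [a b]; split; exact: continuous_measurable_fun. Qed.

Lemma eq_cig f g : f =1 g -> cig f -> cig g.
Proof. by move=> /funext ->. Qed.

Lemma eq_CI f g : f =1 g -> CI f = CI g.
Proof. by move=> /funext ->. Qed.

Lemma ccont_cst c : ccont (fun=> c).
Proof. by split=> x; exact: cvg_cst. Qed.

Lemma ccontD f g : ccont f -> ccont g -> ccont (fun x => f x + g x).
Proof.
move=> [f1 f2] [g1 g2]; split.
  by under eq_fun do rewrite ReD; move=> x; apply: cvgD; [exact: f1|exact: g1].
by under eq_fun do rewrite ImD; move=> x; apply: cvgD; [exact: f2|exact: g2].
Qed.

Lemma ccontM f g : ccont f -> ccont g -> ccont (fun x => f x * g x).
Proof.
move=> [f1 f2] [g1 g2]; split.
  under eq_fun do rewrite ReM; move=> x; apply: cvgB.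
    by apply: cvgM; [exact: f1|exact: g1].
  by apply: cvgM; [exact: f2|exact: g2].
under eq_fun do rewrite ImM; move=> x; apply: cvgD.
  by apply: cvgM; [exact: f1|exact: g2].
by apply: cvgM; [exact: f2|exact: g1].
Qed.

Lemma ccont_real (h : R -> R) : continuous h -> ccont (fun x => (h x)%:C).
Proof. by move=> ch; split => //= x; exact: cvg_cst. Qed.

Lemma ccont_dist f : (forall x, exists C : R, \forall y \near x,
    nc (f y - f x) <= C * `|y - x|) -> ccont f.
Proof.
move=> h.
(* [p] will be the real part, then the imaginary part; both are 1-Lipschitz for the modulus. *)
have H (p : R[i] -> R) : (forall z w, `|p z - p w| <= nc (z - w)) ->
    continuous (fun x => p (f x)).
  move=> hp x; have [C hC] := h x; apply/cvgrPdist_le => e e0.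
  pose D := `|C| + 1; have D0 : 0 < D by rewrite ltr_pwDr.
  near=> y; rewrite (le_trans (hp _ _))// ncC.
  have /le_trans -> // : nc (f y - f x) <= C * `|y - x| by near: y.
  have : `|x - y| <= e / D by near: y; apply: cvgr_dist_le => //; rewrite divr_gt0.
  rewrite ler_pdivlMr// distrC => /(le_trans _); apply.
  by rewrite mulrC ler_wpM2l// (le_trans (ler_norm _))// lerDl.
split; apply: H => z w; first by rewrite -ReB nc_Re.
by rewrite -ImB nc_Im.
Unshelve. all: end_near. Qed.

Lemma cig_dom f (g : R -> R) : cmeas f -> (forall x, nc (f x) <= g x) ->
  intg g -> cig f.
Proof.
move=> [m1 m2] fg ig; split; apply: intg_dom ig => // x;
  by apply: le_trans (fg x); rewrite ?nc_Re ?nc_Im.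
Qed.

Lemma cigD f g : cig f -> cig g -> cig (fun x => f x + g x).
Proof.
move=> [f1 f2] [g1 g2]; split.
  by under eq_fun do rewrite ReD; exact: intgD.
by under eq_fun do rewrite ImD; exact: intgD.
Qed.

Lemma cigZ c f : cig f -> cig (fun x => c * f x).
Proof.
move=> [f1 f2]; split.
  by under eq_fun do rewrite ReM; apply: intgB; exact: intgZ.
by under eq_fun do rewrite ImM; apply: intgD; exact: intgZ.
Qed.

Lemma CID f g : cig f -> cig g -> CI (fun x => f x + g x) = CI f + CI g.
Proof.
move=> [f1 f2] [g1 g2]; apply: complex_ext.
  by rewrite ReD !ReCI -RintegralD//; apply: eq_Rintegral => x _; rewrite ReD.
by rewrite ImD !ImCI -RintegralD//; apply: eq_Rintegral => x _; rewrite ImD.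
Qed.

Lemma CIZ c f : cig f -> CI (fun x => c * f x) = c * CI f.
Proof.
move=> [f1 f2]; apply: complex_ext.
  rewrite ReM !(ReCI, ImCI) -!RintegralZl// -RintegralB//; try exact: intgZ.
  by apply: eq_Rintegral => x _; rewrite ReM.
rewrite ImM !(ReCI, ImCI) -!RintegralZl// -RintegralD//; try exact: intgZ.
by apply: eq_Rintegral => x _; rewrite ImM.
Qed.

Lemma CIB f g : cig f -> cig g -> CI (fun x => f x - g x) = CI f - CI g.
Proof.
move=> fi gi; rewrite -mulN1r -CIZ// -CID//; last exact: cigZ.
by apply: eq_CI => x; rewrite mulN1r.
Qed.

Lemma cigB f g : cig f -> cig g -> cig (fun x => f x - g x).
Proof.
by move=> fi gi; apply: eq_cig (cigD fi (cigZ (-1) gi)) => x; rewrite mulN1r.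
Qed.

(** The factor 2 comes from estimating the real and imaginary parts separately. *)
Lemma CI_le f (g : R -> R) : cig f -> intg g -> (forall x, nc (f x) <= g x) ->
  nc (CI f) <= 2 * \int[mu]_x g x.
Proof.
move=> [f1 f2] ig fg; rewrite (le_trans (nc_le _))//= mulrDl mul1r.
by rewrite lerD// norm_Rint_le// => x; rewrite (le_trans _ (fg x))// ?nc_Re ?nc_Im.
Qed.

Lemma CI_conj f : cig f -> CI (fun x => conjc (f x)) = conjc (CI f).
Proof.
move=> [f1 f2]; apply: complex_ext => /=.
  by apply: eq_Rintegral => x _; case: (f x).
transitivity (\int[mu]_x (-1 * complex.Im (f x))).
  by apply: eq_Rintegral => x _; rewrite mulN1r; case: (f x).
by rewrite RintegralZl// mulN1r.
Qed.

Lemma CI_opp f : ccont f -> cig f -> cig (fun x => f (- x)) ->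
  CI (fun x => f (- x)) = CI f.
Proof. by move=> [c1 c2] [f1 f2] [g1 g2]; congr Complex; exact: Rint_opp. Qed.

Lemma CI_dct (f_ : nat -> R -> R[i]) f (g : R -> R) :
  (forall n, cmeas (f_ n)) -> cmeas f -> intg g ->
  (forall x, ccvg (f_ ^~ x) (f x)) -> (forall n x, nc (f_ n x) <= g x) ->
  cig f /\ ccvg (fun n => CI (f_ n)) (CI f).
Proof.
move=> mf_ mf ig f_f f_g.
have H (p : R[i] -> R) : (forall z w, `|p z - p w| <= nc (z - w)) ->
    (forall z, `|p z| <= nc z) ->
    (forall n, measurable_fun setT (fun x => p (f_ n x))) ->
    measurable_fun setT (fun x => p (f x)) ->
    intg (fun x => p (f x)) /\
    \int[mu]_x p (f_ n x) @[n --> \oo] --> \int[mu]_x p (f x).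
  move=> p1 p2 m1 m2.
  have [|||||h1 _ h2] := @dominated_convergence _ _ R mu setT measurableT
      (fun n x => (p (f_ n x))%:E) (fun x => (p (f x))%:E) (EFin \o g).
  - by move=> n; apply/measurable_EFinP; exact: m1.
  - by apply/measurable_EFinP; exact: m2.
  - apply: aeW => x _; apply: cvg_EFin; first by apply: nearW.
    apply/cvgrPdist_le => e e0; have /cvgrPdist_le/(_ _ e0) := f_f x.
    apply: filterS => n; rewrite sub0r normrN ger0_norm ?nc_ge0// => h.
    by rewrite /= distrC (le_trans _ h).
  - exact: ig.
  - by apply: aeW => x n _; rewrite lee_fin (le_trans (p2 _)).
  split => //; apply: fine_cvg; rewrite fineK//; exact: integrable_fin_num.
have ReP (z w : R[i]) : `|complex.Re z - complex.Re w| <= nc (z - w) by rewrite -ReB nc_Re.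
have ImP (z w : R[i]) : `|complex.Im z - complex.Im w| <= nc (z - w) by rewrite -ImB nc_Im.
have [i1 c1] := H _ ReP (@nc_Re _) (fun n => (mf_ n).1) mf.1.
have [i2 c2] := H _ ImP (@nc_Im _) (fun n => (mf_ n).2) mf.2.
split => //.
apply: (@ccvg_squeeze _ _ _ (fun n =>
   `|complex.Re (CI (f_ n)) - complex.Re (CI f)| +
   `|complex.Im (CI (f_ n)) - complex.Im (CI f)|)).
  by move=> n; rewrite (le_trans (nc_le _))// ReB ImB.
rewrite -(addr0 0); apply: cvgD; rewrite -(normr0 R); apply: cvg_norm.
  by apply/subr_cvg0; exact: c1.
by apply/subr_cvg0; exact: c2.
Qed.

End ComplexIntegral.


(** * The substitution t = exp (c v) *)

Section ExpSubstitution.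
Context {R : realType}.
Implicit Types G : R -> R.
Local Notation mu := (@lebesgue_measure R).

Lemma bigcup_itv_expR (c : R) : 0 < c ->
  \bigcup_n `[expR (c * - n%:R), expR (c * n%:R)]%classic = `]0, +oo[%classic :> set R.
Proof.
move=> c0; apply/seteqP; split => [x [n _ /=]|x /=]; rewrite !in_itv/= andbT.
  by move=> /andP[+ _]; apply: lt_le_trans; exact: expR_gt0.
move=> x0; exists (Num.truncn `|ln x / c|).+1 => //=; rewrite in_itv/=.
rewrite -[X in _ <= X <= _](lnK (x := x)) ?posrE// !ler_expR.
have := ltW (truncnS_gt `|ln x / c|); rewrite ler_norml ler_pdivlMr// ler_pdivrMr//.
by rewrite !(mulrC _ c).
Qed.

(** The half-line is exhausted by the compact images of [-n, n], where the substitution is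
    classical; monotone convergence on both sides passes to the limit. The rate [c] will be 1 for
    Euler's integral and 1/2 for the Gaussian integral. *)
Lemma subst_expR_ge0 (c : R) G : 0 < c -> (forall t, 0 < t -> {for t, continuous G}) ->
  (forall t, 0 < t -> 0 <= G t) ->
  (\int[mu]_(t in `]0%R, +oo[) (G t)%:E =
   \int[mu]_v (G (expR (c * v)) * (c * expR (c * v)))%:E)%E.
Proof.
move=> c0 cG G0.
have ccv : continuous (fun v : R => c * v).
  by move=> v; apply: cvgM; [exact: cvg_cst|exact: cvg_id].
have cev : continuous (fun v : R => expR (c * v)).
  by move=> v; apply: continuous_comp; [exact: ccv|exact: continuous_expR].
have cexp : continuous (fun v => G (expR (c * v)) * (c * expR (c * v))).
  move=> v; apply: cvgM.
    by apply: continuous_comp; [exact: cev|apply: cG; exact: expR_gt0].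
  by apply: cvgM; [exact: cvg_cst|exact: cev].
have h2 := ge0_cvg_trunc (continuous_measurable_fun cexp)
  (fun v => mulr_ge0 (G0 _ (expR_gt0 _)) (mulr_ge0 (ltW c0) (expR_ge0 _))).
have sub n : [set` `[expR (c * - n%:R), expR (c * n%:R)]] `<=` [set` `]0, +oo[ : interval R].
  by rewrite -(bigcup_itv_expR c0) => x; exists n.
have mG : measurable_fun (`]0, +oo[%classic : set R) G.
  apply: open_continuous_measurable_fun; first exact: interval_open.
  by move=> x; rewrite inE/= in_itv/= andbT => x0; exact: cG.
have h1 : (\int[mu]_(t in `[expR (c * - n%:R), expR (c * n%:R)]) (G t)%:E @[n --> \oo] -->
    \int[mu]_(t in `]0%R, +oo[) (G t)%:E)%E.
  rewrite -(bigcup_itv_expR c0); apply: ge0_nondecreasing_set_cvg_integral => //.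
  - move=> m n mn; apply/subsetPset => x /=; rewrite !in_itv/= => /andP[h k].
    by rewrite (le_trans _ h) ?(le_trans k)// ler_expR ler_pM2l// ?lerN2 ler_nat.
  - move=> i; apply/measurable_EFinP; apply: measurable_funS mG => //.
  - by move=> i x /sub /=; rewrite in_itv/= andbT lee_fin => /G0.
apply: (cvg_unique (@ereal_hausdorff R) h1); apply: cvg_trans h2.
apply: near_eq_cvg; apply: nearW => n.
have dF (x : R) : is_derive x 1 (fun v : R => expR (c * v)) (c * expR (c * x)).
  by apply: is_derive_eq; rewrite /GRing.scale /=; ring.
have dexp : derive1 (fun v : R => expR (c * v)) = (fun x => c * expR (c * x)).
  by apply/funext => x; rewrite derive1E; exact: derive_val.
have cd : continuous (fun x : R => c * expR (c * x)).
  by move=> v; apply: cvgM; [exact: cvg_cst|exact: cev].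
rewrite (@integration_by_substitution_increasing R (fun v => expR (c * v)) G (- n%:R) n%:R).
- by apply: eq_integral => x _; rewrite dexp.
- by rewrite (@le_trans _ _ 0)// oppr_le0.
- by move=> x y _ _; rewrite ltr_expR ltr_pM2l.
- by rewrite dexp => x _; exact: cd.
- rewrite dexp; apply: cvgP; apply: cvg_at_right_filter; exact: cd.
- rewrite dexp; apply: cvgP; apply: cvg_at_left_filter; exact: cd.
- split; first by move=> x _; exact: ex_derive.
    by apply: cvg_at_right_filter; exact: cev.
  by apply: cvg_at_left_filter; exact: cev.
- apply: continuous_in_subspaceT => x; rewrite inE => /sub/=.
  by rewrite in_itv/= andbT => x0; exact: cG.
Qed.

(** The positive and negative parts of [G] are transformed separately. No integrability is assumed:
    the two sides are built from the same extended values. *)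
Lemma subst_expR (c : R) G : 0 < c -> (forall t, 0 < t -> {for t, continuous G}) ->
  \int[mu]_(t in `]0, +oo[) G t = \int[mu]_v (G (expR (c * v)) * (c * expR (c * v))).
Proof.
move=> c0 cG; rewrite /Rintegral; congr fine.
have P (H : R -> R) : (forall t, 0 < t -> {for t, continuous H}) ->
    (\int[mu]_(t in `]0%R, +oo[) (Num.max (H t) 0)%:E =
    \int[mu]_v (Num.max (H (expR (c * v)) * (c * expR (c * v))) 0)%:E)%E.
  move=> cH; rewrite (@subst_expR_ge0 c (fun t => Num.max (H t) 0) c0).
  - apply: eq_integral => v _; congr EFin.
    by rewrite maxr_pMl ?mul0r// mulr_ge0 ?expR_ge0// ltW.
  - by move=> t t0; apply: continuous_max; [exact: cH|exact: cst_continuous].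
  - by move=> t _; rewrite le_max lexx orbT.
rewrite integralE [RHS]integralE; congr (_ - _)%E.
  transitivity (\int[mu]_(t in `]0%R, +oo[) (Num.max (G t) 0)%R%:E)%E.
    by apply: eq_integral => t _; rewrite funeposE EFin_max.
  by rewrite P//; apply: eq_integral => t _; rewrite funeposE EFin_max.
transitivity (\int[mu]_(t in `]0%R, +oo[) (Num.max (- G t) 0)%R%:E)%E.
  by apply: eq_integral => t _; rewrite funenegE EFin_max.
rewrite (P (fun t => - G t)).
  by apply: eq_integral => v _; rewrite funenegE mulNr EFin_max.
by move=> t t0; apply: cvgN; exact: cG.
Qed.

End ExpSubstitution.

(** * The complex exponential and its Taylor estimates *)

Section ComplexExp.
Context {R : realType}.
Implicit Types z w : R[i].

Definition ce z : R[i] :=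
  (expR (complex.Re z) * cos (complex.Im z)) +i*
  (expR (complex.Re z) * sin (complex.Im z)).

Lemma ce_Re z : complex.Re (ce z) = expR (complex.Re z) * cos (complex.Im z).
Proof. by []. Qed.

Lemma ce_Im z : complex.Im (ce z) = expR (complex.Re z) * sin (complex.Im z).
Proof. by []. Qed.

Lemma ceD z w : ce (z + w) = ce z * ce w.
Proof.
apply: complex_ext; rewrite ?ReM ?ImM /= ReD ImD expRD ?cosD ?sinD.
  by ring.
by ring.
Qed.

Lemma nc_ce z : nc (ce z) = expR (complex.Re z).
Proof.
rewrite /nc /= !exprMn -mulrDr cos2Dsin2 mulr1 sqrtr_sqr.
by rewrite ger0_norm ?expR_ge0.
Qed.

Lemma ce_real (x : R) : ce x%:C = (expR x)%:C.
Proof. by apply: complex_ext; rewrite ?ce_Re ?ce_Im /= ?cos0 ?sin0 ?mulr1 ?mulr0. Qed.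

Lemma taylor1 (p p1 : R -> R) (M : R) :
  (forall x : R, is_derive x 1 p (p1 x)) ->
  (forall x, 0 <= x <= 1 -> `|p1 x| <= M) -> `|p 1 - p 0| <= M.
Proof.
move=> d1 hM; have [c] := @MVT R p p1 0 1 ltr01 (fun x _ => d1 x)
  (cont_within (fun x => is_derive_continuous (d1 x))).
rewrite in_itv/= => /andP[c0 c1 ->]; rewrite subr0 mulr1.
by apply: hM; rewrite !ltW.
Qed.

Lemma taylor2 (p p1 p2 : R -> R) (M : R) :
  (forall x : R, is_derive x 1 p (p1 x)) ->
  (forall x : R, is_derive x 1 p1 (p2 x)) ->
  (forall x, 0 <= x <= 1 -> `|p2 x| <= M) -> `|p 1 - p 0 - p1 0| <= M.
Proof.
move=> d1 d2 hM; have [c] := @MVT R p p1 0 1 ltr01 (fun x _ => d1 x)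
  (cont_within (fun x => is_derive_continuous (d1 x))).
rewrite in_itv/= => /andP[c0 c1 ->]; rewrite subr0 mulr1.
have [e] := @MVT R p1 p2 0 c c0 (fun x _ => d2 x)
  (cont_within (fun x => is_derive_continuous (d2 x))).
rewrite in_itv/= => /andP[e0 ec ->]; rewrite subr0 normrM (ger0_norm (ltW c0)).
rewrite (le_trans (ler_pM _ _ (hM e _) (ltW c1))) ?mulr1//; first exact: ltW.
by rewrite (ltW e0)/= ltW// (lt_trans ec).
Qed.

(** On a segment issued from 0 the exponential is at most the larger of its end values; the sum of
    both covers the two signs of [p]. *)
Lemma expR_seg (t p : R) : 0 <= t <= 1 -> expR (t * p) <= 1 + expR p.
Proof.
move=> /andP[t0 t1]; have [p0|p0] := leP 0 p.
  rewrite (@le_trans _ _ (expR p))// ?lerDr// ler_expR ler_piMl//.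
by rewrite (@le_trans _ _ 1)// ?lerDl ?expR_ge0// expR_le1 mulr_ge0_le0// ltW.
Qed.

(** Mean value theorem for the real and imaginary parts of ce (t z), with t running from 0 to 1. *)
Lemma ce_taylor1 z : nc (ce z - 1) <= 4 * nc z * (1 + expR (complex.Re z)).
Proof.
case: z => p q; set z := p +i* q.
have np : `|p| <= nc z := nc_Re z. have nq : `|q| <= nc z := nc_Im z.
have B t (u v : R) : 0 <= t <= 1 -> `|u| <= 1 -> `|v| <= 1 ->
    `|expR (t * p) * (p * u + q * v)| <= 2 * nc z * (1 + expR p).
  move=> t01 u1 v1; rewrite normrM ger0_norm ?expR_ge0// mulrC ler_pM ?expR_seg ?expR_ge0//.
  rewrite (le_trans (ler_normD _ _))// !normrM mulrDl mul1r lerD//.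
    by rewrite -[leRHS]mulr1 ler_pM.
  by rewrite -[leRHS]mulr1 ler_pM.
rewrite (le_trans (nc_le _))// ReB ImB ce_Re ce_Im /=.
rewrite (_ : 4 * nc z * (1 + expR p) = 2 * nc z * (1 + expR p) + 2 * nc z * (1 + expR p));
  last by ring.
rewrite lerD//.
  have := @taylor1 (fun t : R => expR (t * p) * cos (t * q))
     (fun t => expR (t * p) * (p * cos (t * q) + q * (- sin (t * q)))) (2 * nc z * (1 + expR p)).
  rewrite !mul1r !mul0r expR0 cos0 mulr1; apply.
    by move=> x; apply: is_derive_eq; rewrite /GRing.scale /=; ring.
  by move=> x x01; apply: B => //; rewrite ?normrN ?cos_max ?sin_max.
have := @taylor1 (fun t : R => expR (t * p) * sin (t * q))
     (fun t => expR (t * p) * (p * sin (t * q) + q * cos (t * q))) (2 * nc z * (1 + expR p)).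
rewrite !mul1r !mul0r expR0 sin0 mulr0; apply.
  by move=> x; apply: is_derive_eq; rewrite /GRing.scale /=; ring.
by move=> x x01; apply: B => //; rewrite ?cos_max ?sin_max.
Qed.

(** Two applications of the mean value theorem along the same path. The factor
    [1 + expR (complex.Re z)] has the form needed under Euler's integral: with z replaced by h v,
    its product with |gk z v| is |gk z v| + |gk (z + h) v|. *)
Lemma ce_taylor2 z :
  nc (ce z - 1 - z) <= 8 * nc z ^+ 2 * (1 + expR (complex.Re z)).
Proof.
case: z => p q; set z := p +i* q.
have np : `|p| <= nc z := nc_Re z. have nq : `|q| <= nc z := nc_Im z.
have B t (u v : R) : 0 <= t <= 1 -> `|u| <= 1 -> `|v| <= 1 ->
    `|expR (t * p) * ((p ^+ 2 - q ^+ 2) * u + (2 * p * q) * v)| <= 4 * nc z ^+ 2 * (1 + expR p).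
  move=> t01 u1 v1; rewrite normrM ger0_norm ?expR_ge0// mulrC ler_pM ?expR_seg ?expR_ge0//.
  rewrite (le_trans (ler_normD _ _))// !normrM.
  rewrite (_ : 4 * nc z ^+ 2 = (nc z ^+ 2 + nc z ^+ 2) * 1 + (2 * nc z * nc z) * 1);
    last by ring.
  rewrite lerD// ler_pM//.
    rewrite (le_trans (ler_normB _ _))// !normrX lerD// lerXn2r ?nnegrE ?nc_ge0//.
  by rewrite normr_nat ler_pM// ler_pM.
rewrite (le_trans (nc_le _))// !ReB !ImB ce_Re ce_Im /= subr0.
rewrite (_ : 8 * nc z ^+ 2 * (1 + expR p) =
  4 * nc z ^+ 2 * (1 + expR p) + 4 * nc z ^+ 2 * (1 + expR p)); last by ring.
rewrite lerD//.
  have := @taylor2 (fun t : R => expR (t * p) * cos (t * q))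
     (fun t => expR (t * p) * (p * cos (t * q) + q * (- sin (t * q))))
     (fun t => expR (t * p) * ((p ^+ 2 - q ^+ 2) * cos (t * q) + 2 * p * q * (- sin (t * q))))
     (4 * nc z ^+ 2 * (1 + expR p)).
  rewrite !mul1r !mul0r expR0 cos0 sin0 mulr1 oppr0 mulr0 addr0 mul1r mulr1; apply.
  - by move=> x; apply: is_derive_eq; rewrite /GRing.scale /=; ring.
  - by move=> x; apply: is_derive_eq; rewrite /GRing.scale /=; ring.
  - by move=> x x01; apply: B => //; rewrite ?normrN ?cos_max ?sin_max.
have := @taylor2 (fun t : R => expR (t * p) * sin (t * q))
     (fun t => expR (t * p) * (p * sin (t * q) + q * cos (t * q)))
     (fun t => expR (t * p) * ((p ^+ 2 - q ^+ 2) * sin (t * q) + 2 * p * q * cos (t * q)))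
     (4 * nc z ^+ 2 * (1 + expR p)).
rewrite !mul1r !mul0r expR0 cos0 sin0 !mulr0 add0r mul1r mulr1 subr0; apply.
- by move=> x; apply: is_derive_eq; rewrite /GRing.scale /=; ring.
- by move=> x; apply: is_derive_eq; rewrite /GRing.scale /=; ring.
- by move=> x x01; apply: B => //; rewrite ?cos_max ?sin_max.
Qed.

End ComplexExp.


(** * Derivatives of complex curves and the fundamental theorem *)

Section CurveDerivative.
Context {R : realType}.
Implicit Types f F : R -> R[i].
Local Notation mu := (@lebesgue_measure R).

Definition cder F (x : R) (l : R[i]) :=
  is_derive x 1 (fun x => complex.Re (F x)) (complex.Re l) /\
  is_derive x 1 (fun x => complex.Im (F x)) (complex.Im l).

Lemma cFTC_R f F (lp lm : R[i]) : ccont f -> cig f ->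
  (forall x, cder F x (f x)) ->
  ccvg (fun n => F n%:R) lp -> ccvg (fun n => F (- n%:R)) lm ->
  CI f = lp - lm.
Proof.
move=> [c1 c2] [i1 i2] dF.
have H (p : R[i] -> R) u l : (forall z w, `|p z - p w| <= nc (z - w)) ->
    ccvg u l -> (fun n : nat => p (u n)) @ \oo --> p l.
  move=> hp ul; apply/cvgrPdist_le => e e0; have /cvgrPdist_le/(_ _ e0) := ul.
  apply: filterS => n; rewrite sub0r normrN ger0_norm ?nc_ge0// => h.
  by rewrite distrC (le_trans _ h).
have ReP (z w : R[i]) : `|complex.Re z - complex.Re w| <= nc (z - w) by rewrite -ReB nc_Re.
have ImP (z w : R[i]) : `|complex.Im z - complex.Im w| <= nc (z - w) by rewrite -ImB nc_Im.
move=> Fp Fm; apply: complex_ext.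
  by rewrite ReCI ReB; apply: FTC_R c1 i1 (fun x => (dF x).1) _ _; exact: H.
by rewrite ImCI ImB; apply: FTC_R c2 i2 (fun x => (dF x).2) _ _; exact: H.
Qed.

Lemma cFTC_itv f F (a b : R) : a <= b -> ccont f ->
  (forall x, cder F x (f x)) -> cintegral `[a, b] f = F b - F a.
Proof.
move=> ab [c1 c2] dF; apply: complex_ext.
  by rewrite ReB; exact: (FTC_itv ab c1 (fun x => (dF x).1)).
by rewrite ImB; exact: (FTC_itv ab c2 (fun x => (dF x).2)).
Qed.

End CurveDerivative.

(** * Euler's integral over the real line *)

Section GammaKernel.
Context {R : realType}.
Implicit Types (x y v : R) (z w : R[i]).
Local Notation mu := (@lebesgue_measure R).

(* The integrand of Euler's integral after the substitution t = exp v. *)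
Definition rk x v : R := expR (x * v - expR v).

Lemma rk_ge0 x v : 0 <= rk x v. Proof. exact: expR_ge0. Qed.

Lemma rk_cont x : continuous (rk x).
Proof.
move=> v; apply: continuous_comp; last exact: continuous_expR.
apply: cvgB; last exact: continuous_expR.
by apply: cvgM; [exact: cvg_cst|exact: cvg_id].
Qed.

Lemma expR_ge_sqr x : 0 <= x -> 1 + x ^+ 2 / 2 <= expR x.
Proof. by move=> x0; have := @expR_ge1Dxn R x 1 x0. Qed.

Lemma rk_le x : 0 < x -> exists C k : R, [/\ 0 <= C, 0 < k &
  forall v, rk x v <= C * expR (- (k * `|v|))].
Proof.
(* For v >= 0, [expR_ge_sqr] and completing the square in (x + 1) v - v^2 / 2 leave the exponent -
   v; for v < 0 the term x v alone gives the decay. Hence the rate, the smaller of x and 1. *)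
move=> x0; exists (expR ((x + 1) ^+ 2 / 2)), (Num.min x 1); split.
- exact: expR_ge0.
- by rewrite lt_min x0 ltr01.
move=> v; rewrite /rk -expRD ler_expR.
have k1 : Num.min x 1 <= 1 by rewrite ge_min lexx orbT.
have kx : Num.min x 1 <= x by rewrite ge_min lexx.
have [v0|v0] := leP 0 v.
  rewrite ger0_norm//; have := expR_ge_sqr v0.
  have : Num.min x 1 * v <= 1 * v by rewrite ler_wpM2r.
  have : 0 <= (v - (x + 1)) ^+ 2 by exact: sqr_ge0.
  rewrite !expr2; nra.
rewrite ltr0_norm//; have := expR_ge0 v.
have : Num.min x 1 * (- v) <= x * (- v) by rewrite ler_wpM2r// oppr_ge0 ltW.
have := sqr_ge0 (x + 1); lra.
Qed.

Lemma rk_intg x : 0 < x -> intg (rk x).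
Proof.
move=> x0; have [C [k [C0 k0 h]]] := rk_le x0.
apply: (@intg_dom _ _ (fun v => C * expR (- (k * `|v|)))).
- by apply: continuous_measurable_fun; exact: rk_cont.
- by move=> v; rewrite ger0_norm ?rk_ge0.
- by apply: intgZ; exact: cvg_expR_norm_intg.
Qed.

Lemma cvg_expR_natN (k : R) : 0 < k -> expR (- (k * n%:R)) @[n --> \oo] --> (0 : R).
Proof.
move=> k0; apply: (@cvg_comp _ _ _ (fun n : nat => k * n%:R) (fun x => expR (- x)) _ +oo%R).
  apply: (@cvg_comp _ _ _ (fun n : nat => n%:R : R) (fun x => k * x) _ +oo%R).
    exact: cvgr_idn.
  by apply: gt0_cvgMry => //; exact: cvg_id.
exact: cvgr_expR.
Qed.

(** The exponent is monotone in the abscissa, in a direction that depends on the sign of [v]; the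
    sum dominates the kernel on a whole strip. *)
Lemma rk_between x1 x2 x v : x1 <= x <= x2 -> rk x v <= rk x1 v + rk x2 v.
Proof.
move=> /andP[h1 h2]; have [v0|v0] := leP 0 v.
  by rewrite (@le_trans _ _ (rk x2 v))// ?lerDr ?rk_ge0// ler_expR lerB// ler_wpM2r.
by rewrite (@le_trans _ _ (rk x1 v))// ?lerDl ?rk_ge0// ler_expR lerB// ler_wnM2r// ltW.
Qed.

(** The weight [v ^+ 2] will come from second-order Taylor remainders; it is absorbed by moving the
    abscissa by [d] in both directions. *)
Lemma sqr_rk (d : R) x v : 0 < d ->
  v ^+ 2 * rk x v <= (2 / d ^+ 2) * (rk (x - d) v + rk (x + d) v).
Proof.
move=> d0; have dv0 : 0 <= d * `|v| by rewrite mulr_ge0// ltW.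
have h1 : v ^+ 2 <= (2 / d ^+ 2) * expR (d * `|v|).
  rewrite mulrAC ler_pdivlMr ?exprn_gt0//.
  have := expR_ge_sqr dv0; rewrite exprMn real_normK ?num_real//; nra.
have h2 : expR (d * `|v|) * rk x v <= rk (x - d) v + rk (x + d) v.
  rewrite /rk -expRD; have [v0|v0] := leP 0 v.
    rewrite ger0_norm// (_ : d * v + (x * v - expR v) = (x + d) * v - expR v); last by ring.
    by rewrite lerDr expR_ge0.
  rewrite ltr0_norm// (_ : d * - v + (x * v - expR v) = (x - d) * v - expR v); last by ring.
  by rewrite lerDl expR_ge0.
apply: (le_trans (ler_wpM2r (rk_ge0 x v) h1)); rewrite -(mulrA (2 / d ^+ 2)).
by apply: ler_wpM2l; rewrite // divr_ge0// sqr_ge0.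
Qed.

Definition gk z v : R[i] := ce (z * v%:C - (expR v)%:C).

Lemma nc_gk z v : nc (gk z v) = rk (complex.Re z) v.
Proof. by rewrite nc_ce ReB ReM /= mulr0 subr0. Qed.

Lemma gkE z v : gk z v =
  (rk (complex.Re z) v * cos (complex.Im z * v)) +i*
  (rk (complex.Re z) v * sin (complex.Im z * v)).
Proof.
rewrite /gk /ce ReB ImB ReM ImM /= !mulr0 subr0 add0r subr0.
by rewrite ?add0r ?addr0.
Qed.

Lemma gk_cont z : ccont (gk z).
Proof.
have lin (a : R) : continuous (fun v : R => a * v).
  by move=> v; apply: cvgM; [exact: cvg_cst|exact: cvg_id].
split; under eq_fun do rewrite gkE/=; move=> v; apply: cvgM;
  try exact: rk_cont; apply: continuous_comp; try exact: lin.
  exact: continuous_cos.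
exact: continuous_sin.
Qed.

Lemma gk_cig z : 0 < complex.Re z -> cig (gk z).
Proof.
move=> z0; apply: cig_dom (ccont_meas (gk_cont z)) _ (rk_intg z0) => v.
by rewrite nc_gk.
Qed.

Lemma gkD z w v : gk (z + w) v = gk z v * ce (w * v%:C).
Proof. by rewrite /gk -ceD; congr ce; ring. Qed.

Definition GI z : R[i] := CI (gk z).

Lemma Gamma_integralE z : Gamma_integral z = GI z.
Proof.
rewrite /Gamma_integral /cintegral.
have cpE (t : R) : 0 < t -> cpowR t (z - 1) * (expR (- t))%:C =
   (expR ((complex.Re z - 1) * ln t - t) * cos (complex.Im z * ln t)) +i*
   (expR ((complex.Re z - 1) * ln t - t) * sin (complex.Im z * ln t)).
  move=> t0; rewrite /cpowR ReB ImB /= /powR gt_eqF// expRD.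
  apply: complex_ext; rewrite !(ReM, ImM) /=; rewrite !subr0; ring.
have cont (p : R -> R) (t : R) : continuous p -> 0 < t ->
    {for t, continuous (fun t => expR ((complex.Re z - 1) * ln t - t) *
     p (complex.Im z * ln t))}.
  move=> cp t0; have cl (a : R) : {for t, continuous (fun t => a * ln t)}.
    by apply: cvgM; [exact: cvg_cst|exact: continuous_ln].
  apply: cvgM; last by apply: continuous_comp; [exact: cl|exact: cp].
  apply: continuous_comp; last exact: continuous_expR.
  by apply: cvgB; [exact: cl|exact: cvg_id].
have E (v : R) : expR ((complex.Re z - 1) * ln (expR v) - expR v) * expR v = rk (complex.Re z) v.
  by rewrite expRK -expRD; congr expR; ring.
congr Complex.
  transitivity (\int[mu]_(t in `]0, +oo[) (expR ((complex.Re z - 1) * ln t - t) *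
     cos (complex.Im z * ln t))).
    by apply: eq_Rintegral => t t0; rewrite cpE//; move: t0; rewrite inE/= in_itv/= andbT.
  rewrite (subst_expR ltr01); last by move=> t t0; apply: cont => //; exact: continuous_cos.
  by apply: eq_Rintegral => v _; rewrite !mul1r mulrAC E gkE expRK.
transitivity (\int[mu]_(t in `]0, +oo[) (expR ((complex.Re z - 1) * ln t - t) *
   sin (complex.Im z * ln t))).
  by apply: eq_Rintegral => t t0; rewrite cpE//; move: t0; rewrite inE/= in_itv/= andbT.
rewrite (subst_expR ltr01); last by move=> t t0; apply: cont => //; exact: continuous_sin.
by apply: eq_Rintegral => v _; rewrite !mul1r mulrAC E gkE expRK.
Qed.

Lemma GammaE z : 0 < complex.Re z -> Gamma z = GI z.
Proof.
by move=> z0; rewrite /Gamma z0 /= addr0 big_ord0 divr1 Gamma_integralE.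
Qed.

Lemma gk_vanish z : 0 < complex.Re z ->
  ccvg (fun n => gk z n%:R) 0 /\ ccvg (fun n => gk z (- n%:R)) 0.
Proof.
move=> z0; have [C [k [C0 k0 h]]] := rk_le z0.
have c0 : (fun n : nat => C * expR (- (k * n%:R))) @ \oo --> (0 : R).
  rewrite -(mulr0 C); apply: cvgM; first exact: cvg_cst.
  exact: cvg_expR_natN.
split; apply: ccvg_squeeze c0 => n; rewrite subr0 nc_gk (le_trans (h _))//.
  by rewrite ger0_norm.
by rewrite normrN ger0_norm.
Qed.

(** Integration by parts, in the form that [gk z] vanishes at both ends and has derivative
    [z * gk z v - gk (z + 1) v]. *)
Lemma GI_succ z : 0 < complex.Re z -> GI (z + 1) = z * GI z.
Proof.
move=> z0; have z10 : 0 < complex.Re (z + 1) by rewrite ReD addr_gt0.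
have dE (v : R) : is_derive v 1 (rk (complex.Re z))
    (rk (complex.Re z) v * (complex.Re z - expR v)).
  by rewrite /rk; apply: is_derive_eq; rewrite /GRing.scale /=; ring.
have D v : cder (gk z) v (z * gk z v - gk (z + 1) v).
  have E : gk (z + 1) v = gk z v * (expR v)%:C by rewrite gkD mul1r ce_real.
  rewrite E; split; under eq_fun do rewrite gkE/=.
    rewrite ReB !ReM gkE /=; apply: is_derive_eq; rewrite /GRing.scale /=; ring.
  rewrite ImB !ImM gkE /=; apply: is_derive_eq; rewrite /GRing.scale /=; ring.
have [p m] := gk_vanish z0.
have := cFTC_R _ _ D p m; rewrite subr0 CIB ?CIZ; try exact: gk_cig; last first.
  by apply: cigZ; exact: gk_cig.
move=> H; apply/esym/eqP; rewrite -subr_eq0; apply/eqP; apply: H.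
  apply: ccontD; first by apply: ccontM; [exact: ccont_cst|exact: gk_cont].
  have : ccont (fun v => -1 * gk (z + 1) v).
    by apply: ccontM; [exact: ccont_cst|exact: gk_cont].
  by under eq_fun do rewrite mulN1r.
by apply: cigB; [apply: cigZ; exact: gk_cig|exact: gk_cig].
Qed.

(** From [z] to [z + 1] the number of shifts in the definition drops by one, unless it is already
    zero, and the divisor lost is [z]. At the poles -1, -2, ... both sides are the junk value 0. *)
Lemma Gamma_succ z : z != 0 -> Gamma (z + 1) = z * Gamma z.
Proof.
move=> z0; have [zp|zp] := ltP 0 (complex.Re z).
  by rewrite !GammaE ?GI_succ// ReD addr_gt0.
have [h|h] := ltP 0 (complex.Re (z + 1)); move: (h); rewrite ReD /= => h'.
  rewrite GammaE// /Gamma ltNge zp /=.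
  rewrite (_ : Num.truncn _ = 0%N); last first.
    by apply: truncn_def; lra.
  rewrite big_ord_recl big_ord0 mulr1 /= addr0 Gamma_integralE mulrCA mulfV ?mulr1//.
rewrite /Gamma !ltNge h zp /=.
have := @truncn_itv _ (- complex.Re z); rewrite oppr_ge0 => /(_ zp).
case: (Num.truncn (- complex.Re z)) => [mh|m]; first by exfalso; lra.
move=> mh0; have mh : (m%:R + 1 <= - complex.Re z < m%:R + 1 + 1)%R by rewrite !natr1.
have mE : Num.truncn (- complex.Re (z + 1)) = m.
  by apply: truncn_def; rewrite ReD /= -natr1; lra.
rewrite mE [in RHS]big_ord_recl/= addr0 invfM [RHS]mulrCA (mulrA z) mulfV// mul1r.
congr (_ * _); first by rewrite -addrA nat1r.
congr (_^-1); apply: eq_bigr => i _.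
by rewrite /bump /= -addrA nat1r.
Qed.

Lemma Gamma_addn z n : (forall k, (k < n)%N -> z + k%:R != 0) ->
  Gamma (z + n%:R) = (\prod_(k < n) (z + k%:R)) * Gamma z.
Proof.
elim: n => [_|n IH h]; first by rewrite addr0 big_ord0 mul1r.
rewrite -natr1 addrA Gamma_succ ?h// IH; last by move=> k kn; apply: h; exact: ltnW.
by rewrite big_ord_recr /= mulrA (mulrC (z + _)).
Qed.

Lemma GI_conj z : 0 < complex.Re z -> GI (conjc z) = conjc (GI z).
Proof.
move=> z0; rewrite /GI -CI_conj; last exact: gk_cig.
by apply: eq_CI => v; rewrite !gkE; case: z z0 => a b _ /=; rewrite mulNr cosN sinN mulrN.
Qed.

End GammaKernel.


(** * Quantitative holomorphy *)

Section QuadraticDerivative.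
Context {R : realType}.
Local Notation mu := (@lebesgue_measure R).

Lemma quad_is_derive (f : R -> R) (x l : R) :
  (exists M : R, \forall y \near x, `|f y - f x - l * (y - x)| <= M * `|y - x| ^+ 2) ->
  is_derive x 1 f l.
Proof.
move=> [M hM].
have H : (fun h => h^-1 *: (f (h *: (1 : R) + x) - f x)) @ 0^' --> l.
  apply/cvgrPdist_le => e e0.
  pose D := `|M| + 1; have D0 : 0 < D by rewrite ltr_pwDr.
  have {}hM : \forall h \near (0 : R), `|f (h + x) - f x - l * h| <= M * `|h| ^+ 2.
    move/nbhs_ballP : hM => [r /= r0 hr]; apply/nbhs_ballP; exists r => //= h.
    rewrite /ball/= sub0r normrN => hb; have := hr (h + x).
    by rewrite /ball/= addrK opprD addrCA subrr addr0 normrN; apply.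
  near=> h.
  have h0 : h != 0 by near: h; exact: nbhs_dnbhs_neq.
  rewrite /= scaler1 distrC.
  have -> : h^-1 *: (f (h + x) - f x) - l = h^-1 * (f (h + x) - f x - l * h).
    by rewrite /GRing.scale /=; field.
  rewrite normrM normfV ler_pdivrMl ?normr_gt0//.
  have /le_trans -> // : `|f (h + x) - f x - l * h| <= M * `|h| ^+ 2.
    by near: h; exact: nbhs_dnbhs.
  rewrite expr2 mulrCA ler_wpM2l//.
  have hs : `|h| <= e / D.
    near: h; apply: nbhs_dnbhs; apply/nbhs_ballP; exists (e / D) => /=.
      by rewrite divr_gt0.
    by move=> h; rewrite /ball/= sub0r normrN => /ltW.
  move: hs; rewrite ler_pdivlMr// => /(le_trans _); apply.
  by rewrite mulrC ler_wpM2l// (le_trans (ler_norm _))// lerDl.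
split.
  by apply/cvg_ex; exists l.
exact/cvg_lim.
Unshelve. all: end_near. Qed.

Lemma quad_cder (f : R -> R[i]) (x : R) (l : R[i]) :
  (exists M : R, \forall y \near x, nc (f y - f x - l * (y - x)%:C) <= M * `|y - x| ^+ 2) ->
  cder f x l.
Proof.
move=> [M hM]; split; apply: quad_is_derive; exists M; apply: filterS hM => y;
  apply: le_trans.
  rewrite (_ : _ - _ = complex.Re (f y - f x - l * (y - x)%:C)) ?nc_Re//.
  by rewrite !ReB ReM /= mulr0 subr0.
rewrite (_ : _ - _ = complex.Im (f y - f x - l * (y - x)%:C)) ?nc_Im//.
by rewrite !ImB ImM /= mulr0 add0r.
Qed.

(** Differentiability is asked inside the interval only: the functions built with [clamp] below have
    corners at its ends. *)
Lemma FTC_oo (f F : R -> R) (a b : R) : a <= b -> continuous f -> continuous F ->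
  (forall x : R, a < x < b -> is_derive x 1 F (f x)) ->
  \int[mu]_(x in `[a, b]) f x = F b - F a.
Proof.
rewrite le_eqVlt => /predU1P[-> _ _ _|ab cf cF dF].
  by rewrite set_itv1 Rintegral_set1 subrr.
rewrite /Rintegral (continuous_FTC2 ab (cont_within cf) (F := F))//.
  split; first by move=> x; rewrite in_itv/= => xab; apply: ex_derive; exact: dF.
    by apply: cvg_at_right_filter; exact: cF.
  by apply: cvg_at_left_filter; exact: cF.
by move=> x; rewrite in_itv/= derive1E => xab; have := dF _ xab => ?; exact: derive_val.
Qed.

Lemma cFTC_oo (f F : R -> R[i]) (a b : R) : a <= b -> ccont f -> ccont F ->
  (forall x : R, a < x < b -> cder F x (f x)) ->
  cintegral `[a, b] f = F b - F a.
Proof.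
move=> ab [c1 c2] [C1 C2] dF; apply: complex_ext.
  by rewrite ReB; exact: (FTC_oo ab c1 C1 (fun x xab => (dF x xab).1)).
by rewrite ImB; exact: (FTC_oo ab c2 C2 (fun x xab => (dF x xab).2)).
Qed.

Lemma citvD (f g : R -> R[i]) (a b : R) : ccont f -> ccont g ->
  cintegral `[a, b] (fun x => f x + g x) = cintegral `[a, b] f + cintegral `[a, b] g.
Proof.
move=> [f1 f2] [g1 g2]; apply: complex_ext.
  rewrite ReD /cintegral/= -RintegralD//; try exact: cont_itv_intg.
  by apply: eq_Rintegral => x _; rewrite ReD.
rewrite ImD /cintegral/= -RintegralD//; try exact: cont_itv_intg.
by apply: eq_Rintegral => x _; rewrite ImD.
Qed.

Lemma citvZ (c : R[i]) (f : R -> R[i]) (a b : R) : ccont f ->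
  cintegral `[a, b] (fun x => c * f x) = c * cintegral `[a, b] f.
Proof.
move=> [f1 f2].
have Z (k : R) (p : R -> R) : continuous p -> continuous (fun x => k * p x).
  by move=> cp x; apply: cvgM; [exact: cvg_cst|exact: cp].
apply: complex_ext.
  rewrite ReM /cintegral/= -!RintegralZl//; try exact: cont_itv_intg.
  rewrite -RintegralB//; try by apply: cont_itv_intg; exact: Z.
  by apply: eq_Rintegral => x _; rewrite ReM.
rewrite ImM /cintegral/= -!RintegralZl//; try exact: cont_itv_intg.
rewrite -RintegralD//; try by apply: cont_itv_intg; exact: Z.
by apply: eq_Rintegral => x _; rewrite ImM.
Qed.

Lemma ccontZ (c : R[i]) (f : R -> R[i]) : ccont f -> ccont (fun x => c * f x).
Proof. by move=> cf; apply: ccontM => //; exact: ccont_cst. Qed.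

Lemma ccontB (f g : R -> R[i]) : ccont f -> ccont g -> ccont (fun x => f x - g x).
Proof.
move=> cf cg; have := ccontD cf (ccontZ (-1) cg).
by under eq_fun do rewrite mulN1r.
Qed.

Lemma citvB (f g : R -> R[i]) (a b : R) : ccont f -> ccont g ->
  cintegral `[a, b] (fun x => f x - g x) = cintegral `[a, b] f - cintegral `[a, b] g.
Proof.
move=> cf cg; rewrite -mulN1r -citvZ// -citvD//; last exact: ccontZ.
by congr cintegral; apply/funext => x; rewrite mulN1r.
Qed.

Lemma eq_citv (f g : R -> R[i]) (a b : R) : (forall t, a <= t <= b -> f t = g t) ->
  cintegral `[a, b] f = cintegral `[a, b] g.
Proof.
by move=> fg; congr Complex; apply: eq_Rintegral => t; rewrite inE/= in_itv/= => /fg ->.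
Qed.

Lemma citv_le (f : R -> R[i]) (a b M : R) : a <= b -> ccont f ->
  (forall t, a <= t <= b -> nc (f t) <= M) ->
  nc (cintegral `[a, b] f) <= 2 * M * (b - a).
Proof.
move=> ab [f1 f2] hM.
have H (p : R -> R) : continuous p -> (forall t, a <= t <= b -> `|p t| <= M) ->
    `|\int[mu]_(t in `[a, b]) p t| <= M * (b - a).
  move=> cp pM; apply: (le_trans (le_normr_Rintegral _ (cont_itv_intg _ _ cp))) => //.
  rewrite (_ : M * (b - a) = \int[mu]_(t in `[a, b]) M); last first.
    by rewrite Rintegral_cst//= lebesgue_measure_itv/= lte_fin; case: ltgtP ab => //= -> _;
       rewrite subrr.
  apply: le_Rintegral => //.
  - by apply: cont_itv_intg => x; apply: cvg_norm; exact: cp.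
  - by apply: cont_itv_intg => x; exact: cvg_cst.
apply: (le_trans (nc_le _)).
rewrite (_ : 2 * M * (b - a) = M * (b - a) + M * (b - a)); last by ring.
by rewrite lerD// H// => t tab; rewrite (le_trans _ (hM t tab))// ?nc_Re ?nc_Im.
Qed.

End QuadraticDerivative.

Section Nice.
Context {R : realType}.
Implicit Types (K : set R[i]) (F G : R[i] -> R[i]) (z w : R[i]).

(* Holomorphy is only used through a second-order Taylor estimate that is uniform
   on K; it is stable under products and inverses, whatever the shape of K. *)
Definition nice_with K F F' (C : R) :=
  [/\ 0 <= C, forall z, K z -> nc (F z) <= C, forall z, K z -> nc (F' z) <= C &
   forall z w, K z -> K w -> nc (F w - F z - F' z * (w - z)) <= C * nc (w - z) ^+ 2].

Definition nice K F := exists F' C, nice_with K F F' C.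

Lemma nice_withW K F F' C D : C <= D -> nice_with K F F' C -> nice_with K F F' D.
Proof.
move=> CD [C0 b b' q]; split; first exact: le_trans CD.
- by move=> z Kz; rewrite (le_trans (b z Kz)).
- by move=> z Kz; rewrite (le_trans (b' z Kz)).
- by move=> z w Kz Kw; rewrite (le_trans (q z w Kz Kw))// ler_wpM2r// exprn_ge0// nc_ge0.
Qed.

Lemma nice_sub K K' F : K' `<=` K -> nice K F -> nice K' F.
Proof.
move=> s [F' [C [C0 b b' q]]]; exists F', C; split => // z; first by move=> /s; exact: b.
  by move=> /s; exact: b'.
by move=> w /s Kz /s Kw; exact: q.
Qed.

Lemma nice_eq K F G : (forall z, K z -> F z = G z) -> nice K F -> nice K G.
Proof.
move=> e [F' [C [C0 b b' q]]]; exists F', C; split => // z.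
  by move=> Kz; rewrite -e//; exact: b.
by move=> w Kz Kw; rewrite -!e//; exact: q.
Qed.

(** [K] is arbitrary, so no path in it joins [z] to [w]: the Taylor estimate is used at distance at
    most 1, and the bound on [F] beyond. *)
Lemma nice_lip K F F' C z w : nice_with K F F' C -> K z -> K w ->
  nc (F w - F z) <= 2 * C * nc (w - z).
Proof.
move=> [C0 b b' q] Kz Kw; have [h|/ltW h] := leP 1 (nc (w - z)).
  rewrite (le_trans (ncB _ _))// (le_trans (lerD (b w Kw) (b z Kz)))//.
  rewrite (_ : C + C = 2 * C * 1); last by ring.
  by rewrite ler_wpM2l// mulr_ge0.
rewrite -(subrK (F' z * (w - z)) (F w - F z)) (le_trans (ncD _ _))//.
rewrite (_ : 2 * C * nc (w - z) = C * nc (w - z) + C * nc (w - z)); last by ring.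
rewrite lerD// ?ncM ?ler_wpM2r ?nc_ge0 ?b'//.
rewrite (le_trans (q z w Kz Kw))// ler_wpM2l// expr2.
by rewrite -[leRHS]mulr1 ler_wpM2l ?nc_ge0.
Qed.

(** The Taylor estimates from [z] to [w] and from [w] to [z] add up to one for
    [(F' w - F' z) * (w - z)], since the increments of [F] cancel. *)
Lemma nice_lip' K F F' C z w : nice_with K F F' C -> K z -> K w ->
  nc (F' w - F' z) <= 2 * C * nc (w - z).
Proof.
move=> [C0 b b' q] Kz Kw; have [->|wz] := eqVneq w z.
  by rewrite subrr nc0 mulr_ge0 ?mulr_ge0// nc_ge0.
have h : 0 < nc (w - z) by rewrite nc_gt0 subr_eq0.
rewrite -(ler_pM2r h) -ncM.
rewrite (_ : _ * _ = - ((F w - F z - F' z * (w - z)) * -1 + -1 * (F z - F w - F' w * (z - w))));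
  last by ring.
rewrite ncN (le_trans (ncD _ _))// !ncM ncN nc1 mul1r mulr1.
rewrite (_ : 2 * C * _ * _ = C * nc (w - z) ^+ 2 + C * nc (z - w) ^+ 2).
  by rewrite lerD ?q.
by rewrite (ncC z w); ring.
Qed.

Lemma niceM K F G : nice K F -> nice K G -> nice K (fun z => F z * G z).
Proof.
move=> [F' [C1 n1]] [G' [C2 n2]].
pose C := C1 + C2.
have C10 : 0 <= C1 by case: n1.
have C20 : 0 <= C2 by case: n2.
have {}n1 : nice_with K F F' C by apply: nice_withW n1; rewrite lerDl.
have {}n2 : nice_with K G G' C by apply: nice_withW n2; rewrite lerDr.
have [C0 bF bF' qF] := n1; have [_ bG bG' qG] := n2.
exists (fun z => F' z * G z + F z * G' z), (4 * C ^+ 2); split.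
- by rewrite mulr_ge0// sqr_ge0.
- move=> z Kz; rewrite ncM (@le_trans _ _ (C * C))//.
    by rewrite ler_pM ?nc_ge0 ?bF ?bG.
  by rewrite -expr2 ler_peMl ?sqr_ge0// ler1n.
- move=> z Kz; rewrite (le_trans (ncD _ _))// !ncM.
  rewrite (@le_trans _ _ (C * C + C * C))//.
    by rewrite lerD// ler_pM ?nc_ge0 ?bF ?bG ?bF' ?bG'.
  by have := sqr_ge0 C; rewrite expr2; lra.
- move=> z w Kz Kw.
  rewrite (_ : _ - _ - _ = (F w - F z - F' z * (w - z)) * G w
     + F' z * (w - z) * (G w - G z) + F z * (G w - G z - G' z * (w - z))); last by ring.
  have lG := nice_lip n2 Kz Kw.
  have h0 := nc_ge0 (w - z).
  rewrite (le_trans (ncD _ _))// (le_trans (lerD (ncD _ _) (lexx _)))// !ncM.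
  rewrite (_ : 4 * C ^+ 2 * nc (w - z) ^+ 2 = (C * nc (w - z) ^+ 2) * C +
    (C * nc (w - z)) * (2 * C * nc (w - z)) + C * (C * nc (w - z) ^+ 2)); last by ring.
  rewrite !lerD//; apply: ler_pM; rewrite ?mulr_ge0 ?nc_ge0 ?qF ?qG ?bG ?bF//.
  by rewrite ler_wpM2r// bF'.
Qed.

Lemma niceV K F (c : R) : 0 < c -> (forall z, K z -> c <= nc (F z)) ->
  nice K F -> nice K (fun z => (F z)^-1).
Proof.
move=> c0 cF [F' [C n1]]; have [C0 bF bF' qF] := n1.
have F0 z : K z -> F z != 0 by move=> Kz; rewrite -nc_gt0 (lt_le_trans c0)// cF.
have iF z : K z -> (nc (F z))^-1 <= c^-1.
  by move=> Kz; rewrite lef_pV2 ?posrE ?cF// (lt_le_trans c0)// cF.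
have ci : 0 < c^-1 by rewrite invr_gt0.
have iF0 z : 0 <= (nc (F z))^-1 by rewrite invr_ge0 nc_ge0.
exists (fun z => - F' z / F z ^+ 2), (c^-1 + C * (c^-1) ^+ 2 + 3 * C ^+ 2 * (c^-1) ^+ 3).
have t1 : 0 <= C * (c^-1) ^+ 2 by rewrite mulr_ge0// sqr_ge0.
have t2 : 0 <= 3 * C ^+ 2 * (c^-1) ^+ 3 by apply: mulr_ge0; [apply: mulr_ge0 => //; exact: sqr_ge0|exact/exprn_ge0/ltW].
split.
- by rewrite !addr_ge0// ltW.
- by move=> z Kz; rewrite ncV (le_trans (iF z Kz))// -addrA lerDl addr_ge0.
- move=> z Kz; rewrite ncM ncN ncV ncX -exprVn.
  rewrite (@le_trans _ _ (C * (c^-1) ^+ 2))//; last by lra.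
  by rewrite ler_pM ?nc_ge0 ?sqr_ge0 ?bF'// lerXn2r ?nnegrE ?iF ?iF0 ?(ltW ci).
- move=> z w Kz Kw.
  rewrite (_ : _ - _ - _ = (- ((F w - F z - F' z * (w - z)) * F z) +
    F' z * (w - z) * (F w - F z)) * ((F w)^-1 * (F z)^-1 ^+ 2)); last first.
    by field; rewrite !F0.
  have lG := nice_lip n1 Kz Kw.
  have h0 := nc_ge0 (w - z).
  rewrite ncM (@le_trans _ _ ((3 * C ^+ 2 * nc (w - z) ^+ 2) * (c^-1) ^+ 3))//; last first.
    rewrite (mulrAC _ (nc (w - z) ^+ 2)) ler_wpM2r ?sqr_ge0//.
    by rewrite lerDr addr_ge0// ltW.
  apply: ler_pM; rewrite ?nc_ge0//.
    rewrite (le_trans (ncD _ _))// ncN !ncM.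
    rewrite (_ : 3 * C ^+ 2 * nc (w - z) ^+ 2 = (C * nc (w - z) ^+ 2) * C +
      (C * nc (w - z)) * (2 * C * nc (w - z))); last by ring.
    rewrite lerD//; apply: ler_pM; rewrite ?mulr_ge0 ?nc_ge0 ?qF ?bF//.
    by rewrite ler_wpM2r// bF'.
  rewrite ncM ncX !ncV [leRHS]exprS; apply: ler_pM; rewrite ?sqr_ge0 ?iF0 ?iF//.
  by rewrite lerXn2r ?nnegrE ?iF ?iF0 ?(ltW ci).
Qed.

Lemma nice_cst K (c : R[i]) : nice K (fun=> c).
Proof.
exists (fun=> 0), (nc c); split => [|//|z _|z w _ _]; rewrite ?nc_ge0 ?nc0 ?nc_ge0//.
by rewrite subrr mul0r subr0 nc0 mulr_ge0 ?sqr_ge0 ?nc_ge0.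
Qed.

Lemma nice_prod (I : Type) (s : seq I) (F : I -> R[i] -> R[i]) K :
  (forall i, nice K (F i)) -> nice K (fun z => \prod_(i <- s) F i z).
Proof.
move=> h; elim: s => [|i s IH].
  by apply: nice_eq (nice_cst K 1) => z _; rewrite big_nil.
by apply: nice_eq (niceM (h i) IH) => z _; rewrite big_cons.
Qed.

(** The Taylor remainder of the inverse is exactly (w - z)^2 / ((w + a) (z + a)^2), so [K] may be
    unbounded, whereas [niceV] would ask for z + a to be bounded on it. *)
Lemma nice_addV K (a : R[i]) (c : R) : 0 < c -> (forall z, K z -> c <= nc (z + a)) ->
  nice K (fun z => (z + a)^-1).
Proof.
move=> c0 h; have ci : 0 < c^-1 by rewrite invr_gt0.
have F0 z : K z -> z + a != 0 by move=> Kz; rewrite -nc_gt0 (lt_le_trans c0)// h.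
have iF z : K z -> (nc (z + a))^-1 <= c^-1.
  by move=> Kz; rewrite lef_pV2 ?posrE ?h// (lt_le_trans c0)// h.
have iF0 z : 0 <= (nc (z + a))^-1 by rewrite invr_ge0 nc_ge0.
have := exprn_ge0 2 (ltW ci); have := exprn_ge0 3 (ltW ci) => e3 e2.
exists (fun z => - (z + a)^-1 ^+ 2), (c^-1 + (c^-1) ^+ 2 + (c^-1) ^+ 3); split.
- by rewrite !addr_ge0// ltW.
- by move=> z Kz; rewrite ncV (le_trans (iF z Kz))// -addrA lerDl addr_ge0.
- move=> z Kz; rewrite ncN ncX ncV (@le_trans _ _ (c^-1 ^+ 2))//; last by lra.
  by rewrite lerXn2r ?nnegrE ?iF ?iF0 ?(ltW ci).
- move=> z w Kz Kw.
  rewrite (_ : _ - _ - _ = (w - z) ^+ 2 * ((w + a)^-1 * (z + a)^-1 ^+ 2)); last first.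
    by field; rewrite !F0.
  rewrite ncM ncX mulrC ler_wpM2r ?sqr_ge0 ?nc_ge0//.
  rewrite ncM ncX !ncV (@le_trans _ _ (c^-1 * c^-1 ^+ 2))//; last by rewrite -exprS; lra.
  by apply: ler_pM; rewrite ?sqr_ge0 ?iF0 ?iF// lerXn2r ?nnegrE ?iF ?iF0 ?(ltW ci).
Qed.

(* e = 1 or -1, for the two families of factors Gamma (a + s) and Gamma (a - s). *)
Lemma nice_affine K K' F (a e : R[i]) : e ^+ 2 = 1 ->
  (forall z, K' z -> K (a + e * z)) -> nice K F -> nice K' (fun z => F (a + e * z)).
Proof.
move=> e1 s [F' [C [C0 b b' q]]].
have ne : nc e = 1.
  apply/eqP; rewrite -(@pexpr_eq1 _ _ 2) ?nc_ge0//.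
  by rewrite -ncX e1 nc1.
exists (fun z => e * F' (a + e * z)), C; split => //.
- by move=> z /s; exact: b.
- by move=> z /s Kz; rewrite ncM ne mul1r b'.
- move=> z w /s Kz /s Kw; have := q _ _ Kz Kw.
  rewrite (_ : a + e * w - (a + e * z) = e * (w - z)); last by ring.
  by rewrite ncM ne mul1r mulrA (mulrC _ e).
Qed.

End Nice.


(** * Linear approximation and the chain rule along a curve *)

Section EpsDerivative.
Context {R : realType}.

Lemma is_derive_eps (f : R -> R) (x l : R) : is_derive x 1 f l ->
  forall e, 0 < e -> \forall y \near x, `|f y - f x - l * (y - x)| <= e * `|y - x|.
Proof.
move=> df e e0.
have /cvg_ex[/= l' fl'] : derivable f x 1 by exact: ex_derive.
have ll : l = l'.
  have <- : 'D_1 f x = l by exact: derive_val.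
  exact/cvg_lim.
have /cvgrPdist_le/(_ _ e0)/nbhs_ballP[r /= r0 hr] := fl'.
apply/nbhs_ballP; exists r => //= y; rewrite /ball/= => xy.
have [->|yx] := eqVneq y x; first by rewrite !subrr mulr0 subrr normr0 mulr0.
have yx0 : y - x != 0 by rewrite subr_eq0.
have := hr (y - x); rewrite /ball/= sub0r normrN distrC => /(_ xy yx0).
rewrite scaler1 subrK -ll (distrC l).
have -> : (y - x)^-1 *: (f y - f x) - l = (y - x)^-1 * (f y - f x - l * (y - x)).
  by rewrite /GRing.scale /=; field.
by rewrite normrM normfV (distrC x) ler_pdivrMl ?normr_gt0// (mulrC e).
Qed.

Lemma eps_is_derive (f : R -> R) (x l : R) :
  (forall e, 0 < e -> \forall y \near x, `|f y - f x - l * (y - x)| <= e * `|y - x|) ->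
  is_derive x 1 f l.
Proof.
move=> hf.
have H : (fun h => h^-1 *: (f (h *: (1 : R) + x) - f x)) @ 0^' --> l.
  apply/cvgrPdist_le => e e0.
  have /nbhs_ballP[r /= r0 hr] := hf _ e0.
  apply/nbhs_ballP; exists r => //= h; rewrite /ball/= sub0r normrN => hb h0.
  rewrite scaler1 distrC.
  have -> : h^-1 *: (f (h + x) - f x) - l = h^-1 * (f (h + x) - f x - l * h).
    by rewrite /GRing.scale /=; field.
  rewrite normrM normfV ler_pdivrMl ?normr_gt0// [leRHS]mulrC.
  by have := hr (h + x); rewrite /ball/= addrK opprD addrCA subrr addr0 normrN; apply.
by split; [apply/cvg_ex; exists l|exact/cvg_lim].
Qed.

Lemma near_norm_sub (x r : R) : 0 < r -> \forall y \near x, `|y - x| <= r.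
Proof.
move=> r0; apply/nbhs_ballP; exists r => //= y; rewrite /ball/= distrC.
by move=> /ltW.
Qed.

(** The curve is only assumed differentiable, so its increments are estimated for every epsilon;
    only [P] has a quadratic remainder. *)
Lemma chain_cder (P : R[i] -> R[i]) (gamma : R -> R[i]) (x : R) (l dg : R[i]) :
  (exists M r, 0 < r /\ forall z, nc (z - gamma x) < r ->
     nc (P z - P (gamma x) - l * (z - gamma x)) <= M * nc (z - gamma x) ^+ 2) ->
  cder gamma x dg -> cder (fun t => P (gamma t)) x (l * dg).
Proof.
move=> [M [r [r0 hP]]] [d1 d2].
have eps e : 0 < e -> \forall y \near x,
    nc (gamma y - gamma x - dg * (y - x)%:C) <= e * `|y - x|.
  move=> e0; have e20 : 0 < e / 2 by rewrite divr_gt0.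
  have h1 := is_derive_eps d1 e20; have h2 := is_derive_eps d2 e20.
  near=> y; rewrite (le_trans (nc_le _))// (splitr e) mulrDl lerD//.
    by rewrite !ReB ReM /= mulr0 subr0; near: y.
  by rewrite !ImB ImM /= mulr0 add0r; near: y.
have A0 : 0 < nc dg + 1 by rewrite ltr_wpDl ?nc_ge0.
have lip : \forall y \near x, nc (gamma y - gamma x) <= (nc dg + 1) * `|y - x|.
  have h1 := eps _ ltr01; near=> y.
  rewrite -(subrK (dg * (y - x)%:C) (gamma y - gamma x)) (le_trans (ncD _ _))//.
  rewrite ncM nc_real mulrDl addrC lerD2l.
  by near: y.
have B0 : 0 < `|M| * (nc dg + 1) ^+ 2 + 1 by rewrite ltr_wpDl// mulr_ge0// sqr_ge0.
have L0 : 0 < nc l + 1 by rewrite ltr_wpDl ?nc_ge0.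
have key e : 0 < e -> \forall y \near x,
    nc (P (gamma y) - P (gamma x) - l * dg * (y - x)%:C) <= e * `|y - x|.
  move=> e0.
  have e1 : 0 < e / 2 / (nc l + 1) by rewrite !divr_gt0.
  have e2 : 0 < e / 2 / (`|M| * (nc dg + 1) ^+ 2 + 1) by rewrite !divr_gt0.
  have e3 : 0 < r / 2 / (nc dg + 1) by rewrite !divr_gt0.
  have h1 := eps _ e1; have h2 := near_norm_sub x e2; have h3 := near_norm_sub x e3.
  near=> y.
  have l1 : nc (gamma y - gamma x) <= (nc dg + 1) * `|y - x| by near: y.
  have b2 : `|y - x| <= e / 2 / (`|M| * (nc dg + 1) ^+ 2 + 1) by near: y.
  have b3 : `|y - x| <= r / 2 / (nc dg + 1) by near: y.
  have b1 : nc (gamma y - gamma x - dg * (y - x)%:C) <= e / 2 / (nc l + 1) * `|y - x|.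
    by near: y.
  have gr : nc (gamma y - gamma x) < r.
    move: b3; rewrite ler_pdivlMr// mulrC => b3.
    by rewrite (le_lt_trans l1)// (le_lt_trans b3)// ltr_pdivrMr// ltr_pMr// ltr1n.
  rewrite (_ : _ - _ - _ = (P (gamma y) - P (gamma x) - l * (gamma y - gamma x))
    + l * (gamma y - gamma x - dg * (y - x)%:C)); last by ring.
  rewrite (le_trans (ncD _ _))// (splitr e) mulrDl lerD//.
    rewrite (le_trans (hP _ gr))// (@le_trans _ _ (`|M| * ((nc dg + 1) * `|y - x|) ^+ 2))//.
      rewrite (@le_trans _ _ (`|M| * nc (gamma y - gamma x) ^+ 2))//.
        by rewrite ler_wpM2r ?sqr_ge0// ler_norm.
      by rewrite ler_wpM2l// lerXn2r ?nnegrE ?nc_ge0 ?mulr_ge0// ltW.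
    rewrite exprMn mulrA (expr2 `|y - x|) mulrA ler_wpM2r//.
    move: b2; rewrite ler_pdivlMr// => b2; rewrite (le_trans _ b2)//.
    by rewrite mulrC ler_wpM2l// lerDl.
  rewrite ncM (@le_trans _ _ ((nc l + 1) * (e / 2 / (nc l + 1) * `|y - x|)))//.
    by rewrite ler_pM ?nc_ge0// lerDl.
  by rewrite mulrA mulrCA mulfV ?mulr1// gt_eqF.
split; apply: eps_is_derive => e e0; apply: filterS (key _ e0) => y; apply: le_trans.
  rewrite (_ : _ - _ = complex.Re (P (gamma y) - P (gamma x) - l * dg * (y - x)%:C)) ?nc_Re//.
  by rewrite !ReB (ReM (l * dg)) /= mulr0 subr0.
rewrite (_ : _ - _ = complex.Im (P (gamma y) - P (gamma x) - l * dg * (y - x)%:C)) ?nc_Im//.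
by rewrite !ImB (ImM (l * dg)) /= mulr0 add0r.
Unshelve. all: end_near. Qed.

End EpsDerivative.

(** * Primitives and contours in star-shaped domains *)

Section Primitive.
Context {R : realType}.
Implicit Types (F : R[i] -> R[i]) (s z : R[i]).

(** Projection onto [0, 1]: it extends the integrands along a segment to continuous functions on the
    whole line, as [ccont] asks, without leaving the segment. *)
Definition clamp (t : R) : R := Num.max 0 (Num.min t 1).

Lemma clamp_id t : 0 <= t <= 1 -> clamp t = t.
Proof. by move=> /andP[t0 t1]; rewrite /clamp min_l// max_r. Qed.

Lemma clamp_itv t : 0 <= clamp t <= 1.
Proof. by rewrite /clamp le_max lexx ge_max ler01 ge_min lexx orbT. Qed.

Lemma clamp_lip x y : `|clamp x - clamp y| <= `|x - y|.
Proof.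
have H (a b : R) : a <= b -> 0 <= clamp b - clamp a <= b - a.
  by move=> ab; rewrite /clamp; case: (leP b 1) => b1; case: (leP a 1) => a1;
    case: (leP 0 b) => b0; case: (leP 0 a) => a0; rewrite ?(max_r (@ler01 R));
    apply/andP; split; lra.
have [/H /andP[h1 h2]|/ltW/H /andP[h1 h2]] := leP x y.
  by rewrite distrC ger0_norm// (le_trans h2)// distrC ler_norm.
by rewrite ger0_norm// (le_trans h2)// ler_norm.
Qed.

Definition prim F s z := cintegral `[0, 1] (fun t : R => F (s + t%:C * (z - s)) * (z - s)).

Lemma prim_quad F s z0 (r : R) (K : set R[i]) : 0 < r -> nice K F ->
  (forall z (t : R), nc (z - z0) < r -> 0 <= t <= 1 -> K (s + t%:C * (z - s))) ->
  exists M r, 0 < r /\ forall z, nc (z - z0) < r ->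
    nc (prim F s z - prim F s z0 - F z0 * (z - z0)) <= M * nc (z - z0) ^+ 2.
Proof.
move=> r0 [F' [C nF]] hK; have [C0 bF bF' qF] := nF.
pose f z t := F (s + (clamp t)%:C * (z - s)).
pose f' z t := F' (s + (clamp t)%:C * (z - s)).
have Kc z t : nc (z - z0) < r -> K (s + (clamp t)%:C * (z - s)).
  by move=> zr; apply: hK => //; exact: clamp_itv.
have step z x y : s + (clamp y)%:C * (z - s) - (s + (clamp x)%:C * (z - s)) =
    (clamp y - clamp x)%:C * (z - s) by rewrite rmorphB; ring.
have cstep z x y : nc (s + (clamp y)%:C * (z - s) - (s + (clamp x)%:C * (z - s))) <=
    nc (z - s) * `|y - x|.
  by rewrite step ncM nc_real mulrC ler_wpM2l ?nc_ge0 ?clamp_lip.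
have C20 : 0 <= 2 * C by rewrite mulr_ge0.
have cf z : nc (z - z0) < r -> ccont (f z).
  move=> zr; apply: ccont_dist => x; exists (2 * C * nc (z - s)); near=> y.
  by rewrite (le_trans (nice_lip nF (Kc _ _ zr) (Kc _ _ zr)))// -(mulrA (2 * C)) ler_wpM2l.
have cf' z : nc (z - z0) < r -> ccont (f' z).
  move=> zr; apply: ccont_dist => x; exists (2 * C * nc (z - s)); near=> y.
  by rewrite (le_trans (nice_lip' nF (Kc _ _ zr) (Kc _ _ zr)))// -(mulrA (2 * C)) ler_wpM2l.
have ct : ccont (fun t : R => t%:C) by apply: ccont_real => x; exact: cvg_id.
have z0r : nc (z0 - z0) < r by rewrite subrr nc0.
(* [g] is the derivative in z, at [z0], of the integrand (z - s) f z t, and also the derivative in t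
   of t f z0 t. By the second description its integral over [0, 1] is [F z0]. *)
pose g t := f z0 t + t%:C * f' z0 t * (z0 - s).
have cg : ccont g.
  apply: ccontD; first exact: cf.
  apply: ccontM; last exact: ccont_cst.
  by apply: ccontM; [exact: ct|exact: cf'].
have gE : cintegral `[0, 1] g = F z0.
  rewrite (@cFTC_oo _ g (fun t => t%:C * f z0 t) 0 1)//; last 2 first.
  - by apply: ccontM; [exact: ct|exact: cf].
  - move=> x /andP[x0 x1]; apply: quad_cder.
    exists (C * nc (z0 - s) ^+ 2 + 2 * C * nc (z0 - s)).
    have nx : \forall y \near x, 0 < y < 1.
      near=> y; apply/andP; split; near: y; [exact: lt_nbhsr|exact: lt_nbhsl].
    near=> y.
    have /andP[y0 y1] : 0 < y < 1 by near: y.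
    have xi : 0 <= x <= 1 by rewrite !ltW.
    have yi : 0 <= y <= 1 by rewrite !ltW.
    rewrite (_ : _ - _ - _ = x%:C * (f z0 y - f z0 x - f' z0 x * ((y - x)%:C * (z0 - s)))
       + (y - x)%:C * (f z0 y - f z0 x)); last by rewrite /g rmorphB; ring.
    rewrite (le_trans (ncD _ _))// mulrDl lerD//.
      rewrite ncM nc_real ger0_norm ?(ltW x0)//.
      have := qF _ _ (Kc z0 x z0r) (Kc z0 y z0r).
      rewrite step (clamp_id xi) (clamp_id yi) -/(f z0 _) => h.
      rewrite /f /f' (clamp_id xi) (clamp_id yi) -[leRHS]mul1r.
      apply: ler_pM; rewrite ?nc_ge0 ?(ltW x0) ?(ltW x1)//.
      by apply: (le_trans h); rewrite ncM nc_real exprMn mulrCA mulrC (mulrC C).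
    rewrite ncM nc_real expr2 (mulrA _ `|y - x|) [leRHS]mulrC ler_wpM2l//.
    rewrite (le_trans (nice_lip nF (Kc z0 x z0r) (Kc z0 y z0r)))//.
    by rewrite -(mulrA (2 * C)) ler_wpM2l.
  rewrite /f clamp_id ?lexx ?ler01// mul0r subr0 mul1r mul1r.
  by congr F; ring.
exists (2 * (C * nc (z0 - s) + 2 * C)), r; split => // z zr.
have primE w : nc (w - z0) < r -> prim F s w = cintegral `[0, 1] (fun t => (w - s) * f w t).
  by move=> wr; apply: eq_citv => t t01; rewrite /f clamp_id// mulrC.
rewrite (primE z zr) (primE z0 z0r) -gE mulrC -citvZ//.
rewrite -citvB; try (by apply: ccontZ; exact: cf).
rewrite -citvB; last 2 first.
- by apply: ccontB; apply: ccontZ; exact: cf.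
- exact: ccontZ.
rewrite (_ : 2 * _ * _ = 2 * ((C * nc (z0 - s) + 2 * C) * nc (z - z0) ^+ 2) * (1 - 0));
  last by ring.
apply: citv_le => //.
  by apply: ccontB; [apply: ccontB; apply: ccontZ; exact: cf|exact: ccontZ].
move=> t /[dup] t01 /andP[t0 t1].
rewrite (_ : _ - _ - _ = (f z t - f z0 t - f' z0 t * (t%:C * (z - z0))) * (z0 - s)
  + (f z t - f z0 t) * (z - z0)); last by rewrite /g; ring.
have st : s + (clamp t)%:C * (z - s) - (s + (clamp t)%:C * (z0 - s)) = t%:C * (z - z0).
  by rewrite clamp_id//; ring.
have nst : nc (t%:C * (z - z0)) <= nc (z - z0).
  by rewrite ncM nc_real ger0_norm// -[leRHS]mul1r ler_wpM2r ?nc_ge0.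
rewrite (le_trans (ncD _ _))// [leRHS]mulrDl !ncM lerD//.
  rewrite (mulrAC C) ler_wpM2r ?nc_ge0//.
  have := qF _ _ (Kc z0 t z0r) (Kc z t zr); rewrite st => /le_trans; apply.
  by rewrite ler_wpM2l// lerXn2r ?nnegrE ?nc_ge0.
rewrite expr2 mulrA ler_wpM2r ?nc_ge0//.
rewrite (le_trans (nice_lip nF (Kc z0 t z0r) (Kc z t zr)))// st.
by rewrite ler_wpM2l.
Unshelve. all: end_near. Qed.

End Primitive.


(** * The fundamental theorem with finitely many exceptional points *)

Section PiecewiseFTC.
Context {R : realType}.
Local Notation mu := (@lebesgue_measure R).

Lemma finite_exc_measurable (f : R -> R) (s : seq R) :
  (forall t, t \notin s -> {for t, continuous f}) -> measurable_fun setT f.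
Proof.
move=> cf; pose A : set R := [set` s].
have fs : finite_set A by exact: finite_seq.
have cs : closed A.
  by apply: (accessible_finite_set_closed.1 _ _ fs); apply: hausdorff_accessible.
rewrite -(setvU A); apply/measurable_funU.
- by apply: measurableC; exact: closed_measurable.
- exact: closed_measurable.
split.
  apply: open_continuous_measurable_fun; first exact: closed_openC.
  by move=> t; rewrite inE/= => /negP; exact: cf.
move=> _ Y mY; apply: countable_measurable; first exact: measurable_set1.
by apply: sub_countable (finite_set_countable fs); apply: subset_card_le; exact: subIsetl.
Qed.

Lemma count_lt (T : eqType) (P Q : pred T) (s : seq T) (p : T) :
  (forall x, P x -> Q x) -> p \in s -> Q p -> ~~ P p -> (count P s < count Q s)%N.
Proof.
move=> PQ ps Qp nPp; rewrite -(size_filter Q) -(count_predC P) count_filter.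
rewrite (eq_count (a2 := P)); last first.
  by move=> x /=; case: (P x) (PQ x) => //= ->.
rewrite -[X in (X < _)%N]addn0 ltn_add2l -has_count; apply/hasP; exists p => //.
by rewrite mem_filter Qp.
Qed.

Lemma integrable_split (f : R -> R) (u p v : R) : measurable_fun setT f ->
  u <= p -> p <= v ->
  mu.-integrable `[u, p] (EFin \o f) -> mu.-integrable `[p, v] (EFin \o f) ->
  mu.-integrable `[u, v] (EFin \o f) /\
  \int[mu]_(x in `[u, v]) f x = \int[mu]_(x in `[u, p]) f x + \int[mu]_(x in `[p, v]) f x.
Proof.
move=> mf up pv i1 i2.
have E : `[u, v]%classic = `[u, p] `|` `]p, v] :> set R.
  by rewrite -itv_bndbnd_setU// bnd_simp.
have i3 : mu.-integrable `]p, v] (EFin \o f).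
  by apply: integrableS i2 => //; apply: subset_itv; rewrite bnd_simp.
have dj : [disjoint `[u, p] & `]p, v]].
  apply/disj_setPS => x [] /=; rewrite !in_itv/= => /andP[_ xp] /andP[px _].
  by have := le_lt_trans xp px; rewrite ltxx.
have iU : mu.-integrable `[u, v] (EFin \o f).
  apply/integrableP; split; first by apply/measurable_EFinP; exact: measurable_funTS.
  have /integrableP[_ f1] := i1; have /integrableP[_ f3] := i3.
  rewrite E ge0_integral_setU//=; last first.
    apply: measurable_funTS; apply: measurableT_comp => //.
    by apply: measurableT_comp.
  exact: lte_add_pinfty.
split => //; rewrite {1}E Rintegral_setU//; last by rewrite -E.
by congr (_ + _); apply: Rintegral_itv_obnd_cbnd.
Qed.

(** Induction on the number of exceptional points strictly between [u] and [v]: splitting the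
    interval at one of them removes it from the interior of both halves. *)
Lemma pw_FTC (f F : R -> R) (s : seq R) : continuous F ->
  (forall t : R, t \notin s -> is_derive t 1 F (f t) /\ {for t, continuous f}) ->
  (forall t, t \in s -> cvg (f y @[y --> t^'-]) /\ cvg (f y @[y --> t^'+])) ->
  forall u v, u <= v -> mu.-integrable `[u, v] (EFin \o f) /\
    \int[mu]_(x in `[u, v]) f x = F v - F u.
Proof.
move=> cF df sf u v uv.
have mf : measurable_fun setT f by apply: (@finite_exc_measurable _ s) => t /df [].
have lim t : (exists l : R, f y @[y --> t^'-] --> l) /\ (exists l : R, f y @[y --> t^'+] --> l).
  have [/sf [/cvg_ex h1 /cvg_ex h2]|/df[_ h]] := boolP (t \in s).
    by [].
  by split; exists (f t); [exact: cvg_at_left_filter|exact: cvg_at_right_filter].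
have [n] := ubnP (count (fun p => u < p < v) s).
elim: n u v uv => // n IH u v uv hn.
have [uv0|uv0] := eqVneq u v.
  rewrite -uv0 set_itv1 Rintegral_set1 subrr; split => //.
  by apply: null_set_integrable; [exact: measurable_set1|
    apply/measurable_EFinP; exact: measurable_funTS|exact: lebesgue_measure_set1].
have {}uv : u < v by rewrite lt_neqAle uv0.
have [/hasP[p ps /andP[up pv]]|/hasPn np] := boolP (has (fun p => u < p < v) s).
  have lt_count a b : u <= a -> b <= v -> ~~ (a < p < b) ->
      (count (fun q => (a < q < b)%R) s < n)%N.
    move=> ua bv pn; rewrite -ltnS (leq_trans _ hn)// ltnS.
    apply: (count_lt (p := p)) => //; last by rewrite up.
    by move=> x /andP[ax xb]; rewrite (le_lt_trans ua)// (lt_le_trans xb).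
  have n1 : ~~ (u < p < p) by rewrite ltxx andbF.
  have n2 : ~~ (p < p < v) by rewrite ltxx.
  have [i1 e1] := IH u p (ltW up) (lt_count _ _ (lexx _) (ltW pv) n1).
  have [i2 e2] := IH p v (ltW pv) (lt_count _ _ (ltW up) (lexx _) n2).
  have [i3 e3] := integrable_split mf (ltW up) (ltW pv) i1 i2.
  by split=> //; rewrite e3 e1 e2; ring.
have [_ [l2 hl2]] := lim u; have [[l1 hl1] _] := lim v.
(* With no exceptional point inside, replacing [f] at the two ends by its one-sided limits makes it
   continuous on [u, v] and changes it on a null set only. *)
pose f1 t := if t == u then l2 else if t == v then l1 else f t.
have f1E t : u < t < v -> f1 t = f t.
  by move=> /andP[ut tv]; rewrite /f1 gt_eqF// lt_eqF.
have nin t : u < t < v -> t \notin s by move=> tuv; apply/negP => /np; rewrite tuv.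
have cf1 : {within `[u, v], continuous f1}.
  apply/continuous_within_itvP => //; split.
  - move=> t; rewrite in_itv/= => tuv; have [_ cft] := df _ (nin t tuv).
    have /andP[ut tv] := tuv.
    rewrite /continuous_at f1E//; apply: cvg_trans cft; apply: near_eq_cvg.
    have nt : \forall y \near t, u < y < v.
      near=> y; apply/andP; split; near: y; [exact: lt_nbhsr|exact: lt_nbhsl].
    by apply: filterS nt => y yuv; rewrite f1E.
  - rewrite /f1 eqxx; apply: cvg_trans hl2; apply: near_eq_cvg.
    have nt : \forall y \near u^'+, u < y < v.
      near=> y; apply/andP; split; near: y; [exact: nbhs_right_gt|exact: nbhs_right_lt].
    by apply: filterS nt => y /andP[uy yv]; rewrite gt_eqF// lt_eqF.
  - rewrite /f1 eqxx gt_eqF//; apply: cvg_trans hl1; apply: near_eq_cvg.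
    have nt : \forall y \near v^'-, u < y < v.
      near=> y; apply/andP; split; near: y; [exact: nbhs_left_gt|exact: nbhs_left_lt].
    by apply: filterS nt => y /andP[uy yv]; rewrite gt_eqF// lt_eqF.
have if1 : mu.-integrable `[u, v] (EFin \o f1).
  by apply: continuous_compact_integrable => //; exact: segment_compact.
have dF : \int[mu]_(x in `[u, v]) f1 x = F v - F u.
  rewrite /Rintegral (continuous_FTC2 uv cf1 (F := F))//.
    split; last 2 first.
    - by apply: cvg_at_right_filter; exact: cF.
    - by apply: cvg_at_left_filter; exact: cF.
    by move=> x; rewrite in_itv/= => /nin/df[h _]; exact: ex_derive.
  move=> x; rewrite in_itv/= derive1E => xuv; rewrite f1E//.
  by have [h _] := df _ (nin _ xuv); exact: derive_val.
pose N : set R := [set u] `|` [set v].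
have mN : measurable N by apply: measurableU; exact: measurable_set1.
have N0 : mu N = 0.
  apply: countable_lebesgue_measure0; apply: finite_set_countable.
  by rewrite finite_setU; split; exact: finite_set1.
have DN x : (`[u, v] `\` N) x -> u < x < v.
  move=> [] /=; rewrite in_itv/= => /andP[ux xv] /not_orP[/eqP xu /eqP xv'].
  by rewrite !lt_neqAle ux xv eq_sym xu xv'.
have mfi : measurable_fun `[u, v] (EFin \o f).
  by apply/measurable_EFinP; exact: measurable_funTS.
have fi : mu.-integrable `[u, v] (EFin \o f).
  have mD : measurable (`[u, v]%classic : set R) by [].
  have [_ h] := @negligible_integrable _ _ _ mu _ _ _ mN mD mfi N0; apply: h.
  apply: (@eq_integrable _ _ _ mu _ _ (EFin \o f1)).
  - by apply: measurableD.
  - by move=> x /set_mem/DN h /=; rewrite f1E.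
  - by apply: integrableS if1 => //; exact: measurableD.
split => //; rewrite -dF /Rintegral; congr fine.
rewrite (@negligible_integral _ _ _ mu _ _ _ mN _ fi N0)//.
rewrite [RHS](@negligible_integral _ _ _ mu _ _ _ mN _ if1 N0)//.
by apply: eq_integral => x /set_mem/DN h /=; rewrite f1E.
Unshelve. all: end_near. Qed.

End PiecewiseFTC.


(** * From the contour to a vertical line *)

Section ContourLimit.
Context {R : realType}.
Implicit Types (F : R[i] -> R[i]) (U K : set R[i]) (s z : R[i]).
Local Notation mu := (@lebesgue_measure R).

(* Uniform holomorphy on the stars of segments from s to the points near z0:
   what is needed to differentiate the primitive [prim F s] at z0. *)
Definition star_nice U F s := forall z0, U z0 -> exists r K, [/\ 0 < r, nice K F &
  forall z (t : R), nc (z - z0) < r -> 0 <= t <= 1 -> K (s + t%:C * (z - s))].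

Lemma clamp_cont : continuous (clamp : R -> R).
Proof.
move=> t; apply/(@cvgrPdist_le R R) => e e0; near=> u.
rewrite (le_trans (clamp_lip _ _))// distrC; near: u.
Unshelve. all: end_near. Qed.

Lemma ccont_near (gamma : R -> R[i]) (x e : R) : ccont gamma -> 0 < e ->
  \forall y \near x, nc (gamma y - gamma x) < e.
Proof.
move=> [c1 c2] e0; have e2 : 0 < e / 2 by rewrite divr_gt0.
have h1 := @cvgr_dist_lt _ _ _ _ _ _ _ (c1 x) _ e2.
have h2 := @cvgr_dist_lt _ _ _ _ _ _ _ (c2 x) _ e2.
near=> y; rewrite (le_lt_trans (nc_le _))// ReB ImB (splitr e).
apply: ltrD; rewrite distrC; near: y; [exact: h1|exact: h2].
Unshelve. all: end_near. Qed.

Lemma ccont_lip_comp (P : R[i] -> R[i]) (gamma : R -> R[i]) : ccont gamma ->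
  (forall x, exists r L, 0 < r /\ forall z, nc (z - gamma x) < r ->
    nc (P z - P (gamma x)) <= L * nc (z - gamma x)) ->
  ccont (fun t => P (gamma t)).
Proof.
move=> cg h.
have H (p : R[i] -> R) : (forall z w, `|p z - p w| <= nc (z - w)) ->
    continuous (fun t => p (P (gamma t))).
  move=> hp x; have [r [L [r0 hL]]] := h x.
  apply/cvgrPdist_le => e e0.
  have L0 : 0 < `|L| + 1 by rewrite ltr_pwDr.
  have eL : 0 < e / (`|L| + 1) by rewrite divr_gt0.
  have h1 := ccont_near x cg r0; have h2 := ccont_near x cg eL.
  near=> y; rewrite distrC (le_trans (hp _ _))//.
  have yr : nc (gamma y - gamma x) < r by near: y.
  have : nc (gamma y - gamma x) < e / (`|L| + 1) by near: y.
  rewrite ltr_pdivlMr// => /ltW; apply: le_trans.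
  rewrite (le_trans (hL _ yr))// mulrC ler_wpM2l ?nc_ge0//.
  by rewrite (le_trans (ler_norm L))// lerDl.
split; apply: H => z w; first by rewrite -ReB nc_Re.
by rewrite -ImB nc_Im.
Unshelve. all: end_near. Qed.

Lemma star_nice_cont U F s (gamma : R -> R[i]) : star_nice U F s ->
  (forall t, U (gamma t)) -> ccont gamma -> ccont (fun t => F (gamma t)).
Proof.
move=> hs Ug cg; apply: ccont_lip_comp => // x.
have [r [K [r0 [F' [C nF]] hK]]] := hs _ (Ug x).
exists r, (2 * C); split => // z zr.
have K1 w : nc (w - gamma x) < r -> K w.
  move=> wr; have := hK w 1 wr; rewrite ler01 lexx => /(_ isT).
  by rewrite mul1r addrC subrK.
by apply: (nice_lip nF); apply: K1 => //; rewrite subrr nc0.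
Qed.

Lemma star_prim_quad U F s z0 : star_nice U F s -> U z0 ->
  exists M r, 0 < r /\ forall z, nc (z - z0) < r ->
    nc (prim F s z - prim F s z0 - F z0 * (z - z0)) <= M * nc (z - z0) ^+ 2.
Proof. by move=> hs /hs[r [K [r0 nF hK]]]; exact: prim_quad hK. Qed.

Lemma star_prim_cder U F s (gamma : R -> R[i]) (x : R) (dg : R[i]) :
  star_nice U F s -> U (gamma x) -> cder gamma x dg ->
  cder (fun t => prim F s (gamma t)) x (F (gamma x) * dg).
Proof. by move=> hs Ug; apply: chain_cder; exact: star_prim_quad hs Ug. Qed.

Lemma star_prim_cont U F s (gamma : R -> R[i]) : star_nice U F s ->
  (forall t, U (gamma t)) -> ccont gamma -> ccont (fun t => prim F s (gamma t)).
Proof.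
move=> hs Ug cg; apply: ccont_lip_comp => // x.
have [M [r [r0 hM]]] := star_prim_quad hs (Ug x).
exists r, (`|M| * r + nc (F (gamma x))); split => // z zr.
rewrite -(subrK (F (gamma x) * (z - gamma x)) (prim F s z - _)).
rewrite (le_trans (ncD _ _))// ncM mulrDl lerD2r (le_trans (hM _ zr))//.
rewrite (le_trans (ler_wpM2r (sqr_ge0 _) (ler_norm M)))// -mulrA ler_wpM2l//.
by rewrite expr2 ler_wpM2r ?nc_ge0// ltW.
Qed.

Lemma cFTC_le (W w : R -> R[i]) (E e : R -> R) (a b : R) : a <= b ->
  ccont W -> ccont w -> (forall x, a < x < b -> cder W x (w x)) ->
  continuous e -> (forall x : R, is_derive x 1 E (e x)) ->
  (forall t, a <= t <= b -> nc (w t) <= e t) ->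
  nc (W b - W a) <= 2 * (E b - E a).
Proof.
move=> ab cW [w1 w2] dW ce dE we; rewrite -(cFTC_oo ab _ cW dW)//.
rewrite (le_trans (nc_le _))//= mulrDl mul1r -(FTC_itv ab ce dE).
have H (p : R -> R) : continuous p -> (forall t, a <= t <= b -> `|p t| <= e t) ->
    `|\int[mu]_(t in `[a, b]) p t| <= \int[mu]_(t in `[a, b]) e t.
  move=> cp pM; apply: (le_trans (le_normr_Rintegral _ (cont_itv_intg _ _ cp))) => //.
  apply: le_Rintegral => //.
  - by apply: cont_itv_intg => x; apply: cvg_norm; exact: cp.
  - exact: cont_itv_intg.
by rewrite lerD// H// => t tab; rewrite (le_trans _ (we t tab))// ?nc_Re ?nc_Im.
Qed.

Lemma cig_trunc (f : R -> R[i]) : cig f ->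
  ccvg (fun n => cintegral `[- n%:R, n%:R] f) (CI f).
Proof.
move=> [f1 f2]; apply: (@ccvg_squeeze _ _ _ (fun n =>
   `|\int[mu]_(x in `[- n%:R, n%:R]) complex.Re (f x) - complex.Re (CI f)| +
   `|\int[mu]_(x in `[- n%:R, n%:R]) complex.Im (f x) - complex.Im (CI f)|)).
  by move=> n; rewrite (le_trans (nc_le _))// ReB ImB.
rewrite -(addr0 0); apply: cvgD; rewrite -(normr0 R); apply: cvg_norm.
  by apply/subr_cvg0; exact: cvg_trunc.
by apply/subr_cvg0; exact: cvg_trunc.
Qed.

Lemma cont_bounded_itv (f : R -> R[i]) (a b : R) : a <= b -> ccont f ->
  exists C, forall t, a <= t <= b -> nc (f t) <= C.
Proof.
move=> ab [c1 c2].
have cn : continuous (fun t => `|complex.Re (f t)| + `|complex.Im (f t)|).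
  by move=> t; apply: cvgD; apply: cvg_norm; [exact: c1|exact: c2].
have [c _ hc] := EVT_max ab (cont_within cn).
exists (`|complex.Re (f c)| + `|complex.Im (f c)|) => t tab.
by rewrite (le_trans (nc_le _))// hc// in_itv.
Qed.

Lemma cig_decay (f : R -> R[i]) (C k : R) : ccont f -> 0 < k ->
  (forall t, 1 <= `|t| -> nc (f t) <= C * expR (- (k * `|t|))) -> cig f.
Proof.
move=> cf k0 hf.
have n1 : (-1 : R) <= 1 by rewrite (@le_trans _ _ 0)// oppr_le0.
have [D hD] := cont_bounded_itv n1 cf.
have D0 : 0 <= D by rewrite (le_trans (nc_ge0 (f 0)))// hD// oppr_le0 ler01.
have C0 : 0 <= C.
  have := hf 1; rewrite normr1 lexx => /(_ isT)/(le_trans (nc_ge0 _)).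
  by rewrite pmulr_lge0// expR_gt0.
(* [expR k] compensates the exponential on [-1, 1], where [f] is only known to be bounded by [D]. *)
apply: (cig_dom (ccont_meas cf) (g := fun t => (C + D * expR k) * expR (- (k * `|t|)))).
  move=> t; have [t1|/ltW t1] := leP 1 `|t|.
    by rewrite (le_trans (hf t t1))// ler_wpM2r ?expR_ge0// lerDl mulr_ge0// expR_ge0.
  rewrite (le_trans (hD t _)) -?ler_norml// mulrDl ler_wpDl ?mulr_ge0 ?expR_ge0//.
  rewrite -mulrA -expRD -[leLHS]mulr1 ler_wpM2l// -expR0 ler_expR.
  by rewrite subr_ge0 -[leRHS]mulr1 ler_wpM2l// ltW.
by apply: intgZ; exact: cvg_expR_norm_intg.
Qed.

Section StarContour.
(** [U] is kept abstract because the argument serves twice: with an open strip, to shift vertical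
    lines, and with the slit plane, for the contour of the theorem. *)
Variables (U : set R[i]) (F : R[i] -> R[i]) (s0 B C k : R) (g : R -> R[i]).
Let s : R[i] := s0%:C.
Hypothesis hs : star_nice U F s.
Hypothesis hline : forall y, U (s0 +i* y).
Hypothesis hconv : forall z t, U z -> 0 <= t <= 1 ->
  U ((s0 + t * (complex.Re z - s0)) +i* complex.Im z).
Hypothesis k0 : 0 < k.
Hypothesis sB : `|s0| <= B.
Hypothesis hdecay : forall z, U z -> `|complex.Re z| <= B -> 1 <= `|complex.Im z| ->
  nc (F z) <= C * expR (- (k * `|complex.Im z|)).
Hypothesis gB : forall t, `|complex.Re (g t)| <= B.
Hypothesis Ug : forall t, U (g t).
Hypothesis gcont : imaginary_contour g.

Let w y := F (s0 +i* y).
Let P := prim F s.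
Let V y := P (s0 +i* y).

Let B0 : 0 <= B. Proof. exact: le_trans sB. Qed.

Let C0 : 0 <= C.
Proof.
have := @hdecay (s0 +i* 1) (hline _) sB; rewrite /= normr1 lexx => /(_ isT).
by move/(le_trans (nc_ge0 _)); rewrite pmulr_lge0// expR_gt0.
Qed.

Let line_cont : ccont (fun y => s0 +i* y).
Proof. by split => x /=; [exact: cvg_cst|exact: cvg_id]. Qed.

Lemma line_w_cont : ccont w.
Proof. exact: (star_nice_cont hs hline line_cont). Qed.

Lemma line_w_cig : cig w.
Proof.
apply: (cig_decay line_w_cont k0 (C := C)) => t t1.
exact: (@hdecay (s0 +i* t) (hline t) sB t1).
Qed.

Let wi_cont : ccont (fun y => w y * 'i%C).
Proof. by apply: ccontM; [exact: line_w_cont|exact: ccont_cst]. Qed.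

Let V_cont : ccont V.
Proof. exact: (star_prim_cont hs hline line_cont). Qed.

Let V_cder y : cder V y (w y * 'i%C).
Proof.
apply: (star_prim_cder hs (hline y)); split => /=.
  exact: is_derive_cst.
exact: is_derive_id.
Qed.

Let L := 'i%C * CI w.

Let V_lim : ccvg (fun n => V n%:R - V (- n%:R)) L.
Proof.
rewrite /L -CIZ; last exact: line_w_cig.
rewrite (eq_CI (g := fun y => w y * 'i%C)); last by move=> y; rewrite mulrC.
have ci : cig (fun y => w y * 'i%C).
  by apply: eq_cig (cigZ 'i%C line_w_cig) => y; rewrite mulrC.
apply: eq_ccvg (cig_trunc ci) => n.
by rewrite (cFTC_itv _ wi_cont V_cder)// (@le_trans _ _ 0)// oppr_le0.
Qed.

(** The heights of the two ends are independent, while [V_lim] only deals with symmetric ones: both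
    are moved to a common large [n], at the cost of two exponential tails. *)
Let tail y y' : 1 <= y -> 1 <= y' ->
  nc (V y - V (- y') - L) <= 2 * (C / k) * (expR (- (k * y)) + expR (- (k * y'))).
Proof.
move=> y1 y1'; apply/ler_addgt0Pr => e e0.
have Ck : 0 <= C / k by rewrite divr_ge0// ltW.
have nci : nc ('i%C : R[i]) = 1 by rewrite /nc /= expr0n expr1n /= add0r sqrtr1.
have up (b : R) : y <= b -> nc (V b - V y) <= 2 * (C / k) * expR (- (k * y)).
  move=> yb; have dE (x : R) : is_derive x 1 (fun x => - (C / k) * expR (- (k * x)))
      (C * expR (- (k * x))).
    by apply: is_derive_eq; rewrite /GRing.scale /=; field; rewrite gt_eqF.
  have ce : continuous (fun x => C * expR (- (k * x))).
    move=> x; apply: cvgM; first exact: cvg_cst.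
    apply: continuous_comp; last exact: continuous_expR.
    by apply: cvgN; apply: cvgM; [exact: cvg_cst|exact: cvg_id].
  apply: (le_trans (cFTC_le yb V_cont wi_cont (fun x _ => V_cder x) ce dE _)).
    move=> t /andP[yt _]; have t1 := le_trans y1 yt; rewrite ncM nci mulr1.
    have := @hdecay (s0 +i* t) (hline t) sB; rewrite /= ger0_norm; last by lra.
    exact.
  rewrite -mulrA ler_wpM2l// mulNr mulNr opprK addrC lerBlDr lerDl.
  by rewrite mulr_ge0// expR_ge0.
have dn (b : R) : y' <= b -> nc (V (- y') - V (- b)) <= 2 * (C / k) * expR (- (k * y')).
  move=> yb; have dE (x : R) : is_derive x 1 (fun x => (C / k) * expR (k * x))
      (C * expR (k * x)).
    by apply: is_derive_eq; rewrite /GRing.scale /=; field; rewrite gt_eqF.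
  have ce : continuous (fun x => C * expR (k * x)).
    move=> x; apply: cvgM; first exact: cvg_cst.
    apply: continuous_comp; last exact: continuous_expR.
    by apply: cvgM; [exact: cvg_cst|exact: cvg_id].
  have yb' : - b <= - y' by rewrite lerN2.
  apply: (le_trans (cFTC_le yb' V_cont wi_cont (fun x _ => V_cder x) ce dE _)).
    move=> t /andP[_ yt]; have t1 : 1 <= - t by lra.
    rewrite ncM nci mulr1.
    have := @hdecay (s0 +i* t) (hline t) sB; rewrite /= ler0_norm; last by lra.
    by rewrite mulrN opprK; exact.
  rewrite -(mulrA 2) ler_wpM2l// !mulrN lerBlDr lerDl.
  by rewrite mulr_ge0// expR_ge0.
have /cvgrPdist_le/(_ _ e0) hn := V_lim.
have [n [hny hny' hne]] : exists n : nat, [/\ y <= n%:R, y' <= n%:R &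
    nc (V n%:R - V (- n%:R) - L) <= e].
  near \oo => n; exists n; split.
  - by near: n; exact: nbhs_infty_ger.
  - by near: n; exact: nbhs_infty_ger.
  - have : `|0 - nc (V n%:R - V (- n%:R) - L)| <= e by near: n.
    by rewrite sub0r normrN ger0_norm// nc_ge0.
rewrite (_ : V y - V (- y') - L = (V n%:R - V (- n%:R) - L) - (V n%:R - V y)
  - (V (- y') - V (- n%:R))); last by ring.
rewrite (le_trans (ncB _ _))// (le_trans (lerD (ncB _ _) (lexx _)))//.
have := up _ hny; have := dn _ hny'; rewrite mulrDr; lra.
Unshelve. all: end_near. Qed.

(** The path is the horizontal segment from [z] to the vertical line: its length is at most [2 * B],
    it stays in [U] by [hconv], and [F] is exponentially small on it. *)
Let horizontal z : U z -> `|complex.Re z| <= B -> 1 <= `|complex.Im z| ->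
  nc (P z - V (complex.Im z)) <= 4 * B * C * expR (- (k * `|complex.Im z|)).
Proof.
move=> Uz zB z1; pose x := complex.Re z; pose y := complex.Im z.
pose gam t := (s0 + clamp t * (x - s0)) +i* y.
have Ugam t : U (gam t) by apply: hconv => //; exact: clamp_itv.
have ccl := clamp_cont.
have cgam : ccont gam.
  split => t /=; last exact: cvg_cst.
  apply: cvgD; first exact: cvg_cst.
  by apply: cvgM; [exact: ccl|exact: cvg_cst].
have cF : ccont (fun t => F (gam t) * (x - s0)%:C).
  by apply: ccontM; [exact: (star_nice_cont hs)|exact: ccont_cst].
have dgam t : 0 < t < 1 -> cder gam t (x - s0)%:C.
  move=> /andP[t0 t1]; apply: quad_cder; exists 0.
  have nx : \forall y \near t, 0 < y < 1.
    near=> u; apply/andP; split; near: u; [exact: lt_nbhsr|exact: lt_nbhsl].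
  near=> u; have /andP[u0 u1] : 0 < u < 1 by near: u.
  have cu : clamp u = u by rewrite clamp_id// !ltW.
  have ct : clamp t = t by rewrite clamp_id// !ltW.
  rewrite mul0r /gam cu ct.
  rewrite le_eqVlt; apply/orP; left; rewrite nc_eq0; apply/eqP.
  by apply: complex_ext; rewrite ?ReB ?ImB ?ReM ?ImM /=; ring.
pose D := 2 * B * C * expR (- (k * `|y|)).
have dE (u : R) : is_derive u 1 (fun u => D * u) D.
  by apply: is_derive_eq; rewrite /GRing.scale /= mulr1.
have := cFTC_le (@ler01 R) (star_prim_cont hs Ugam cgam) cF
  (fun t t01 => star_prim_cder hs (Ugam t) (dgam t t01)) (fun u => cvg_cst D) dE.
have g1 : gam 1 = z.
  rewrite /gam clamp_id ?ler01 ?lexx// mul1r addrC subrK /x /y.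
  by case: (z).
have g0 : gam 0 = s0 +i* y by rewrite /gam clamp_id ?ler01 ?lexx// mul0r addr0.
rewrite g1 g0 mulr1 mulr0 subr0.
rewrite (_ : 4 * B * C * _ = 2 * D); last by rewrite /D /y; ring.
apply => t /andP[t0 t1].
have tc : clamp t = t by rewrite clamp_id// t0.
have xs : `|x - s0| <= 2 * B.
  by rewrite (le_trans (ler_normB _ _))// mulrDl mul1r lerD.
have gamB : `|complex.Re (gam t)| <= B.
  rewrite /= tc; move: zB sB; rewrite -/x !ler_norml => /andP[? ?] /andP[? ?].
  apply/andP; split; nra.
rewrite ncM nc_real mulrC /D -mulrA ler_pM ?nc_ge0//.
exact: (hdecay (Ugam t) gamB).
Unshelve. all: end_near. Qed.

Let pw_cont (f : R -> R) (q : seq R) :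
  (forall t, t \notin q -> derivable f t 1 /\ {for t, continuous (derive1 f)}) ->
  (forall t, t \in q -> cvg (derive1 f x @[x --> t^'-]) /\ cvg (derive1 f x @[x --> t^'+])) ->
  forall t, cvg (derive1 f x @[x --> t^'-]) /\ cvg (derive1 f x @[x --> t^'+]).
Proof.
move=> h1 h2 t; have [/h2//|/h1[_ h]] := boolP (t \in q).
by split; apply: cvgP; [exact: (cvg_at_left_filter h)|exact: (cvg_at_right_filter h)].
Qed.

(** [P] composed with [g] is a primitive of the integrand outside the corners of the two
    coordinates, collected in [q1 ++ q2]. *)
Lemma arc_integralE u v : u <= v -> arc_integral g F u v = P (g v) - P (g u).
Proof.
move=> uv; have [[cRe [q1 [d1 l1]]] [cIm [q2 [d2 l2]]] _ _ _] := gcont.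
have cg : ccont g by [].
have [F1 F2] := star_nice_cont hs Ug cg.
have [P1 P2] := star_prim_cont hs Ug cg.
have L1 := pw_cont d1 l1; have L2 := pw_cont d2 l2.
have D t : t \notin q1 ++ q2 -> cder g t (derive1 (fun t => complex.Re (g t)) t +i*
     derive1 (fun t => complex.Im (g t)) t).
  rewrite mem_cat => /norP[/d1[h1 _] /d2[h2 _]].
  by split => /=; rewrite derive1E; exact: derivableP.
pose dr := derive1 (fun t => complex.Re (g t)).
pose di := derive1 (fun t => complex.Im (g t)).
rewrite /arc_integral; apply: complex_ext; rewrite ?ReB ?ImB.
  transitivity (\int[mu]_(t in `[u, v])
      (complex.Re (F (g t)) * dr t - complex.Im (F (g t)) * di t)).
    by apply: eq_Rintegral => t _; rewrite ReM.
  have [||_] := @pw_FTC R (fun t => complex.Re (F (g t)) * dr t - complex.Im (F (g t)) * di t)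
    (fun t => complex.Re (P (g t))) (q1 ++ q2) P1 _ _ u v uv; last by [].
    move=> t tq; split.
      by have [+ _] := star_prim_cder hs (Ug t) (D t tq); rewrite ReM.
    move: tq; rewrite mem_cat => /norP[/d1[_ h1] /d2[_ h2]].
    by apply: cvgB; apply: cvgM => //; [exact: F1|exact: F2].
  move=> t _; have [/cvg_ex[a1 A1] /cvg_ex[a2 A2]] := L1 t.
  have [/cvg_ex[b1 B1] /cvg_ex[b2 B2]] := L2 t.
  split; apply: cvgP; apply: cvgB; apply: cvgM.
  - by apply: cvg_at_left_filter; exact: F1.
  - exact: A1.
  - by apply: cvg_at_left_filter; exact: F2.
  - exact: B1.
  - by apply: cvg_at_right_filter; exact: F1.
  - exact: A2.
  - by apply: cvg_at_right_filter; exact: F2.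
  - exact: B2.
transitivity (\int[mu]_(t in `[u, v])
    (complex.Re (F (g t)) * di t + complex.Im (F (g t)) * dr t)).
  by apply: eq_Rintegral => t _; rewrite ImM.
have [||_] := @pw_FTC R (fun t => complex.Re (F (g t)) * di t + complex.Im (F (g t)) * dr t)
  (fun t => complex.Im (P (g t))) (q1 ++ q2) P2 _ _ u v uv; last by [].
  move=> t tq; split.
    by have [_ +] := star_prim_cder hs (Ug t) (D t tq); rewrite ImM.
  move: tq; rewrite mem_cat => /norP[/d1[_ h1] /d2[_ h2]].
  by apply: cvgD; apply: cvgM => //; [exact: F1|exact: F2].
move=> t _; have [/cvg_ex[a1 A1] /cvg_ex[a2 A2]] := L1 t.
have [/cvg_ex[b1 B1] /cvg_ex[b2 B2]] := L2 t.
split; apply: cvgP; apply: cvgD; apply: cvgM.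
- by apply: cvg_at_left_filter; exact: F1.
- exact: B1.
- by apply: cvg_at_left_filter; exact: F2.
- exact: A1.
- by apply: cvg_at_right_filter; exact: F1.
- exact: B2.
- by apply: cvg_at_right_filter; exact: F2.
- exact: A2.
Qed.

Lemma arc_integral_near e : 0 < e ->
  \forall uv \near filter_prod (ninfty_nbhs R) (pinfty_nbhs R),
    nc (arc_integral g F uv.1 uv.2 - L) <= e.
Proof.
move=> e0; have [_ _ _ gm gp] := gcont.
(* The first two terms are the constants of [tail] and [horizontal]; the last one makes [D]
   positive. *)
pose D := 2 * (C / k) + 4 * B * C + 1.
have D0 : 0 < D.
  by rewrite ltr_wpDl// addr_ge0// !mulr_ge0// ?invr_ge0 ?ltW.
have lim : (D * expR (- (k * y))) @[y --> +oo] --> (0 : R).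
  rewrite -(mulr0 D); apply: cvgM; first exact: cvg_cst.
  apply: (@cvg_comp _ _ _ (fun x => k * x) (fun x => expR (- x)) _ +oo%R); last exact: cvgr_expR.
  by apply: gt0_cvgMry => //; exact: cvg_id.
have e2 : 0 < e / 2 by rewrite divr_gt0.
have [Y [Y1 hY]] : exists Y, 1 <= Y /\ forall y, Y <= y -> D * expR (- (k * y)) <= e / 2.
  have /cvgrPdist_le/(_ _ e2)[Y [_ hY]] := lim.
  exists (Num.max 1 (Y + 1)); split; first by rewrite le_max lexx.
  move=> y; rewrite ge_max => /andP[_ Yy].
  have := hY y (lt_le_trans _ Yy); rewrite ltrDl ltr01 => /(_ isT) /=.
  by rewrite sub0r normrN ger0_norm// mulr_ge0 ?expR_ge0// ltW.
have nv : \forall v \near +oo, Y <= complex.Im (g v).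
  by move/cvgryPge : gp; exact.
have nu : \forall u \near -oo, complex.Im (g u) <= - Y.
  by move/cvgrNyPle : gm; exact.
exists ([set u : R | complex.Im (g u) <= - Y /\ u <= 0], [set v : R | Y <= complex.Im (g v) /\ 0 <= v]).
  split.
    by apply: filterI => //; exact: nbhs_ninfty_le.
  by apply: filterI => //; exact: nbhs_pinfty_ge.
move=> [u v] [[gu u0] [gv v0]].
change (nc (arc_integral g F u v - L) <= e).
rewrite arc_integralE ?(le_trans u0)//.
pose y := complex.Im (g v); pose y' := - complex.Im (g u).
have y1 : 1 <= y by exact: le_trans gv.
have Yy' : Y <= y' by rewrite lerNr.
have y1' : 1 <= y' by exact: le_trans Yy'.
(* The arc is compared with a broken line having the same ends: a horizontal segment, the vertical
   one from height [- y'] to height [y], and another horizontal segment. *)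
rewrite (_ : _ - _ - _ = (V y - V (- y') - L) + ((P (g v) - V y) - (P (g u) - V (- y'))));
  last by ring.
have iv : 1 <= `|complex.Im (g v)| by rewrite (le_trans y1)// ler_norm.
have iu : 1 <= `|complex.Im (g u)| by rewrite (le_trans y1')// /y' -normrN ler_norm.
have h1 := horizontal (Ug v) (gB v) iv; have h2 := horizontal (Ug u) (gB u) iu.
rewrite -/y (@ger0_norm _ y) in h1; last by lra.
rewrite -(normrN (complex.Im (g u))) -/y' (@ger0_norm _ y') in h2; last by lra.
have h3 := tail y1 y1'.
rewrite (le_trans (ncD _ _))// (le_trans (lerD h3 (ncB _ _)))//.
have y'E : - y' = complex.Im (g u) by rewrite opprK.
rewrite y'E.
apply: (le_trans (lerD (lexx _) (lerD h1 h2))).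
have := hY y gv; have := hY y' Yy'; rewrite /D.
have := expR_ge0 (- (k * y)); have := expR_ge0 (- (k * y')).
set E1 := expR (- (k * y)); set E2 := expR (- (k * y')).
move=> E20 E10 i1 i2.
rewrite (splitr e) (_ : _ + _ = (2 * (C / k) + 4 * B * C) * E1 + (2 * (C / k) + 4 * B * C) * E2);
  last by ring.
by rewrite lerD//; [apply: le_trans i2|apply: le_trans i1]; rewrite ler_wpM2r// lerDl.
Qed.

Theorem contour_limit : [/\ cig w, contour_integrable g F &
  contour_integral g F = 'i%C * CI w].
Proof.
have H (p : R[i] -> R) : (forall z1 z2, `|p z1 - p z2| <= nc (z1 - z2)) ->
    p (arc_integral g F uv.1 uv.2) @[uv --> filter_prod (ninfty_nbhs R) (pinfty_nbhs R)] --> p L.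
  move=> hp; apply/cvgrPdist_le => e e0.
  apply: filterS (arc_integral_near e0) => uv h.
  by rewrite distrC (le_trans (hp _ _)).
have ReP (z1 z2 : R[i]) : `|complex.Re z1 - complex.Re z2| <= nc (z1 - z2) by rewrite -ReB nc_Re.
have ImP (z1 z2 : R[i]) : `|complex.Im z1 - complex.Im z2| <= nc (z1 - z2) by rewrite -ImB nc_Im.
have h1 := H _ ReP; have h2 := H _ ImP.
split; first exact: line_w_cig.
- by split; apply: cvgP; [exact: h1|exact: h2].
- by apply: complex_ext => /=; apply/cvg_lim => //.
Qed.

End StarContour.

End ContourLimit.


(** * Asymptotics of the Gamma function *)

Section GammaNice.
Context {R : realType}.
Implicit Types (x y v : R) (z w : R[i]).
Local Notation mu := (@lebesgue_measure R).

Definition strip (x1 x2 : R) : set R[i] := [set z | x1 <= complex.Re z <= x2].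

(** Differentiation under the integral sign: [ce_taylor2] controls the remainder, and the domination
    is uniform on the strip. *)
Lemma GI_nice x1 x2 : 0 < x1 -> nice (strip x1 x2) GI.
Proof.
(* With this [d] the abscissa [x1 - d] stays positive, so that the shifted kernels of [sqr_rk] are
   still integrable. *)
move=> x10; pose d := x1 / 2; have d0 : 0 < d by rewrite divr_gt0.
have [x21|x12] := ltP x2 x1.
  apply: (nice_eq (F := fun=> 0)); last exact: nice_cst.
  by move=> z /= /andP[h1 h2]; exfalso; lra.
have x20 : 0 < x2 by exact: lt_le_trans x12.
pose W v := rk x1 v + rk x2 v.
pose T v := (2 / d ^+ 2) * (rk (x1 - d) v + rk (x1 + d) v) +
  (2 / d ^+ 2) * (rk (x2 - d) v + rk (x2 + d) v).
have W0 v : 0 <= W v by rewrite addr_ge0 ?rk_ge0.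
have WT v : v ^+ 2 * W v <= T v by rewrite mulrDr lerD// sqr_rk.
have T0 v : 0 <= T v by rewrite (le_trans _ (WT v))// mulr_ge0 ?sqr_ge0.
have Wi : intg W by apply: intgD; exact: rk_intg.
have Ti : intg T.
  apply: intgD; apply: intgZ; apply: intgD; apply: rk_intg; rewrite /d; lra.
(* 16 is the 8 of [ce_taylor2] times 2, for the kernels at [z] and at [w]. *)
pose D v := W v + 16 * T v.
have Di : intg D by apply: intgD => //; exact: intgZ.
have gW z v : strip x1 x2 z -> nc (gk z v) <= W v.
  by move=> hz; rewrite nc_gk rk_between.
have gD z v : strip x1 x2 z -> nc (gk z v) <= D v.
  by move=> hz; rewrite (le_trans (gW z v hz))// lerDl mulr_ge0.
have v1 v : `|v| <= 1 + v ^+ 2.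
  rewrite -(real_normK (num_real v)).
  by have := sqr_ge0 (`|v| - 1); rewrite sqrrB expr1n mulr1 mulr2n => h; nra.
have g'D z v : strip x1 x2 z -> nc (v%:C * gk z v) <= D v.
  move=> hz; rewrite ncM nc_real (@le_trans _ _ ((1 + v ^+ 2) * W v))//.
    by rewrite ler_pM ?nc_ge0 ?v1 ?gW.
  rewrite mulrDl mul1r lerD2l (le_trans (WT v))//.
  by rewrite ler_peMl// ler1n.
have re z : strip x1 x2 z -> 0 < complex.Re z.
  by move=> /andP[h _]; exact: lt_le_trans h.
have cv : ccont (fun v : R => v%:C) by apply: ccont_real => x; exact: cvg_id.
have cg' z : ccont (fun v => v%:C * gk z v) by apply: ccontM => //; exact: gk_cont.
have ig z : strip x1 x2 z -> cig (gk z) by move=> /re; exact: gk_cig.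
have ig' z : strip x1 x2 z -> cig (fun v => v%:C * gk z v).
  by move=> hz; apply: cig_dom (ccont_meas (cg' z)) _ Di => v; exact: g'D.
pose I := \int[mu]_v D v.
have I0 : 0 <= I.
  by apply: Rintegral_ge0 => v _; rewrite addr_ge0// mulr_ge0.
exists (fun z => CI (fun v => v%:C * gk z v)), (2 * I); split.
- by rewrite mulr_ge0.
- by move=> z hz; apply: CI_le => //; [exact: ig|move=> v; exact: gD].
- by move=> z hz; apply: CI_le => //; [exact: ig'|move=> v; exact: g'D].
- move=> z w hz hw; set h := w - z.
  have E : GI w - GI z - CI (fun v => v%:C * gk z v) * h =
      CI (fun v => gk w v - gk z v - h * (v%:C * gk z v)).
    rewrite CIB; last 2 first.
    - by apply: cigB; exact: ig.
    - by apply: cigZ; exact: ig'.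
    by rewrite CIB ?CIZ ?(mulrC h)//; [exact: ig'|exact: ig|exact: ig].
  rewrite E -mulrA (mulrC I) mulrA -(mulrA 2) -RintegralZl//.
  apply: CI_le.
  + apply: cigB; first by apply: cigB; exact: ig.
    by apply: cigZ; exact: ig'.
  + exact: intgZ.
  move=> v; have -> : gk w v = gk z v * ce (h * v%:C).
    by rewrite -gkD /h addrC subrK.
  rewrite (_ : _ - _ - _ = gk z v * (ce (h * v%:C) - 1 - h * v%:C)); last by ring.
  rewrite ncM (le_trans (ler_wpM2l (nc_ge0 _) (ce_taylor2 _)))// ncM nc_real.
  rewrite exprMn real_normK ?num_real//.
  rewrite (_ : nc (gk z v) * _ = nc h ^+ 2 * (8 * (v ^+ 2 * (nc (gk z v) * (1 + expR (complex.Re (h * v%:C))))))); last by ring.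
  rewrite ler_wpM2l ?sqr_ge0// (@le_trans _ _ (8 * (v ^+ 2 * (2 * W v))))//.
    rewrite ler_wpM2l// ler_wpM2l ?sqr_ge0// mulrDr mulr1 (_ : 2 * W v = W v + W v); last by ring.
    rewrite lerD ?gW//.
    rewrite -nc_ce -ncM -gkD (_ : z + h = w) ?gW//.
    by rewrite /h addrC subrK.
  rewrite (_ : 8 * _ = 16 * (v ^+ 2 * W v)); last by ring.
  by rewrite (@le_trans _ _ (16 * T v)) ?ler_wpM2l// lerDr.
Qed.

Lemma Gamma_nice x1 x2 : 0 < x1 -> nice (strip x1 x2) Gamma.
Proof.
move=> x10; apply: nice_eq (GI_nice x2 x10) => z /andP[h _].
by rewrite GammaE//; exact: lt_le_trans h.
Qed.

End GammaNice.

(** * Growth of Gamma (n + z), absence of zeros, monotonicity *)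

Section GammaAsymptotic.
Context {R : realType}.
Implicit Types (x y v : R) (z w : R[i]).
Local Notation mu := (@lebesgue_measure R).

(* Gamma on the positive reals, as a real number. *)
Definition rG x := \int[mu]_v rk x v.

Lemma GI_real x : 0 < x -> GI x%:C = (rG x)%:C.
Proof.
move=> x0; apply: complex_ext; rewrite ?ReCI ?ImCI.
  transitivity (rG x) => //.
  by apply: eq_Rintegral => v _; rewrite gkE /= mul0r cos0 mulr1.
transitivity (\int[mu]_(v in setT) (0 : R)).
  by apply: eq_Rintegral => v _; rewrite gkE /= mul0r sin0 mulr0.
by rewrite /Rintegral integral0.
Qed.

Lemma Gamma_real x : 0 < x -> Gamma x%:C = (rG x)%:C.
Proof. by move=> x0; rewrite GammaE// GI_real. Qed.

Lemma rG_succ x : 0 < x -> rG (x + 1) = x * rG x.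
Proof.
move=> x0; apply: complexI; rewrite -GI_real ?addr_gt0// rmorphD GI_succ//.
by rewrite GI_real// rmorphM.
Qed.

Lemma rG_ge0 x : 0 <= rG x.
Proof. by apply: Rintegral_ge0 => v _; exact: rk_ge0. Qed.

(** The kernel is at least [expR (- expR 1)] on [0, 1]. The bound does not depend on [x], which
    [Gamma_lb] exploits. *)
Lemma rG_lb x : 0 < x -> expR (- expR 1) <= rG x.
Proof.
move=> x0.
have ci : intg (rk x) by exact: rk_intg.
rewrite (@le_trans _ _ (\int[mu]_(v in `[0, 1]) rk x v))//.
  rewrite (_ : expR _ = \int[mu]_(v in `[0, 1]) expR (- expR 1)); last first.
    by rewrite Rintegral_cst//= lebesgue_measure_itv/= lte_fin ltr01/= oppr0 addr0 mulr1.
  apply: le_Rintegral => //.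
  - by apply: cont_itv_intg => v; exact: cvg_cst.
  - exact: intgS.
  move=> v /=; rewrite in_itv/= => /andP[v0 v1]; rewrite ler_expR.
  by rewrite (@le_trans _ _ (- expR v))// ?lerN2 ?ler_expR// lerDr mulr_ge0// ltW.
rewrite [leRHS](_ : _ = \int[mu]_(v in setT) rk x v)//.
rewrite [leLHS]Rintegral_mkcond; apply: le_Rintegral => //.
  by rewrite -restrict_EFin; apply/(integrable_restrict) => //; rewrite setTI; exact: intgS.
move=> v _; rewrite patchE; case: ifP => _ //; exact: rk_ge0.
Qed.

Lemma rG_gt0 x : 0 < x -> 0 < rG x.
Proof. by move=> /rG_lb; exact: lt_le_trans (expR_gt0 _). Qed.

Lemma rk_mul_exp x v : rk x v * expR v = rk (x + 1) v.
Proof. by rewrite /rk -expRD; congr expR; ring. Qed.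

Lemma nc_div_mul (u v w : R[i]) : nc (u / (v * w)) = nc u / (nc v * nc w).
Proof. by rewrite ncM ncV ncM. Qed.

Lemma ReMr z x : complex.Re (z * x%:C) = complex.Re z * x.
Proof. by rewrite ReM /= mulr0 subr0. Qed.

Lemma near_rcvg (u v : nat -> R) (l : R) : (\forall n \near \oo, u n = v n) ->
  u @ \oo --> l -> v @ \oo --> l.
Proof. by move=> uv; apply: cvg_trans; apply: near_eq_cvg; apply: filterS uv => n ->. Qed.

Lemma rcvgM (u v : nat -> R) (a b : R) : u @ \oo --> a -> v @ \oo --> b ->
  (fun n => u n * v n) @ \oo --> a * b.
Proof. exact: cvgM. Qed.

Lemma rcvgV (u : nat -> R) (a : R) : a != 0 -> u @ \oo --> a ->
  (fun n => (u n)^-1) @ \oo --> a^-1.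
Proof. exact: cvgV. Qed.

Definition npow (n : nat) z := ce (z * (ln n%:R)%:C).

Lemma npowD n z w : npow n (z + w) = npow n z * npow n w.
Proof. by rewrite /npow mulrDl ceD. Qed.

Lemma npow_neq0 n z : npow n z != 0.
Proof. by rewrite -nc_gt0 nc_ce expR_gt0. Qed.

Lemma npow1 n : (0 < n)%N -> npow n 1 = n%:R.
Proof. by move=> n0; rewrite /npow mul1r ce_real lnK ?posrE ?ltr0n// natC. Qed.

(** With u = exp v this reads |u^z - 1| <= C |u - 1|. The modulus of u^z lies between 1 and u. For
    the phase, |u^(i y) - 1| <= 2 is enough when u <= 1/2, and otherwise |ln u| <= 2 |u - 1|. *)
Lemma upow_bound z v : 0 <= complex.Re z <= 1 ->
  nc (ce (z * v%:C) - 1) <= (5 + 16 * `|complex.Im z|) * `|expR v - 1|.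
Proof.
move=> /andP[x0 x1]; set x := complex.Re z; set y := complex.Im z.
pose q : R[i] := 0 +i* (y * v).
have -> : ce (z * v%:C) - 1 = (expR (x * v) - 1)%:C * ce q + (ce q - 1).
  have -> : z * v%:C = (x * v)%:C + q.
    by apply: complex_ext; rewrite ?ReM ?ImM ?ReD ?ImD /= ?mulr0 ?subr0 ?addr0 ?add0r.
  by rewrite ceD ce_real rmorphB /=; ring.
have n1 : nc (ce q) = 1 by rewrite nc_ce expR0.
rewrite (le_trans (ncD _ _))// ncM n1 mulr1 nc_real.
rewrite (_ : 5 + 16 * `|y| = 1 + (4 + 16 * `|y|)); last by ring.
rewrite mulrDl mul1r lerD//.
  have [v0|v0] := leP 0 v.
    rewrite !ger0_norm ?subr_ge0 -?expR0 ?ler_expR ?mulr_ge0//.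
    by rewrite lerB// ler_expR -[leRHS]mul1r ler_wpM2r.
  have h1 : expR v <= expR (x * v) by rewrite ler_expR -[leLHS]mul1r ler_wnM2r// ltW.
  have h2 : expR (x * v) <= 1 by rewrite expR_le1 mulr_ge0_le0// ltW.
  by rewrite !ler0_norm; lra.
have y0 := normr_ge0 y.
have [v2|v2] := leP (2 * expR v) 1.
  rewrite (@le_trans _ _ 2)//.
    by rewrite (le_trans (ncB _ _))// n1 nc1.
  rewrite (@ler0_norm _ (expR v - 1)); last by lra.
  have w0 : 0 <= - (expR v - 1) by lra.
  by have := mulr_ge0 y0 w0; rewrite mulrDl; lra.
have vb : `|v| <= 2 * `|expR v - 1|.
  have [v0|v0] := leP 0 v.
    rewrite !ger0_norm ?subr_ge0 -?expR0 ?ler_expR//.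
    by have := expR_ge1Dx v; rewrite expR0; lra.
  rewrite !ltr0_norm ?subr_lt0 -?expR0 ?ltr_expR// expR0.
  have h1 := expR_ge1Dx (- v); have h2 := expRxMexpNx_1 v; nra.
have nq : nc q = `|y| * `|v|.
  by rewrite /q /nc /= expr0n /= add0r sqrtr_sqr normrM.
have rq : complex.Re q = 0 by [].
rewrite (le_trans (ce_taylor1 _))// nq rq expR0.
rewrite (@le_trans _ _ (8 * `|y| * (2 * `|expR v - 1|)))//.
  rewrite (_ : 4 * _ * _ = 8 * `|y| * `|v|); last by ring.
  by rewrite ler_wpM2l// mulr_ge0.
rewrite mulrA ler_wpM2r//; lra.
Qed.

(** Under the probability density rk n / rG n, the variable u = exp v / n has mean 1 and variance 1
    / n, and the left-hand side is the modulus of the mean of u^z - 1. Then [upow_bound] and the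
    inequality |u - 1| <= ((u - 1)^2 / e + e) / 2 reduce the estimate to this variance. *)
Lemma asym_bound z n (e : R) : 0 <= complex.Re z <= 1 -> (0 < n)%N -> 0 < e ->
  nc (Gamma (n%:R + z) / (npow n z * Gamma n%:R) - 1) <=
  (5 + 16 * `|complex.Im z|) * (e + (e * n%:R)^-1).
Proof.
move=> z01 n0 e0; have nR : (0 : R) < n%:R by rewrite ltr0n.
have [x0 x1] := andP z01.
have G0 := rG_gt0 nR.
have Gn : Gamma n%:R = (rG n%:R)%:C by rewrite natC Gamma_real.
have Gn0 : (rG n%:R)%:C != 0 :> R[i] by rewrite -nc_gt0 nc_real gtr0_norm.
pose C := 5 + 16 * `|complex.Im z|.
have C0 : 0 <= C by rewrite addr_ge0// mulr_ge0.
have p0 := npow_neq0 n z.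
have rn : 0 < complex.Re (n%:R : R[i]) by rewrite Re_nat.
have rnz : 0 < complex.Re (n%:R + z) by rewrite ReD Re_nat ltr_pwDl.
pose f v := (gk (n%:R + z) v - npow n z * gk n%:R v).
have fi : cig f by apply: cigB; [exact: gk_cig|apply: cigZ; exact: gk_cig].
pose h v := rk n%:R v * ((expR v / n%:R - 1) ^+ 2 / e + e) / 2.
have hE v : h v = (2^-1 * (n%:R^-1 ^+ 2 / e)) * rk (n%:R + 1 + 1) v +
   (- (n%:R^-1 / e)) * rk (n%:R + 1) v + (2^-1 * (e^-1 + e)) * rk n%:R v.
  by rewrite -!rk_mul_exp /h; field; rewrite !gt_eqF.
have i0 : intg (rk (n%:R : R)) := rk_intg nR.
have i1 : intg (rk (n%:R + 1 : R)) by apply: rk_intg; rewrite addr_gt0.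
have i2 : intg (rk (n%:R + 1 + 1 : R)) by apply: rk_intg; rewrite !addr_gt0.
have hi : intg h.
  by apply: (eq_intg (fun v => esym (hE v))); apply: intgD; [apply: intgD|]; exact: intgZ.
have hI : \int[mu]_v h v = rG n%:R * ((e * n%:R)^-1 + e) / 2.
  transitivity (\int[mu]_v ((2^-1 * (n%:R^-1 ^+ 2 / e)) * rk (n%:R + 1 + 1) v +
   (- (n%:R^-1 / e)) * rk (n%:R + 1) v + (2^-1 * (e^-1 + e)) * rk n%:R v)).
    by apply: eq_Rintegral => v _; exact: hE.
  rewrite RintegralD//; [|by apply: intgD; exact: intgZ|exact: intgZ].
  rewrite RintegralD//; [|exact: intgZ|exact: intgZ].
  rewrite !RintegralZl// -!/(rG _) !rG_succ ?addr_gt0//.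
  by field; rewrite !gt_eqF.
have fh v : nc (f v) <= expR (complex.Re z * ln n%:R) * C * h v.
  have en : expR (v - ln n%:R) = expR v / n%:R.
    by rewrite expRD expRN lnK// posrE.
  have -> : f v = gk n%:R v * npow n z * (ce (z * (v - ln n%:R)%:C) - 1).
    rewrite /f gkD [X in X - _](_ : _ = gk n%:R v * (npow n z * ce (z * (v - ln n%:R)%:C))).
      by ring.
    congr (_ * _); rewrite /npow -ceD; congr ce.
    by rewrite rmorphB /=; ring.
  rewrite !ncM nc_gk Re_nat nc_ce ReM /= mulr0 subr0.
  have hA : nc (ce (z * (v - ln n%:R)%:C) - 1) <=
      C * (((expR v / n%:R - 1) ^+ 2 / e + e) / 2).
    rewrite (le_trans (upow_bound _ z01))// -/C en ler_wpM2l//.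
    set u := `|_|; rewrite (_ : (expR v / n%:R - 1) ^+ 2 = u ^+ 2); last by rewrite real_normK ?num_real.
    rewrite -subr_ge0 (_ : _ - _ = (u - e) ^+ 2 / (2 * e)); last by field; rewrite gt_eqF.
    by rewrite divr_ge0 ?sqr_ge0// mulr_ge0// ltW.
  rewrite (_ : _ * C * h v = rk n%:R v * expR (complex.Re z * ln n%:R) *
    (C * (((expR v / n%:R - 1) ^+ 2 / e + e) / 2))); last by rewrite /h; ring.
  by apply: ler_wpM2l hA; exact: (mulr_ge0 (rk_ge0 _ _) (expR_ge0 _)).
have E : Gamma (n%:R + z) / (npow n z * Gamma n%:R) - 1 = CI f / (npow n z * (rG n%:R)%:C).
  rewrite /f CIB ?CIZ; [|exact: gk_cig|exact: gk_cig|by apply: cigZ; exact: gk_cig].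
  rewrite -/(GI _) -/(GI _) -!GammaE// Gn.
  by rewrite mulrBl mulfV// mulf_neq0.
have rz : complex.Re (z * (ln n%:R)%:C) = complex.Re z * ln n%:R.
  by rewrite ReM /= mulr0 subr0.
rewrite E ncM ncV ncM nc_ce rz nc_real (gtr0_norm G0).
have e1 := expR_gt0 (complex.Re z * ln n%:R).
rewrite ler_pdivrMr ?mulr_gt0//.
have := CI_le fi (intgZ _ hi) fh; rewrite RintegralZl// hI => /le_trans; apply.
rewrite le_eqVlt; apply/orP; left; apply/eqP; rewrite /C.
by field; rewrite !gt_eqF.
Qed.

Lemma cvg_natV : (fun n : nat => (n%:R : R)^-1) @ \oo --> (0 : R).
Proof.
apply/cvgrPdist_le => e e0; near=> n.
have n0 : (0 < n)%N by near: n; exact: nbhs_infty_gt.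
have hn : e^-1 <= n%:R by near: n; exact: nbhs_infty_ger.
rewrite sub0r normrN ger0_norm ?invr_ge0// -(invrK e) lef_pV2// posrE ?ltr0n//.
by rewrite invr_gt0.
Unshelve. all: end_near. Qed.

Lemma asym01 z : 0 <= complex.Re z <= 1 ->
  ccvg (fun n => Gamma (n%:R + z) / (npow n z * Gamma n%:R)) 1.
Proof.
move=> z01; pose C := 5 + 16 * `|complex.Im z|.
have C0 : 0 < C by rewrite ltr_pwDl// mulr_ge0.
apply/cvgrPdist_le => e e0; pose d := e / (2 * C).
have d0 : 0 < d by rewrite divr_gt0// mulr_gt0.
near=> n; have n0 : (0 < n)%N by near: n; exact: nbhs_infty_gt.
rewrite sub0r normrN ger0_norm ?nc_ge0// (le_trans (asym_bound z01 n0 d0))// -/C.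
have hn : (d ^+ 2)^-1 <= n%:R by near: n; exact: nbhs_infty_ger.
have nR : (0 : R) < n%:R by rewrite ltr0n.
have h : (d * n%:R)^-1 <= d.
  rewrite -(invrK d) lef_pV2 ?posrE ?mulr_gt0 ?invr_gt0// invrK.
  rewrite -(ler_pM2l d0) mulfV ?gt_eqF// mulrA -expr2.
  by rewrite -ler_pdivrMl ?exprn_gt0// mulr1.
apply: (@le_trans _ _ (C * (d + d))).
  by rewrite ler_wpM2l ?(ltW C0)// lerD2l.
rewrite le_eqVlt; apply/orP; left; apply/eqP; rewrite /d; field.
by rewrite gt_eqF.
Unshelve. all: end_near. Qed.

Lemma ccvg_addn_div z : ccvg (fun n => (n%:R + z) / n%:R) 1.
Proof.
apply: (@ccvg_squeeze_near _ _ _ (fun n => nc z * n%:R^-1)).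
  near=> n; have n0 : (0 < n)%N by near: n; exact: nbhs_infty_gt.
  have nn : (n%:R : R[i]) != 0 by rewrite pnatr_eq0 -lt0n.
  rewrite (_ : _ - 1 = z * n%:R^-1); last by field.
  by rewrite ncM ncV natC nc_real ger0_norm.
by rewrite -(mulr0 (nc z)); apply: cvgM; [exact: cvg_cst|exact: cvg_natV].
Unshelve. all: end_near. Qed.

Lemma natr_Re_neq0 n z : (0 < n)%N -> 0 <= complex.Re z -> n%:R + z != 0.
Proof.
move=> n0 z0; apply/eqP => /(congr1 (@complex.Re R)); rewrite ReD Re_nat /= => h.
have : (0 : R) < n%:R by rewrite ltr0n.
lra.
Qed.

(** Induction on an integer bound of the real part: the functional equation lowers [z] by 1 and
    costs the factor (n + z - 1) / n, which tends to 1. *)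
Lemma asym z : 0 <= complex.Re z ->
  ccvg (fun n => Gamma (n%:R + z) / (npow n z * Gamma n%:R)) 1.
Proof.
move=> z0; have [m hm] : exists m : nat, complex.Re z < m%:R.
  by exists (Num.truncn (complex.Re z)).+1; exact: truncnS_gt.
elim: m z z0 hm => [|m IH] z z0 hm; first by exfalso; move: hm; lra.
have [z1|z1] := leP (complex.Re z) 1; first by apply: asym01; rewrite z0.
have zm1 : 0 <= complex.Re (z - 1) by rewrite ReB /= subr_ge0 ltW.
have H : ccvg (fun n => Gamma (n%:R + (z - 1)) / (npow n (z - 1) * Gamma n%:R)) 1.
  by apply: IH => //; rewrite ReB /= ltrBlDr natr1.
have := ccvgM (ccvg_addn_div (z - 1)) H; rewrite mulr1; apply: near_ccvg; near=> n.
have n0 : (0 < n)%N by near: n; exact: nbhs_infty_gt.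
have nn : (n%:R : R[i]) != 0 by rewrite pnatr_eq0 -lt0n.
have -> : n%:R + z = n%:R + (z - 1) + 1 by ring.
rewrite Gamma_succ; last exact: natr_Re_neq0.
have -> : npow n z = npow n (z - 1) * n%:R by rewrite -[X in _ * X](npow1 n0) -npowD subrK.
by rewrite [in LHS]mulrACA -invfM (mulrC n%:R) (mulrAC _ n%:R).
Unshelve. all: end_near. Qed.

Lemma Gamma_nat_neq0 n : (0 < n)%N -> Gamma (n%:R : R[i]) != 0.
Proof.
move=> n0; rewrite natC Gamma_real ?ltr0n// -nc_gt0 nc_real gtr0_norm rG_gt0 ?ltr0n//.
Qed.

(** A zero at [z] would propagate to all z + n by the functional equation, against the limit 1 of
    [asym]. *)
Lemma Gamma_neq0_gt0 z : 0 < complex.Re z -> Gamma z != 0.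
Proof.
move=> z0; apply/eqP => Gz.
have Re0 k : z + k%:R != 0.
  apply/eqP => /(congr1 (@complex.Re R)); rewrite ReD Re_nat /=.
  by have : 0 <= k%:R :> R by []; lra.
have := ccvg_neq0 (asym (ltW z0)) (oner_neq0 _) => h.
near \oo => n; have : Gamma (n%:R + z) / (npow n z * Gamma n%:R) != 0 by near: n.
by rewrite addrC Gamma_addn// Gz mulr0 mul0r eqxx.
Unshelve. all: end_near. Qed.

Lemma Gamma_neq0 z : (forall k, z + k%:R != 0) -> Gamma z != 0.
Proof.
move=> zk; apply/eqP => Gz.
pose n := (Num.truncn (- complex.Re z)).+1.
have : Gamma (z + n%:R) != 0.
  apply: Gamma_neq0_gt0; rewrite ReD Re_nat.
  by have := truncnS_gt (- complex.Re z); rewrite /n; lra.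
by rewrite Gamma_addn// Gz mulr0 eqxx.
Qed.

Lemma asym_ratio x z : complex.Re z = x -> 0 <= x ->
  (fun n => nc (Gamma (n%:R + z)) / rG (n%:R + x)) @ \oo --> (1 : R).
Proof.
move=> zx x0; have h1 : ccvg (fun n => Gamma (n%:R + z) / (npow n z * Gamma n%:R)) 1.
  by apply: asym; rewrite zx.
have h2 := asym (z := x%:C) x0.
have n10 : nc (1 : R[i]) != 0 by rewrite nc1 oner_neq0.
have := rcvgM (ccvg_nc h1) (rcvgV n10 (ccvg_nc h2)); rewrite nc1 invr1 mulr1 => H.
apply: near_rcvg H; near=> n.
have n0 : (0 < n)%N by near: n; exact: nbhs_infty_gt.
have nx : (0 : R) < n%:R + x by rewrite ltr_pwDl ?ltr0n.
have -> : n%:R + x%:C = (n%:R + x)%:C.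
  by rewrite natC; apply: complex_ext; rewrite ?ReD ?ImD /= ?addr0.
rewrite Gamma_real// !nc_div_mul nc_real (gtr0_norm (rG_gt0 nx)) !nc_ce !ReMr zx.
rewrite (_ : complex.Re x%:C = x)//.
have g0 := rG_gt0 nx. have e0 := expR_gt0 (x * ln n%:R).
have gn : 0 < nc (Gamma (n%:R : R[i])) by rewrite nc_gt0 Gamma_nat_neq0.
by field; rewrite !gt_eqF.
Unshelve. all: end_near. Qed.

(* The partial products of |Gamma (x + i y) / Gamma x|^2; every comparison between
   values of |Gamma| on different lines is read off factor by factor. *)
Definition Gprod x y n : R := \prod_(k < n) ((x + k%:R) ^+ 2 / ((x + k%:R) ^+ 2 + y ^+ 2)).

Lemma rG_addn x n : 0 < x -> rG (x + n%:R) = (\prod_(k < n) (x + k%:R)) * rG x.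
Proof.
move=> x0; elim: n => [|n IH]; first by rewrite addr0 big_ord0 mul1r.
have xn : 0 < x + n%:R by rewrite ltr_wpDr.
rewrite -natr1 addrA (rG_succ xn) IH big_ord_recr /=; ring.
Qed.

(** The functional equation turns the sequence of [asym_ratio] into |Gamma z| / Gamma x divided by
    the square root of [Gprod x y n]; its limit being 1, the product converges to the square of this
    ratio. *)
Lemma cvg_Gprod x y : 0 < x ->
  Gprod x y @ \oo --> (nc (Gamma (x +i* y)) / rG x) ^+ 2.
Proof.
move=> x0; pose z := x +i* y; have h := @asym_ratio x z erefl (ltW x0).
have n1 : (1 * 1 : R) != 0 by rewrite mulr1 oner_neq0.
have hc : (fun _ : nat => (nc (Gamma z) / rG x) ^+ 2) @ \oo --> (nc (Gamma z) / rG x) ^+ 2.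
  exact: cvg_cst.
have := rcvgM hc (rcvgV n1 (rcvgM h h)).
rewrite mulr1 invr1 mulr1 => H; apply: near_rcvg H; apply: nearW => n.
have zk k : z + k%:R != 0.
  apply/eqP => /(congr1 (@complex.Re R)); rewrite ReD Re_nat /=.
  by have : 0 <= k%:R :> R by []; lra.
rewrite addrC Gamma_addn// (addrC n%:R) rG_addn// ncM nc_prod.
have g0 : 0 < nc (Gamma z) by rewrite nc_gt0 Gamma_neq0.
have r0 := rG_gt0 x0.
have p1 : 0 < \prod_(k < n) nc (z + k%:R) by apply: prodr_gt0 => k _; rewrite nc_gt0.
have p2 : 0 < \prod_(k < n) (x + k%:R) by apply: prodr_gt0 => k _; rewrite ltr_wpDr.
have -> : Gprod x y n = (\prod_(k < n) (x + k%:R)) ^+ 2 / (\prod_(k < n) nc (z + k%:R)) ^+ 2.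
  rewrite /Gprod -!prodrXl -prodfV -big_split /=; apply: eq_bigr => k _.
  by rewrite nc_sqr ReD ImD Re_nat Im_nat /= addr0.
by field; rewrite !gt_eqF.
Qed.

Lemma Gprod_mono x1 x2 y n : 0 < x1 -> x1 <= x2 -> Gprod x1 y n <= Gprod x2 y n.
Proof.
move=> x10 x12; apply: ler_prod => k _.
have k0 : 0 <= k%:R :> R by [].
have a1 : 0 < x1 + k%:R by rewrite ltr_wpDr.
have a2 : x1 + k%:R <= x2 + k%:R by rewrite lerD2r.
have a3 : 0 < x2 + k%:R by exact: lt_le_trans a2.
have b1 : 0 < (x1 + k%:R) ^+ 2 + y ^+ 2 by rewrite ltr_pwDl ?exprn_gt0 ?sqr_ge0.
have b2 : 0 < (x2 + k%:R) ^+ 2 + y ^+ 2 by rewrite ltr_pwDl ?exprn_gt0 ?sqr_ge0.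
rewrite divr_ge0 ?sqr_ge0 ?(ltW b1)//=.
rewrite ler_pdivrMr// mulrAC ler_pdivlMr//.
have s12 : (x1 + k%:R) ^+ 2 <= (x2 + k%:R) ^+ 2 by rewrite ler_sqr ?nnegrE ?(ltW a1) ?(ltW a3).
have := ler_wpM2r (sqr_ge0 y) s12; rewrite !mulrDr; nra.
Qed.

Lemma Gamma_mono x1 x2 y : 0 < x1 -> x1 <= x2 ->
  nc (Gamma (x1 +i* y)) / rG x1 <= nc (Gamma (x2 +i* y)) / rG x2.
Proof.
move=> x10 x12; have x20 : 0 < x2 by exact: lt_le_trans x12.
have g1 := rG_gt0 x10; have g2 := rG_gt0 x20.
rewrite -ler_sqr ?nnegrE ?divr_ge0 ?nc_ge0 ?(ltW g1) ?(ltW g2)//.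
rewrite -(cvg_lim _ (cvg_Gprod (y := y) x10))// -(cvg_lim _ (cvg_Gprod (y := y) x20))//.
apply: ler_lim; [apply: cvgP; exact: cvg_Gprod|apply: cvgP; exact: cvg_Gprod|].
by apply: nearW => n; exact: Gprod_mono.
Qed.

Lemma Gamma_conj z : 0 < complex.Re z -> Gamma (conjc z) = conjc (Gamma z).
Proof.
by move=> z0; rewrite !GammaE ?GI_conj//; case: z z0.
Qed.

End GammaAsymptotic.


(** * Reflection formulas on the lines of abscissa 1 and 1/2 *)

Section CosineIntegrals.
Context {R : realType}.
Implicit Types (x y t : R).
Local Notation mu := (@lebesgue_measure R).

Lemma rcvg_squeeze (u : nat -> R) (l : R) (d : nat -> R) :
  (forall n, `|u n - l| <= d n) -> d @ \oo --> (0 : R) -> u @ \oo --> l.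
Proof.
move=> h hd; apply/cvgrPdist_lt => e e0; near=> n.
rewrite distrC; apply: le_lt_trans (h n) _; near: n.
exact: (cvgr_lt (0 : R)).
Unshelve. all: end_near.
Qed.

Definition ch t : R := (expR t + expR (- t)) / 2.
Definition sh t : R := (expR t - expR (- t)) / 2.

Lemma ch0 : ch 0 = 1.
Proof. by rewrite /ch oppr0 expR0; field. Qed.

Lemma sh0 : sh 0 = 0.
Proof. by rewrite /sh oppr0 subrr mul0r. Qed.

Lemma ch_ge1 t : 1 <= ch t.
Proof.
rewrite /ch ler_pdivlMr// mul1r.
have h := expRxMexpNx_1 t; have h1 := expR_gt0 t; have h2 := expR_gt0 (- t).
have := sqr_ge0 (expR t - expR (- t)); nra.
Qed.

Lemma is_derive_ch (c t : R) : is_derive t 1 (fun t => ch (c * t)) (c * sh (c * t)).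
Proof. by rewrite /ch /sh; apply: is_derive_eq; rewrite /GRing.scale /=; field. Qed.

Lemma is_derive_sh (c t : R) : is_derive t 1 (fun t => sh (c * t)) (c * ch (c * t)).
Proof. by rewrite /ch /sh; apply: is_derive_eq; rewrite /GRing.scale /=; field. Qed.

Lemma derive_cont (f df : R -> R) : (forall x, is_derive x 1 f (df x)) -> continuous f.
Proof. by move=> h x; exact: is_derive_continuous (h x). Qed.

Lemma ch_cont c : continuous (fun t => ch (c * t)).
Proof. exact: derive_cont (is_derive_ch c). Qed.

(* cosI n y / cosI n 0 tends to 1 when n tends to oo, while the recurrence
   from n to n + 2 turns it into a partial product of |Gamma|^2: comparing the two
   evaluates |Gamma (1 + i y)| and |Gamma (1/2 + i y)|. *)
Definition cosI n y := \int[mu]_(t in `[0, pi / 2]) (cos t ^+ n * ch (2 * y * t)).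

Lemma cosn_cont n : continuous (fun t : R => cos t ^+ n).
Proof.
elim: n => [|n IH]; first by under eq_fun do rewrite expr0; move=> t; exact: cvg_cst.
by under eq_fun do rewrite exprS; move=> t; apply: cvgM; [exact: continuous_cos|exact: IH].
Qed.

Lemma cosI_cont n y : continuous (fun t : R => cos t ^+ n * ch (2 * y * t)).
Proof. by move=> t; apply: cvgM; [exact: cosn_cont|exact: ch_cont]. Qed.

Let pi2 : 0 <= pi / 2 :> R.
Proof. by rewrite divr_ge0// pi_ge0. Qed.

(** Two integrations by parts, combined in one antiderivative [F] that vanishes at 0 and at pi /
    2. *)
Lemma cosI_rec n y :
  ((n.+2%:R) ^+ 2 + 4 * y ^+ 2) * cosI n.+2 y = n.+2%:R * n.+1%:R * cosI n y.
Proof.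
pose f t := ((n.+2%:R) ^+ 2 + 4 * y ^+ 2) * (cos t ^+ n.+2 * ch (2 * y * t)) -
  n.+2%:R * n.+1%:R * (cos t ^+ n * ch (2 * y * t)).
pose F t := n.+2%:R * cos t ^+ n.+1 * sin t * ch (2 * y * t) +
  2 * y * cos t ^+ n.+2 * sh (2 * y * t).
have cf : continuous f.
  by move=> t; apply: cvgB; apply: cvgM; [exact: cvg_cst|exact: cosI_cont|
    exact: cvg_cst|exact: cosI_cont].
have dF t : is_derive t 1 F (f t).
  have d1 := is_derive_ch (2 * y) t; have d2 := is_derive_sh (2 * y) t.
  have dn (m : nat) : is_derive t 1 (fun t : R => cos t ^+ m.+1) (- (m.+1%:R * cos t ^+ m * sin t)).
    have := is_deriveX m.+1 (is_derive_cos t); rewrite exprfctE => h.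
    by apply: (is_derive_eq h); rewrite /GRing.scale /= mulrN.
  have dn1 := dn n; have dn2 := dn n.+1.
  rewrite /F /f; apply: is_derive_eq; rewrite /GRing.scale /= !(exprS (cos t)).
  have s2 : sin t * sin t = 1 - cos t * cos t by rewrite -!expr2 sin2cos2.
  have N2 : n.+2%:R = n.+1%:R + 1 :> R by rewrite natr1.
  move: N2 s2; move: (n.+2%:R) (n.+1%:R) (cos t) (sin t) (ch _) (sh _) => N2 N1 C S c s -> s2.
  set X := C ^+ n; transitivity ((N1 + 1) * (C * X * C - N1 * X * (S * S)) * c + 4 * y ^+ 2 * (C * (C * X)) * c);
    last by rewrite s2; ring.
  ring.
have := FTC_itv pi2 cf dF.
rewrite {1}/f RintegralB//; last 2 first.
- by apply: cont_itv_intg => t; apply: cvgM; [exact: cvg_cst|exact: cosI_cont].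
- by apply: cont_itv_intg => t; apply: cvgM; [exact: cvg_cst|exact: cosI_cont].
rewrite !RintegralZl//; try (apply: cont_itv_intg; exact: cosI_cont).
rewrite /F sin0 cos_pihalf !mulr0 !mul0r sh0 !mulr0 !expr0n /= !(mulr0, mul0r) !addr0 subr0.
by move=> /eqP; rewrite subr_eq0 => /eqP.
Qed.

Lemma cosI0 y : 2 * y * cosI 0 y = sh (pi * y).
Proof.
have cf : continuous (fun t => 2 * y * ch (2 * y * t)).
  by move=> t; apply: cvgM; [exact: cvg_cst|exact: ch_cont].
have := FTC_itv pi2 cf (is_derive_sh (2 * y)); rewrite mulr0 sh0 subr0.
rewrite RintegralZl//; last (apply: cont_itv_intg; exact: ch_cont).
rewrite (_ : 2 * y * (pi / 2) = pi * y); last by field.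
move=> <-; congr (_ * _); apply: eq_Rintegral => t _; by rewrite expr0 mul1r.
Qed.

Lemma cosI00 : cosI 0 0 = pi / 2.
Proof.
transitivity (\int[mu]_(t in `[0, pi / 2]) (1 : R)).
  by apply: eq_Rintegral => t _; rewrite expr0 mul1r mulr0 mul0r ch0.
by rewrite Rintegral_cst//= lebesgue_measure_itv/= lte_fin divr_gt0 ?pi_gt0//= oppr0 addr0 mul1r.
Qed.

Lemma cosI1 y : (1 + 4 * y ^+ 2) * cosI 1 y = ch (pi * y).
Proof.
pose F t := sin t * ch (2 * y * t) + 2 * y * cos t * sh (2 * y * t).
have dF t : is_derive t 1 F ((1 + 4 * y ^+ 2) * (cos t ^+ 1 * ch (2 * y * t))).
  have d1 := is_derive_ch (2 * y) t; have d2 := is_derive_sh (2 * y) t.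
  by rewrite /F; apply: is_derive_eq; rewrite /GRing.scale /=; ring.
have cf : continuous (fun t => (1 + 4 * y ^+ 2) * (cos t ^+ 1 * ch (2 * y * t))).
  by move=> t; apply: cvgM; [exact: cvg_cst|exact: cosI_cont].
have := FTC_itv pi2 cf dF; rewrite RintegralZl//; last (apply: cont_itv_intg; exact: cosI_cont).
rewrite /F sin0 cos_pihalf sin_pihalf !mulr0 !mul0r sh0 !mulr0 !addr0 subr0 mul1r => ->.
by congr ch; field.
Qed.

Lemma cosI_gt0 n : 0 < cosI n 0.
Proof.
have [m] := ubnP n; elim: m n => // m IH [|[|n]] nm.
- by rewrite cosI00 divr_gt0 ?pi_gt0.
- by have := cosI1 0; rewrite expr0n /= !mulr0 addr0 mul1r ch0 => ->.
have h : 0 < cosI n 0 by apply: IH; lia.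
have := cosI_rec n 0; rewrite expr0n /= mulr0 addr0 => e.
have n2 : (0 : R) < n.+2%:R by rewrite ltr0n.
have : 0 < n.+2%:R ^+ 2 * cosI n.+2 0 by rewrite e !mulr_gt0// ltr0n.
by rewrite pmulr_rgt0// exprn_gt0.
Qed.

(** A weak form of Jordan's inequality: up to 1 the cosine is at least cos 1, and beyond 1 the sine
    is at least sin 1 while t < 2. *)
Lemma sin_ge_lin : exists2 c : R, 0 < c & forall t, 0 <= t <= pi / 2 -> c * t <= sin t.
Proof.
have s1 : 0 < sin (1 : R) by apply: sin2_gt0; rewrite ltr01 ltr1n.
have c1 := @cos1_gt0 R.
have p2 := @pihalf_lt2 R; have p1 := @pihalf_ge1 R.
exists (Num.min (cos 1) (sin 1 / 2)); first by rewrite lt_min c1 divr_gt0.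
move=> t /andP[t0 t2].
have [t1|t1] := leP t 1.
  have [->|tn0] := eqVneq t 0; first by rewrite mulr0 sin0.
  have tp : 0 < t by rewrite lt_neqAle eq_sym tn0.
  have [c] := @MVT R sin cos 0 t tp (fun x _ => is_derive_sin x)
    (cont_within (@continuous_sin R)).
  rewrite in_itv/= => /andP[c0 ct]; rewrite sin0 !subr0 => ->.
  rewrite ler_wpM2r// (@le_trans _ _ (cos 1)) ?ge_min ?lexx//.
  by apply/ltW; rewrite ltr_cos ?in_itv/=; [lra|apply/andP; split; lra|apply/andP; split; lra].
rewrite (@le_trans _ _ (sin 1 / 2 * t))//.
  by rewrite ler_wpM2r// ge_min lexx orbT.
rewrite (@le_trans _ _ (sin 1))//; first by nra.
by apply/ltW; rewrite ltr_sin ?in_itv/=; [lra|apply/andP; split; lra|apply/andP; split; lra].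
Qed.

(** The linear terms of exp a and exp (- a) cancel in the mean, which leaves the two second-order
    remainders. *)
Lemma ch_le (A a : R) : `|a| <= A -> ch a - 1 <= 8 * a ^+ 2 * (1 + expR A).
Proof.
move=> aA.
have h (b : R) : `|b| <= A -> expR b - 1 - b <= 8 * b ^+ 2 * (1 + expR A).
  move=> bA; have := ce_taylor2 b%:C; rewrite ce_real -!rmorphB !nc_real /=.
  rewrite real_normK ?num_real// => h; rewrite (le_trans (ler_norm _))// (le_trans h)//.
  have b2 : 0 <= 8 * b ^+ 2 by rewrite mulr_ge0 ?sqr_ge0.
  by apply: (ler_wpM2l b2); apply: lerD => //; rewrite ler_expR; exact: le_trans (ler_norm _) bA.
have h1 := h _ aA; have := h (- a); rewrite normrN sqrrN => /(_ aA).
rewrite /ch; lra.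
Qed.

(** On [0, pi / 2], [ch (2 * y * t) - 1] is at most a multiple of t^2, hence of (sin t)^2, and the
    integral of (cos t)^n (sin t)^2 is [cosI n 0 - cosI n.+2 0], that is [cosI n 0] divided by n +
    2. *)
Lemma cosI_ratio y : (fun n => cosI n y / cosI n 0) @ \oo --> (1 : R).
Proof.
have [c c0 hc] := sin_ge_lin.
pose A := 4 * `|y|; pose K := 8 * (4 * y ^+ 2) * (1 + expR A) / c ^+ 2.
have K0 : 0 <= K.
  apply: divr_ge0; last exact: sqr_ge0.
  by have := sqr_ge0 y; have := expR_ge0 A; nra.
have p2 := @pihalf_lt2 R.
have bound n : `|cosI n y / cosI n 0 - 1| <= K * n.+1%:R^-1.
  have I0 := cosI_gt0 n.
  have cn t : 0 <= t <= pi / 2 -> 0 <= cos t ^+ n.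
    move=> /andP[t0 t1]; apply: exprn_ge0; apply: cos_ge0_pihalf.
    by rewrite t1 andbT (le_trans _ t0)// oppr_le0.
  have h1 : cosI n 0 <= cosI n y.
    apply: le_Rintegral => //; try (apply: cont_itv_intg; exact: cosI_cont).
    move=> t /=; rewrite in_itv/= => ht; rewrite ler_wpM2l ?cn//.
    by rewrite mulr0 mul0r ch0 ch_ge1.
  have h2 : cosI n y - cosI n 0 <= K * (cosI n 0 - cosI n.+2 0).
    rewrite -!RintegralB//; try (apply: cont_itv_intg; exact: cosI_cont).
    have cB (a b : nat) u v : continuous (fun t : R => cos t ^+ a * ch (2 * u * t) - cos t ^+ b * ch (2 * v * t)).
      by move=> t; apply: cvgB; exact: cosI_cont.
    rewrite -RintegralZl//; last (apply: cont_itv_intg; exact: cB).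
    apply: le_Rintegral => //; first (apply: cont_itv_intg; exact: cB).
      by apply: cont_itv_intg => t; apply: cvgM; [exact: cvg_cst|exact: cB].
    move=> t /=; rewrite in_itv/= => ht.
    rewrite !mulr0 !mul0r ch0 !mulr1 (_ : _ - cos t ^+ n = cos t ^+ n * (ch (2 * y * t) - 1)); last by ring.
    rewrite (_ : K * _ = cos t ^+ n * (K * sin t ^+ 2)); last first.
      by rewrite sin2cos2 !exprS; ring.
    rewrite ler_wpM2l ?cn//; have /andP[t0 t1] := ht.
    have aA : `|2 * y * t| <= A.
      rewrite !normrM (ger0_norm t0) ger0_norm// /A -[leRHS]mulr1 -(mulrA 2) (_ : 4 * _ * 1 = 2 * (`|y| * 2)); last by ring.
      by rewrite ler_pM2l// ler_wpM2l//; exact: ltW (le_lt_trans t1 p2).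
    apply: (le_trans (ch_le aA)); rewrite /K [leRHS]mulrAC ler_pdivlMr ?exprn_gt0//.
    have : (c * t) ^+ 2 <= sin t ^+ 2.
      rewrite ler_sqr ?nnegrE ?hc//; first by rewrite mulr_ge0// ltW.
      by rewrite (le_trans _ (hc t ht))// mulr_ge0// ltW.
    have q0 : 0 <= 8 * (4 * y ^+ 2) * (1 + expR A).
      by have := sqr_ge0 y; have := expR_ge0 A; nra.
    move=> /(ler_wpM2l q0); apply: le_trans.
    by rewrite le_eqVlt; apply/orP; left; apply/eqP; ring.
  have e := cosI_rec n 0; rewrite expr0n /= mulr0 addr0 in e.
  have n2 : (n.+2%:R : R) != 0 by rewrite pnatr_eq0.
  have n1 : (n.+1%:R : R) != 0 by rewrite pnatr_eq0.
  have e2 : cosI n.+2 0 = n.+1%:R / n.+2%:R * cosI n 0.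
    apply: (mulfI (mulf_neq0 n2 n2)); rewrite -expr2 e.
    by move: n2; move: (n.+2%:R) => N ?; field.
  have e3 : (1 - n.+1%:R / n.+2%:R) = n.+2%:R^-1 :> R.
    by move: n2; rewrite -(natr1 n.+1); move: (n.+1%:R) => N ?; field.
  move: h1 h2 I0; rewrite {e} e2; move: (cosI n y) (cosI n 0) => u v uv h2 v0.
  have {h2} h2 : u - v <= K * n.+2%:R^-1 * v by rewrite -e3; apply: le_trans h2 _; rewrite le_eqVlt; apply/orP; left; apply/eqP; ring.
  have -> : u / v - 1 = (u - v) / v by field; rewrite gt_eqF.
  rewrite ger0_norm; last by rewrite divr_ge0 ?subr_ge0// ltW.
  rewrite ler_pdivrMr//; apply: (le_trans h2); apply: ler_wpM2r; first exact: ltW.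
  by apply: ler_wpM2l => //; rewrite lef_pV2 ?posrE ?ltr0n// ler_nat.
apply: (rcvg_squeeze bound).
have hK : (fun _ : nat => K) @ \oo --> K by exact: cvg_cst.
by have := rcvgM hK (@cvg_harmonic R); rewrite mulr0.
Qed.

Lemma GprodS x y n :
  Gprod x y n.+1 = Gprod x y n * ((x + n%:R) ^+ 2 / ((x + n%:R) ^+ 2 + y ^+ 2)).
Proof. by rewrite /Gprod big_ord_recr. Qed.

(** At the index 2 (k + 1), the recurrence divided by the same recurrence for y = 0 is the factor of
    rank k of [Gprod 1 y]. *)
Lemma cosI_even n y :
  cosI n.*2 y / cosI n.*2 0 = cosI 0 y / cosI 0 0 * Gprod 1 y n.
Proof.
elim: n => [|n IH]; first by rewrite /Gprod big_ord0 mulr1.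
rewrite GprodS [RHS]mulrA -IH doubleS.
have g0 := cosI_gt0 n.*2; have g2 := cosI_gt0 n.*2.+2.
have e0 := cosI_rec n.*2 0; have ey := cosI_rec n.*2 y.
have nn : (0 : R) <= n%:R by [].
have n2E : (n.*2.+2%:R : R) = 2 * (1 + n%:R).
  by rewrite -!natr1 -muln2 natrM; ring.
have d1 : (1 + n%:R) ^+ 2 + y ^+ 2 != 0 :> R.
  by rewrite gt_eqF// ltr_pwDl ?sqr_ge0// exprn_gt0// ltr_pwDl.
have d2 : (1 + n%:R : R) != 0 by rewrite gt_eqF// ltr_pwDl.
rewrite n2E in e0 ey.
have b0 : (n.*2.+1%:R : R) != 0 by rewrite pnatr_eq0.
have d3 : (2 * (1 + n%:R)) ^+ 2 + 4 * y ^+ 2 != 0 :> R.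
  rewrite (_ : _ + _ = 4 * ((1 + n%:R) ^+ 2 + y ^+ 2)); last by ring.
  by rewrite mulf_neq0// pnatr_eq0.
have E0 : cosI n.*2.+2 0 = n.*2.+1%:R / (2 * (1 + n%:R)) * cosI n.*2 0.
  apply: (mulfI (x := (2 * (1 + n%:R)) ^+ 2)); first by rewrite expf_neq0// mulf_neq0// pnatr_eq0.
  by rewrite expr0n /= mulr0 addr0 in e0; rewrite e0; field.
have Ey : cosI n.*2.+2 y = 2 * (1 + n%:R) * n.*2.+1%:R / ((2 * (1 + n%:R)) ^+ 2 + 4 * y ^+ 2) * cosI n.*2 y.
  by apply: (mulfI d3); rewrite ey; field.
rewrite E0 Ey.
rewrite (_ : (2 * (1 + n%:R)) ^+ 2 + 4 * y ^+ 2 = 4 * ((1 + n%:R) ^+ 2 + y ^+ 2)); last by ring.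
move: b0 d1 d2 (lt0r_neq0 g0); move: (n.*2.+1%:R) (1 + n%:R) (cosI _ y) (cosI _ 0).
by move=> m p u v b0 d1 d2 v0; field; rewrite b0 d1 d2 v0.
Qed.

(** Half-integers replace integers, and [cosI1] supplies the factor of rank 0, whence the length
    [n.+1] of the product. *)
Lemma cosI_odd n y :
  cosI n.*2.+1 y / cosI n.*2.+1 0 = ch (pi * y) * Gprod 2^-1 y n.+1.
Proof.
elim: n => [|n IH].
  rewrite /Gprod big_ord1 /= addr0 -cosI1.
  have := cosI1 0; rewrite expr0n /= !mulr0 addr0 mul1r ch0 => ->; field.
  have := sqr_ge0 y => y2.
  by rewrite !gt_eqF//; lra.
rewrite GprodS [RHS]mulrA -IH doubleS.
have g0 := cosI_gt0 n.*2.+1; have g2 := cosI_gt0 n.*2.+3.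
have e0 := cosI_rec n.*2.+1 0; have ey := cosI_rec n.*2.+1 y.
have nn : (0 : R) <= n%:R by [].
set q : R := 2^-1 + n.+1%:R.
have n2E : (n.*2.+3%:R : R) = 2 * q.
  by rewrite /q -!natr1 -muln2 natrM; field.
have q0 : 0 < q by rewrite ltr_pwDl.
have d1 : q ^+ 2 + y ^+ 2 != 0 :> R.
  by rewrite gt_eqF// ltr_pwDl ?sqr_ge0// exprn_gt0.
have d2 : q != 0 by rewrite gt_eqF.
rewrite n2E in e0 ey.
have b0 : (n.*2.+2%:R : R) != 0 by rewrite pnatr_eq0.
have d3 : (2 * q) ^+ 2 + 4 * y ^+ 2 != 0 :> R.
  rewrite (_ : _ + _ = 4 * (q ^+ 2 + y ^+ 2)); last by ring.
  by rewrite mulf_neq0// pnatr_eq0.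
have E0 : cosI n.*2.+3 0 = n.*2.+2%:R / (2 * q) * cosI n.*2.+1 0.
  apply: (mulfI (x := (2 * q) ^+ 2)); first by rewrite expf_neq0// mulf_neq0// pnatr_eq0.
  by rewrite expr0n /= mulr0 addr0 in e0; rewrite e0; field.
have Ey : cosI n.*2.+3 y = 2 * q * n.*2.+2%:R / ((2 * q) ^+ 2 + 4 * y ^+ 2) * cosI n.*2.+1 y.
  by apply: (mulfI d3); rewrite ey; field.
rewrite E0 Ey (_ : (2 * q) ^+ 2 + 4 * y ^+ 2 = 4 * (q ^+ 2 + y ^+ 2)); last by ring.
clear q0 d3 E0 Ey e0 ey; move: b0 d1 d2 (lt0r_neq0 g0); clear n2E; clearbody q; move: (n.*2.+2%:R) (cosI _ y) (cosI _ 0).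
by move=> m u v b0 d1 d2 v0; field; rewrite b0 d1 d2 v0.
Qed.

Lemma rG1 : rG (1 : R) = 1.
Proof.
have d (v : R) : is_derive v 1 (fun v => - expR (- expR v)) (rk 1 v).
  rewrite /rk mul1r expRD; apply: is_derive_eq; rewrite /GRing.scale /=; ring.
rewrite /rG (FTC_R (lp := 0) (lm := -1) _ _ d); [by rewrite sub0r opprK| exact: rk_cont| exact: rk_intg| |].
  rewrite -oppr0; apply: cvgN.
  apply: rcvg_squeeze (cvg_expR_natN (@ltr01 R)) => n.
  rewrite subr0 ger0_norm ?expR_ge0// ler_expR mul1r lerN2.
  by rewrite (le_trans _ (expR_ge1Dx _))// lerDr.
apply: cvgN; rewrite -[X in _ --> X]expR0 -[X in _ --> expR X]oppr0.
apply: (@cvg_comp _ _ _ (fun n : nat => expR (- n%:R)) (fun x => expR (- x)) _ (nbhs (0 : R))).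
  by apply: near_rcvg (cvg_expR_natN (@ltr01 R)); apply: nearW => n; rewrite mul1r.
apply: (@continuous_comp _ _ _ (fun x : R => - x) expR); first exact: oppr_continuous.
exact: continuous_expR.
Qed.

(** The substitution t = exp (v / 2) identifies [rG 2^-1] with the integral of 2 exp (- t^2) over
    the half-line, a Gaussian integral. *)
Lemma rG_half : rG (2^-1 : R) ^+ 2 = pi.
Proof.
have h0 : (0 : R) < 2^-1 by [].
have cg t : 0 < t -> {for t, continuous (fun t : R => 2 * expR (- t ^+ 2))}.
  move=> _; apply: cvgM; first exact: cvg_cst.
  apply: continuous_comp; last exact: continuous_expR.
  by apply: cvgN; exact: exprn_continuous.
have := subst_expR h0 cg.
rewrite [X in _ = X -> _](_ : _ = rG 2^-1); last first.
  apply: eq_Rintegral => v _.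
  have -> : expR (2^-1 * v) ^+ 2 = expR v by rewrite expr2 -expRD; congr expR; field.
  by rewrite /rk expRD; move: (expR _) (expR _) => u w; field.
have gi : mu.-integrable `]0, +oo[ (EFin \o (fun t : R => expR (- t ^+ 2))).
  by apply: intgS => //; exact: integrableT_gauss.
rewrite RintegralZl// => <-.
have -> : \int[mu]_(x in `]0, +oo[) expR (- x ^+ 2) = Num.sqrt pi / 2.
  rewrite Rintegral_itv_obnd_cbnd//.
  have E := f_equal (@fine R) (@integral0y_gauss R).
  by rewrite -[RHS]E.
by rewrite mulrC divfK ?pnatr_eq0// sqr_sqrtr// pi_ge0.
Qed.

(** Written as a product, the identity covers y = 0, where [cosI0] degenerates. *)
Lemma Gamma1_nc y : nc (Gamma (1 +i* y)) ^+ 2 * sh (pi * y) = pi * y.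
Proof.
have [->|y0] := eqVneq y 0; first by rewrite mulr0 sh0 mulr0.
have h1 : (fun n => cosI 0 y / cosI 0 0 * Gprod 1 y n) @ \oo --> (1 : R).
  have := cvg_comp (fun n => n.*2) _ _ (cosI_ratio y) => H.
  have dbl : (fun n => n.*2) @ \oo --> \oo.
    move=> A [N _ hN]; exists N => //= n /= Nn; apply: hN => /=.
    by rewrite (leq_trans Nn)// -addnn leq_addr.
  apply: near_rcvg (cvg_comp _ _ dbl (cosI_ratio y)).
  by apply: nearW => n /=; rewrite cosI_even.
have hc : (fun _ : nat => cosI 0 y / cosI 0 0) @ \oo --> cosI 0 y / cosI 0 0 by exact: cvg_cst.
have h2 := rcvgM hc (cvg_Gprod (y := y) (@ltr01 R)).
have := rcvg_unique h2 h1; rewrite rG1 divr1 cosI00 -cosI0 => h.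
have p0 := lt0r_neq0 (pi_gt0 R); move: h; move: p0 (nc _ ^+ 2) (cosI 0 y); move: (pi) => p p0 u v h.
by rewrite -[RHS]mulr1 -[X in _ = _ * X]h; field.
Qed.

Lemma Gamma_half_nc y : nc (Gamma (2^-1 +i* y)) ^+ 2 * ch (pi * y) = pi.
Proof.
have h1 : (fun n => ch (pi * y) * Gprod 2^-1 y n.+1) @ \oo --> (1 : R).
  have dbl : (fun n => n.*2.+1) @ \oo --> \oo.
    move=> A [N _ hN]; exists N => //= n /= Nn; apply: hN => /=.
    by rewrite (leq_trans Nn)// -addnn ltnW// ltnS leq_addr.
  apply: near_rcvg (cvg_comp _ _ dbl (cosI_ratio y)).
  by apply: nearW => n /=; rewrite cosI_odd.
have hc : (fun _ : nat => ch (pi * y)) @ \oo --> ch (pi * y) by exact: cvg_cst.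
have h0 : (0 : R) < 2^-1 by [].
have hs : (fun n => Gprod 2^-1 y n.+1) @ \oo --> (nc (Gamma (2^-1 +i* y)) / rG 2^-1) ^+ 2.
  by rewrite (cvg_shiftS (Gprod 2^-1 y)); exact: cvg_Gprod.
have := rcvg_unique (rcvgM hc hs) h1.
rewrite expr_div_n rG_half => h.
have p0 := lt0r_neq0 (pi_gt0 R); move: h; move: (nc _ ^+ 2) (ch _) p0; move: (pi) => p u v p0 h.
by rewrite -[RHS]mulr1 -[X in _ = _ * X]h; field.
Qed.

End CosineIntegrals.


(** * Exponential decay and shifts of vertical lines *)

Section Decay.
Context {R : realType}.
Implicit Types (x y t p q d k : R) (z w a : R[i]).

Lemma lin_le_expR (A e y : R) : 0 <= A -> 0 < e -> 0 <= y ->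
  A + y <= (A + e^-1) * expR (e * y).
Proof.
move=> A0 e0 y0; rewrite mulrDl lerD//.
  by rewrite ler_peMr// (le_trans _ (expR_ge1Dx _))// lerDl mulr_ge0// ltW.
rewrite -ler_pdivrMl ?invr_gt0// invrK.
by rewrite (le_trans _ (expR_ge1Dx _))// lerDr.
Qed.

Lemma shN t : sh (- t) = - sh t.
Proof. by rewrite /sh opprK -mulNr opprB. Qed.

(** Giving up the fraction [d] of the rate produces the factor [t], which will cancel the factor pi
    y of [Gamma1_nc]. *)
Lemma sh_ge d t : 0 <= t -> d <= 1 -> d / 2 * t * expR ((1 - d) * t) <= sh t.
Proof.
move=> t0 d1; rewrite /sh ler_pdivlMr//.
have e1 : expR t = expR ((1 - d) * t) * expR (d * t) by rewrite -expRD; congr expR; ring.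
have e2 : expR (- t) <= expR ((1 - d) * t).
  by rewrite ler_expR; have : 0 <= (1 - d) * t; [rewrite mulr_ge0 ?subr_ge0|lra].
have e3 := expR_ge1Dx (d * t); have e4 := expR_ge0 ((1 - d) * t).
rewrite e1; move: e2 e3 e4; move: (expR _) (expR _) (expR (d * t)) => u v w h1 h2 h3.
by have := ler_wpM2l h3 h2; lra.
Qed.

Lemma sh_le t : 0 <= t -> sh t <= t * expR t.
Proof.
move=> t0; rewrite /sh ler_pdivrMr//.
have e1 : expR (- t) = expR t * expR (- (2 * t)) by rewrite -expRD; congr expR; ring.
have e3 := expR_ge1Dx (- (2 * t)); have e4 := expR_ge0 t.
rewrite e1; move: e3 e4; move: (expR t) (expR _) => u v h1 h2.
by have := ler_wpM2l h2 h1; lra.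
Qed.

Lemma Gamma1_nc_abs y : nc (Gamma (1 +i* y)) ^+ 2 * sh (pi * `|y|) = pi * `|y|.
Proof.
have [y0|y0] := leP 0 y; first by rewrite ger0_norm// Gamma1_nc.
by rewrite ltr0_norm// !mulrN shN mulrN Gamma1_nc.
Qed.

Lemma Gamma1_nc0 : nc (Gamma (1 +i* (0 : R))) = 1.
Proof.
have -> : (1 +i* (0 : R)) = (1 : R)%:C by [].
by rewrite Gamma_real// rG1 nc_real normr1.
Qed.

Lemma Gamma1_ub d y : 0 < d -> d <= 1 ->
  nc (Gamma (1 +i* y)) <= 2 / d * expR (- ((1 - d) * (pi / 2) * `|y|)).
Proof.
move=> d0 d1.
have d2 : 1 <= 2 / d by rewrite ler_pdivlMr//; lra.
have [->|y0] := eqVneq y 0; first by rewrite Gamma1_nc0 normr0 mulr0 oppr0 expR0 mulr1.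
have t0 : 0 < pi * `|y| by rewrite mulr_gt0 ?pi_gt0// normr_gt0.
have := Gamma1_nc_abs y; have := sh_ge (ltW t0) d1; have := nc_ge0 (Gamma (1 +i* y)).
have -> : - ((1 - d) * (pi / 2) * `|y|) = - ((1 - d) * (pi * `|y|) / 2) by field.
move: (nc _) t0; move: (pi * `|y|) => t n t0 n0 hs e.
have E0 := expR_gt0 ((1 - d) * t).
have h1 : n ^+ 2 * (d / 2 * t * expR ((1 - d) * t)) <= t.
  by rewrite -[leRHS]e ler_wpM2l// exprn_ge0.
have h2 : n ^+ 2 <= 2 / d * expR (- ((1 - d) * t)).
  rewrite expRN -ler_pdivrMr ?invr_gt0// invrK ler_pdivlMr//.
  rewrite -(ler_pM2r t0) (le_trans _ (_ : t * 2 <= _))//; last by rewrite mulrC.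
  have := h1; rewrite (_ : n ^+ 2 * _ = n ^+ 2 * expR ((1 - d) * t) * d * t / 2); last by field.
  by rewrite ler_pdivrMr.
have c0 : 0 <= 2 / d * expR (- ((1 - d) * t / 2)).
  by rewrite mulr_ge0 ?expR_ge0// (le_trans _ d2).
rewrite -ler_sqr ?nnegrE//; apply: le_trans h2 _.
have -> : (2 / d * expR (- ((1 - d) * t / 2))) ^+ 2 = 2 / d * (2 / d * expR (- ((1 - d) * t))).
  have -> : expR (- ((1 - d) * t)) = expR (- ((1 - d) * t / 2)) ^+ 2.
    by rewrite expr2 -expRD; congr expR; field.
  by rewrite exprMn expr2 mulrA.
by rewrite ler_peMl// mulr_ge0 ?expR_ge0// (le_trans _ d2).
Qed.

Lemma Gamma1_lb y : expR (- (pi / 2 * `|y|)) <= nc (Gamma (1 +i* y)).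
Proof.
have [->|y0] := eqVneq y 0; first by rewrite Gamma1_nc0 normr0 mulr0 oppr0 expR0.
have t0 : 0 < pi * `|y| by rewrite mulr_gt0 ?pi_gt0// normr_gt0.
have := Gamma1_nc_abs y; have := sh_le (ltW t0); have := nc_ge0 (Gamma (1 +i* y)).
have -> : - (pi / 2 * `|y|) = - ((pi * `|y|) / 2) by field.
move: (nc _) t0; move: (pi * `|y|) => t n t0 n0 hs e.
have E0 := expR_gt0 t.
have h1 : 1 <= n ^+ 2 * expR t.
  by rewrite -(ler_pM2l t0) mulr1 -[leLHS]e [leRHS]mulrCA ler_wpM2l// exprn_ge0.
rewrite -ler_sqr ?nnegrE ?expR_ge0//.
have -> : expR (- (t / 2)) ^+ 2 = (expR t)^-1 by rewrite expr2 -expRD -expRN; congr expR; field.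
by rewrite -div1r ler_pdivrMr.
Qed.

(** Each step to the next integer multiplies by a linear factor, paid with half of the margin
    between [p] and pi / 2. *)
Lemma Gamma_nat_ub n p : p < pi / 2 ->
  exists2 C, 0 <= C & forall y, nc (Gamma (n.+1%:R +i* y)) <= C * expR (- (p * `|y|)).
Proof.
have p0 := pi_gt0 R; elim: n p => [|n IH] p hp.
  pose d := Num.min 1 (1 - p / (pi / 2)).
  have d0 : 0 < d by rewrite lt_min ltr01 subr_gt0 ltr_pdivrMr ?mul1r// divr_gt0.
  have d1 : d <= 1 by rewrite ge_min lexx.
  exists (2 / d); first by rewrite divr_ge0// ltW.
  move=> y; apply: le_trans (Gamma1_ub y d0 d1) _.
  rewrite ler_wpM2l ?divr_ge0 ?(ltW d0)// ler_expR lerN2 ler_wpM2r//.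
  have : d <= 1 - p / (pi / 2) by rewrite ge_min lexx orbT.
  by rewrite lerBrDr addrC -lerBrDr ler_pdivrMr// divr_gt0.
pose e := (pi / 2 - p) / 2.
have e0 : 0 < e by rewrite divr_gt0// subr_gt0.
have [|C C0 hC] := IH (p + e); first by rewrite /e; lra.
exists ((n.+1%:R + e^-1) * C) => [|y]; first by rewrite mulr_ge0// addr_ge0// invr_ge0 ltW.
have E : n.+2%:R +i* y = (n.+1%:R +i* y) + 1.
  by apply: complex_ext; rewrite ?ReD ?ImD /= ?addr0// natr1.
rewrite E Gamma_succ; last first.
  by apply/eqP => /(congr1 (@complex.Re R)) /= /eqP; rewrite pnatr_eq0.
rewrite ncM.
have -> : (n.+1%:R + e^-1) * C * expR (- (p * `|y|)) =
    ((n.+1%:R + e^-1) * expR (e * `|y|)) * (C * expR (- ((p + e) * `|y|))).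
  have -> : expR (- (p * `|y|)) = expR (e * `|y|) * expR (- ((p + e) * `|y|)).
    by rewrite -expRD; congr expR; ring.
  by ring.
apply: ler_pM; rewrite ?nc_ge0//.
apply: le_trans (nc_le _) _; rewrite /= ger0_norm//.
exact: lin_le_expR.
Qed.

Lemma rG_bounded x1 x2 : 0 < x1 -> exists2 C, 0 <= C & forall x, x1 <= x <= x2 -> rG x <= C.
Proof.
move=> x10; exists (rG x1 + rG x2); first by rewrite addr_ge0 ?rG_ge0.
move=> x /andP[h1 h2]; have x0 := lt_le_trans x10 h1; have x20 := lt_le_trans x0 h2.
have i1 := rk_intg x10; have i2 := rk_intg x20.
rewrite /rG -RintegralD//; apply: le_Rint; [exact: rk_intg|exact: intgD|move=> v].
by apply: rk_between; rewrite h1.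
Qed.

(** [Gamma_mono] compares all abscissas of the strip with one integer above [x2]. *)
Lemma Gamma_ub x1 x2 p : 0 < x1 -> p < pi / 2 -> exists2 C, 0 <= C &
  forall x y, x1 <= x <= x2 -> nc (Gamma (x +i* y)) <= C * expR (- (p * `|y|)).
Proof.
move=> x10 hp; pose n := Num.truncn x2.
have [C C0 hC] := Gamma_nat_ub n hp; have [D D0 hD] := rG_bounded x2 x10.
have n1 : (0 : R) < n.+1%:R by rewrite ltr0n.
have G0 := rG_gt0 n1.
exists (D * (C / rG n.+1%:R)) => [|x y xx]; first by rewrite mulr_ge0// divr_ge0// ltW.
have /andP[h1 h2] := xx; have x0 := lt_le_trans x10 h1.
have h3 : x <= n.+1%:R by rewrite (le_trans h2)// ltW// truncnS_gt.
have := Gamma_mono y x0 h3; rewrite ler_pdivrMr ?rG_gt0// => h.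
apply: le_trans h _; rewrite (_ : D * _ * _ = C * expR (- (p * `|y|)) / rG n.+1%:R * D); last by ring.
by apply: ler_pM => //; [rewrite divr_ge0 ?nc_ge0// ltW|exact: rG_ge0|rewrite ler_pM2r ?invr_gt0|exact: hD].
Qed.

(** [Gamma_mono] goes from the abscissa 1 to x + 1, and the functional equation comes back to x; the
    division by |x + i y| is paid with the margin [q - pi / 2]. *)
Lemma Gamma_lb x1 x2 q : 0 < x1 -> pi / 2 < q -> exists2 C, 0 <= C &
  forall x y, x1 <= x <= x2 -> (nc (Gamma (x +i* y)))^-1 <= C * expR (q * `|y|).
Proof.
move=> x10 hq; pose e := q - pi / 2.
have e0 : 0 < e by rewrite subr_gt0.
have c0 : 0 < expR (- expR 1) :> R by exact: expR_gt0.
pose A := `|x2|.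
exists ((A + e^-1) / expR (- expR 1)) => [|x y xx].
  apply: divr_ge0; last exact: ltW.
  by apply: addr_ge0; [exact: normr_ge0|rewrite invr_ge0 ltW].
have /andP[h1 h2] := xx; have x0 := lt_le_trans x10 h1.
have xz : x +i* y != 0 by apply/eqP => /(congr1 (@complex.Re R)) /= E; rewrite E ltxx in x0.
have E : (x + 1) +i* y = (x +i* y) + 1 by apply: complex_ext; rewrite ?ReD ?ImD /= ?addr0.
have x11 : 1 <= x + 1 by rewrite lerDr ltW.
have := Gamma_mono y ltr01 x11; rewrite rG1 divr1.
rewrite ler_pdivlMr ?rG_gt0//; last by rewrite ltr_wpDl// ltW.
rewrite E Gamma_succ// ncM => h.
have g0 : 0 < nc (Gamma (x +i* y)) by rewrite nc_gt0 Gamma_neq0_gt0.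
have h3 : nc (x +i* y) <= A + `|y|.
  apply: le_trans (nc_le _) _; rewrite /= lerD2r ger0_norm ?(ltW x0)//.
  by rewrite (le_trans h2)// ler_norm.
have h4 := rG_lb (ltr_wpDl (ltW x0) (@ltr01 R)).
have h5 := Gamma1_lb y.
have h6 : expR (- (pi / 2 * `|y|)) * expR (- expR 1) <= (A + `|y|) * nc (Gamma (x +i* y)).
  apply: le_trans (_ : nc (x +i* y) * nc (Gamma (x +i* y)) <= _); last by rewrite ler_wpM2r// ltW.
  by apply: le_trans h; apply: ler_pM => //; exact: expR_ge0.
have h7 := lin_le_expR (normr_ge0 x2) e0 (normr_ge0 y).
have e1 : expR (q * `|y|) = expR (e * `|y|) * expR (pi / 2 * `|y|).
  by rewrite -expRD; congr expR; rewrite /e; ring.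
have e2 : expR (- (pi / 2 * `|y|)) * expR (pi / 2 * `|y|) = 1 by rewrite mulrC expRxMexpNx_1.
have X0 := expR_ge0 (pi / 2 * `|y|).
rewrite -div1r ler_pdivrMr// e1; move: h6 h7 e2 X0 c0.
move: (expR (- expR 1)) (expR (- (pi / 2 * _))) (expR (pi / 2 * _)) (expR (e * _)) (nc _) (A + e^-1) (A + `|y|) g0.
move=> c E1 X Y g B D g0 h6 h7 e2 X0 c0.
rewrite (_ : B / c * (Y * X) * g = B * Y * X * g / c); last by ring.
rewrite ler_pdivlMr// mul1r -[leLHS]mul1r -e2 mulrAC.
rewrite (_ : B * Y * X * g = B * Y * g * X); last by ring.
apply: ler_wpM2r => //; apply: le_trans h6 _; apply: ler_wpM2r => //; exact: ltW.
Qed.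

End Decay.


(** * Regular functions on strips and shifts of vertical lines *)

Section Shift.
Context {R : realType}.
Implicit Types (x y t p q k l M s : R) (z w a c e : R[i]) (K : set R[i]) (F G : R[i] -> R[i]).
Local Notation mu := (@lebesgue_measure R).

Lemma niceD K F G : nice K F -> nice K G -> nice K (fun z => F z + G z).
Proof.
move=> [F' [C1 [C10 a1 b1 q1]]] [G' [C2 [C20 a2 b2 q2]]].
exists (fun z => F' z + G' z), (C1 + C2); split; first exact: addr_ge0.
- by move=> z Kz; rewrite (le_trans (ncD _ _))// lerD ?a1 ?a2.
- by move=> z Kz; rewrite (le_trans (ncD _ _))// lerD ?b1 ?b2.
move=> z w Kz Kw.
have -> : F w + G w - (F z + G z) - (F' z + G' z) * (w - z) =
  (F w - F z - F' z * (w - z)) + (G w - G z - G' z * (w - z)) by ring.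
by rewrite (le_trans (ncD _ _))// mulrDl lerD ?q1 ?q2.
Qed.

Lemma nice_id K (B : R) : (forall z, K z -> nc z <= B) -> nice K id.
Proof.
move=> h; exists (fun=> 1), (`|B| + 1); split; first by rewrite addr_ge0.
- by move=> z Kz; rewrite (le_trans (h z Kz))// (le_trans (ler_norm _))// lerDl.
- by move=> z _; rewrite nc1 lerDr.
by move=> z w _ _; rewrite mul1r subrr nc0 mulr_ge0 ?sqr_ge0// addr_ge0.
Qed.

Lemma nice_ce K c (B : R) : (forall z, K z -> nc z <= B) -> nice K (fun z => ce (c * z)).
Proof.
move=> h; have n0 := nc_ge0 c.
have hz z : K z -> nc (ce (c * z)) <= expR (nc c * B).
  move=> Kz; rewrite nc_ce ler_expR (le_trans (ler_norm _))// (le_trans (nc_Re _))//.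
  by rewrite ncM ler_wpM2l// h.
pose E := expR (nc c * B); have E0 : 0 <= E by exact: expR_ge0.
pose D := 8 * nc c ^+ 2 * (1 + expR (nc c * (2 * B))).
have D0 : 0 <= D.
  by apply: mulr_ge0; [rewrite mulr_ge0// exprn_ge0|rewrite addr_ge0// expR_ge0].
exists (fun z => c * ce (c * z)), (E + nc c * E + E * D); split.
- by rewrite addr_ge0 ?addr_ge0 ?mulr_ge0.
- by move=> z Kz; rewrite (le_trans (hz z Kz))// -addrA lerDl addr_ge0 ?mulr_ge0.
- move=> z Kz; rewrite ncM; apply: (@le_trans _ _ (nc c * E)).
    by rewrite ler_wpM2l// hz.
  by rewrite addrAC lerDr addr_ge0 ?mulr_ge0.
move=> z w Kz Kw.
have -> : ce (c * w) - ce (c * z) - c * ce (c * z) * (w - z) =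
  ce (c * z) * (ce (c * (w - z)) - 1 - c * (w - z)).
  have -> : ce (c * w) = ce (c * z) * ce (c * (w - z)) by rewrite -ceD; congr ce; ring.
  by ring.
rewrite ncM; apply: (@le_trans _ _ (E * (D * nc (w - z) ^+ 2))).
  apply: ler_pM; rewrite ?nc_ge0 ?hz//.
  apply: le_trans (ce_taylor2 _) _; rewrite ncM exprMn /D.
  rewrite (_ : 8 * (nc c ^+ 2 * _) * _ = 8 * nc c ^+ 2 * nc (w - z) ^+ 2 *
    (1 + expR (complex.Re (c * (w - z))))); last by rewrite mulrA.
  rewrite [leRHS]mulrAC; apply: ler_wpM2l.
    by rewrite mulr_ge0 ?exprn_ge0 ?nc_ge0// mulr_ge0// exprn_ge0.
  rewrite lerD2l ler_expR (le_trans (ler_norm _))// (le_trans (nc_Re _))// ncM ler_wpM2l//.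
  by rewrite (le_trans (ncB _ _))// mulr2n mulrDl mul1r lerD// h.
rewrite mulrA; apply: ler_wpM2r; first by rewrite exprn_ge0// nc_ge0.
by rewrite lerDr addr_ge0 ?mulr_ge0.
Qed.

(** A negative rate allows growth; rates then simply add up in products, those with inverses of
    [Gamma] included. *)
Definition dec K k F :=
  exists2 C, 0 <= C & forall z, K z -> nc (F z) <= C * expR (- (k * `|complex.Im z|)).

Lemma dec_le K k l F : l <= k -> dec K k F -> dec K l F.
Proof.
move=> lk [C C0 h]; exists C => // z Kz; rewrite (le_trans (h z Kz))// ler_wpM2l//.
by rewrite ler_expR lerN2 ler_wpM2r.
Qed.

Lemma decM K k l F G : dec K k F -> dec K l G -> dec K (k + l) (fun z => F z * G z).
Proof.
move=> [C C0 hC] [D D0 hD]; exists (C * D) => [|z Kz]; first exact: mulr_ge0.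
rewrite ncM mulrDl opprD expRD mulrACA.
by apply: ler_pM; rewrite ?nc_ge0 ?hC ?hD.
Qed.

Lemma decD K k F G : dec K k F -> dec K k G -> dec K k (fun z => F z + G z).
Proof.
move=> [C C0 hC] [D D0 hD]; exists (C + D) => [|z Kz]; first exact: addr_ge0.
by rewrite (le_trans (ncD _ _))// mulrDl lerD ?hC ?hD.
Qed.

Lemma dec_cst K c : dec K 0 (fun=> c).
Proof. by exists (nc c) => [|z _]; rewrite ?nc_ge0// mul0r oppr0 expR0 mulr1. Qed.

Lemma sqr1_norm_Im a e z : e ^+ 2 = 1 ->
  `|complex.Im z| - `|complex.Im a| <= `|complex.Im (a + e * z)| <= `|complex.Im z| + `|complex.Im a|.
Proof.
move=> /eqP; rewrite sqrf_eq1 => /orP[]/eqP->; rewrite ?mul1r ?mulN1r ?ImD ?ImN.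
  move: (complex.Im a) (complex.Im z) => u v.
  have h1 := ler_normD u v; have := ler_normB (u + v) u; rewrite addrAC subrr add0r => h2.
  by apply/andP; split; lra.
move: (complex.Im a) (complex.Im z) => u v.
have h1 := ler_normB u v; have := ler_normB u (u - v); rewrite subKr => h2.
by apply/andP; split; lra.
Qed.

Lemma dec_affine K K' k F a e : e ^+ 2 = 1 -> (forall z, K' z -> K (a + e * z)) ->
  dec K k F -> dec K' k (fun z => F (a + e * z)).
Proof.
move=> e1 s [C C0 h]; exists (C * expR (`|k| * `|complex.Im a|)) => [|z Kz].
  by rewrite mulr_ge0 ?expR_ge0.
rewrite (le_trans (h _ (s _ Kz)))// -mulrA ler_wpM2l// -expRD ler_expR.
have /andP[h1 h2] := sqr1_norm_Im a z e1.
have [k0|k0] := leP 0 k.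
  by rewrite (ger0_norm k0); have := ler_wpM2l k0 h1; lra.
rewrite (ltr0_norm k0); have k0' : 0 <= - k by rewrite oppr_ge0 ltW.
by have := ler_wpM2l k0' h2; lra.
Qed.

Lemma dec_id x1 x2 l : 0 < l -> dec (strip x1 x2) (- l) id.
Proof.
move=> l0; exists (`|x1| + `|x2| + l^-1) => [|z /andP[h1 h2]].
  by rewrite !addr_ge0// invr_ge0 ltW.
rewrite mulNr opprK; apply: le_trans (nc_le z) _.
apply: le_trans (lin_le_expR _ l0 (normr_ge0 _)); last by rewrite addr_ge0.
rewrite lerD2r ler_norml; apply/andP; split.
  rewrite lerNl (le_trans (_ : _ <= - x1))// ?lerN2// (le_trans (ler_norm _))// normrN lerDl//.
by rewrite (le_trans h2)// (le_trans (ler_norm _))// lerDr.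
Qed.

(* On vertical lines |Gamma| decays like exp (- pi / 2 |y|), up to a polynomial
   factor: any two rates around pi / 2 will do, provided that they are close enough
   for the products of the two lemmas to be integrable. *)
Definition gp : R := pi * (2 / 5).
Definition gq : R := pi * (3 / 5).

Lemma gp_lt : gp < pi / 2.
Proof. by rewrite /gp ltr_pM2l ?pi_gt0//; lra. Qed.

Lemma gq_gt : pi / 2 < gq.
Proof. by rewrite /gq ltr_pM2l ?pi_gt0//; lra. Qed.

Lemma complexE' z : z = complex.Re z +i* complex.Im z.
Proof. by case: z. Qed.

Lemma dec_Gamma x1 x2 : 0 < x1 -> dec (strip x1 x2) gp Gamma.
Proof.
move=> x0; have [C C0 h] := Gamma_ub x2 x0 gp_lt; exists C => // z Kz.
by rewrite {1}(complexE' z); exact: h.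
Qed.

Lemma dec_GammaV x1 x2 : 0 < x1 -> dec (strip x1 x2) (- gq) (fun z => (Gamma z)^-1).
Proof.
move=> x0; have [C C0 h] := Gamma_lb x2 x0 gq_gt; exists C => // z Kz.
by rewrite ncV mulNr opprK {1}(complexE' z); exact: h.
Qed.

Definition box x1 x2 M : set R[i] := strip x1 x2 `&` [set z | `|complex.Im z| <= M].

Lemma box_bound x1 x2 M z : box x1 x2 M z -> nc z <= `|x1| + `|x2| + M.
Proof.
move=> [/andP[h1 h2] h3]; apply: le_trans (nc_le z) _; apply: lerD => //.
rewrite ler_norml; apply/andP; split.
  by rewrite lerNl (le_trans (_ : _ <= - x1))// ?lerN2// (le_trans (ler_norm _))// normrN lerDl.
by rewrite (le_trans h2)// (le_trans (ler_norm _))// lerDr.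
Qed.

(* Regularity that allows to shift vertical lines when 0 < k. *)
Definition sreg x1 x2 k F := (forall M, nice (box x1 x2 M) F) /\ dec (strip x1 x2) k F.

Lemma sregM x1 x2 k l F G : sreg x1 x2 k F -> sreg x1 x2 l G ->
  sreg x1 x2 (k + l) (fun z => F z * G z).
Proof. by move=> [n1 d1] [n2 d2]; split; [move=> M; exact: niceM|exact: decM]. Qed.

Lemma sregD x1 x2 k F G : sreg x1 x2 k F -> sreg x1 x2 k G ->
  sreg x1 x2 k (fun z => F z + G z).
Proof. by move=> [n1 d1] [n2 d2]; split; [move=> M; exact: niceD|exact: decD]. Qed.

Lemma sreg_cst x1 x2 c : sreg x1 x2 0 (fun=> c).
Proof. by split; [move=> M; exact: nice_cst|exact: dec_cst]. Qed.

Lemma sregZ x1 x2 k c F : sreg x1 x2 k F -> sreg x1 x2 k (fun z => c * F z).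
Proof. by move=> h; have := sregM (sreg_cst x1 x2 c) h; rewrite add0r. Qed.

Lemma sreg_eq x1 x2 k F G : F =1 G -> sreg x1 x2 k F -> sreg x1 x2 k G.
Proof. by move=> /funext ->. Qed.

Lemma sreg_le x1 x2 k l F : l <= k -> sreg x1 x2 k F -> sreg x1 x2 l F.
Proof. by move=> lk [n d]; split=> //; exact: dec_le d. Qed.

Lemma sreg_affine x1 x2 y1 y2 k F a e : e ^+ 2 = 1 ->
  (forall z, strip x1 x2 z -> strip y1 y2 (a + e * z)) ->
  sreg y1 y2 k F -> sreg x1 x2 k (fun z => F (a + e * z)).
Proof.
move=> e1 s [n d]; split => [M|]; last exact: dec_affine d.
apply: (@nice_affine _ (box y1 y2 (M + `|complex.Im a|))) => // z [Kz Mz].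
split; first exact: s.
have /andP[_ h2] := sqr1_norm_Im a z e1; rewrite /= (le_trans h2)//.
by rewrite lerD2r.
Qed.

Lemma sreg_Gamma0 x1 x2 : 0 < x1 -> sreg x1 x2 gp Gamma.
Proof.
move=> x0; split; last exact: dec_Gamma.
by move=> M; apply: nice_sub (Gamma_nice x2 x0) => z [].
Qed.

Lemma sreg_GammaV0 x1 x2 : 0 < x1 -> sreg x1 x2 (- gq) (fun z => (Gamma z)^-1).
Proof.
move=> x0; split; last exact: dec_GammaV.
move=> M; have [C C0 h] := dec_GammaV x2 x0.
(* A lower bound of |Gamma| on the box, read from the upper bound of its inverse; [C + 1] is
   positive even if [C] is 0. *)
have c0 : 0 < ((C + 1) * expR (gq * M))^-1.
  by rewrite invr_gt0 mulr_gt0 ?expR_gt0// ltr_wpDl.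
apply: (niceV c0); last by apply: nice_sub (Gamma_nice x2 x0) => z [].
move=> z [Kz Mz]; have := h z Kz; rewrite ncV mulNr opprK => hz.
have z0 : 0 < complex.Re z by case/andP: Kz => h1 _; exact: lt_le_trans h1.
have g0 : 0 < nc (Gamma z) by rewrite nc_gt0 Gamma_neq0_gt0.
rewrite -[leRHS]invrK lef_pV2 ?posrE ?invr_gt0//; last first.
  by rewrite mulr_gt0 ?expR_gt0// ltr_wpDl.
apply: le_trans hz _; apply: ler_pM; rewrite ?expR_ge0 ?lerDl//.
by rewrite ler_expR ler_wpM2l// ltW// (lt_trans _ gq_gt)// divr_gt0// pi_gt0.
Qed.

Lemma sreg_Gamma x1 x2 a : 0 < complex.Re a + x1 -> sreg x1 x2 gp (fun z => Gamma (a + z)).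
Proof.
move=> h; have n1 : (1 : R[i]) ^+ 2 = 1 by rewrite expr1n.
apply: sreg_eq (sreg_affine (a := a) n1 _ (sreg_Gamma0 (complex.Re a + x2) h)) => z /=.
  by rewrite mul1r.
by rewrite /strip /= mul1r ReD !lerD2l.
Qed.

Lemma sreg_GammaN x1 x2 a : 0 < complex.Re a - x2 -> sreg x1 x2 gp (fun z => Gamma (a - z)).
Proof.
move=> h; have n1 : (-1 : R[i]) ^+ 2 = 1 by rewrite sqrrN expr1n.
apply: sreg_eq (sreg_affine (a := a) n1 _ (sreg_Gamma0 (complex.Re a - x1) h)) => z /=.
  by rewrite mulN1r.
by rewrite /strip /= mulN1r ReB !lerD2l !lerN2 andbC.
Qed.

Lemma sreg_GammaV x1 x2 a : 0 < complex.Re a + x1 ->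
  sreg x1 x2 (- gq) (fun z => (Gamma (a + z))^-1).
Proof.
move=> h; have n1 : (1 : R[i]) ^+ 2 = 1 by rewrite expr1n.
apply: sreg_eq (sreg_affine (a := a) n1 _ (sreg_GammaV0 (complex.Re a + x2) h)) => z /=.
  by rewrite mul1r.
by rewrite /strip /= mul1r ReD !lerD2l.
Qed.

Lemma sreg_GammaVN x1 x2 a : 0 < complex.Re a - x2 ->
  sreg x1 x2 (- gq) (fun z => (Gamma (a - z))^-1).
Proof.
move=> h; have n1 : (-1 : R[i]) ^+ 2 = 1 by rewrite sqrrN expr1n.
apply: sreg_eq (sreg_affine (a := a) n1 _ (sreg_GammaV0 (complex.Re a - x1) h)) => z /=.
  by rewrite mulN1r.
by rewrite /strip /= mulN1r ReB !lerD2l !lerN2 andbC.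
Qed.

Lemma sreg_id x1 x2 l : 0 < l -> sreg x1 x2 (- l) id.
Proof.
by move=> l0; split; [move=> M; apply: nice_id => z; exact: box_bound|exact: dec_id].
Qed.

(* 2 i sin (2 pi z) *)
Definition Sn z : R[i] := ce ((0 +i* (2 * pi)) * z) - ce ((0 +i* (- (2 * pi))) * z).

Lemma sreg_Sn x1 x2 : sreg x1 x2 (- (2 * pi)) Sn.
Proof.
have p0 := pi_gt0 R.
have h (c : R) : `|c| <= 2 * pi -> sreg x1 x2 (- (2 * pi)) (fun z => ce ((0 +i* c) * z)).
  move=> hc; split; first by move=> M; apply: nice_ce => z; exact: box_bound.
  exists 1 => // z _; rewrite mul1r nc_ce ler_expR mulNr opprK ReM /= mul0r sub0r.
  by rewrite (le_trans (ler_norm _))// normrN normrM ler_wpM2r.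
have h1 : sreg x1 x2 (- (2 * pi)) (fun z => ce ((0 +i* (2 * pi)) * z)).
  by apply: h; rewrite ger0_norm// mulr_ge0// ltW.
have h2 : sreg x1 x2 (- (2 * pi)) (fun z => ce ((0 +i* (- (2 * pi))) * z)).
  by apply: h; rewrite normrN ger0_norm// mulr_ge0// ltW.
apply: sreg_eq (sregD h1 (sregZ (-1) h2)) => z.
by rewrite mulN1r.
Qed.

Lemma Sn_i y : Sn (0 +i* y) = (- 2 * sh (2 * pi * y))%:C.
Proof.
have E (c : R) : ce ((0 +i* c) * (0 +i* y)) = (expR (- (c * y)))%:C.
  rewrite -ce_real; congr ce; apply: complex_ext; rewrite ?ReM ?ImM /=; ring.
rewrite /Sn !E -rmorphB /= /sh (_ : - (- (2 * pi) * y) = 2 * pi * y); last by ring.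
by congr (_%:C); field.
Qed.

(** By this periodicity, a shift by 1 of the de Branges-Wilson integrand acts on its other factors
    only. *)
Lemma Sn1 z : Sn (z + 1) = Sn z.
Proof.
have E (c : R) : cos c = 1 -> sin c = 0 -> ce (0 +i* c) = 1.
  by move=> hc hs; apply: complex_ext; rewrite ?ce_Re ?ce_Im /= expR0 mul1r ?hc ?hs.
rewrite /Sn !mulrDr !mulr1 !ceD.
by rewrite !E ?mulr1 ?cosN ?sinN ?(mulrC 2) ?mulr_natr ?cos2pi ?sin2pi ?oppr0.
Qed.

Definition ostrip x1 x2 : set R[i] := [set z | x1 < complex.Re z < x2].

Lemma sreg_star x1 x2 k F t : sreg x1 x2 k F -> x1 < t < x2 ->
  star_nice (ostrip x1 x2) F t%:C.
Proof.
move=> [nF _].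
move=> /andP[t1 t2] z0 /andP[h1 h2].
pose r := Num.min (complex.Re z0 - x1) (x2 - complex.Re z0).
exists r, (box x1 x2 (`|complex.Im z0| + r)); split => //.
  by rewrite lt_min !subr_gt0 h1.
move=> z v hz /andP[v0 v1].
have hr := lt_le_trans (le_lt_trans (nc_Re _) hz) (lexx r).
have hi := lt_le_trans (le_lt_trans (nc_Im _) hz) (lexx r).
have r1 : r <= complex.Re z0 - x1 by rewrite ge_min lexx.
have r2 : r <= x2 - complex.Re z0 by rewrite ge_min lexx orbT.
move: hr hi; rewrite ReB ImB ltr_norml => /andP[e1 e2] hi.
split; rewrite /strip /= ?ReD ?ReM ?ImD ?ImM ?ReB ?ImB /= ?mul0r ?subr0 ?addr0 ?add0r.
  have a1 : 0 <= v * (complex.Re z - x1) by rewrite mulr_ge0//; lra.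
  have a2 : 0 <= v * (x2 - complex.Re z) by rewrite mulr_ge0//; lra.
  have a3 : 0 <= (1 - v) * (t - x1) by rewrite mulr_ge0//; lra.
  have a4 : 0 <= (1 - v) * (x2 - t) by rewrite mulr_ge0//; lra.
  by apply/andP; split; lra.
rewrite normrM (ger0_norm v0) (le_trans (ler_piMl (normr_ge0 _) v1))//.
by have := ler_normD (complex.Im z - complex.Im z0) (complex.Im z0); rewrite subrK; lra.
Qed.

Lemma sreg_cont x1 x2 k F t : sreg x1 x2 k F -> x1 < t < x2 ->
  ccont (fun y => F (t +i* y)).
Proof.
move=> hF ht; apply: (star_nice_cont (sreg_star hF ht)) => [y //|].
by split=> y; [exact: cvg_cst|exact: cvg_id].
Qed.

(** The line of abscissa [s] is itself a contour, and [contour_limit] expresses the integral along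
    it on any reference line of the strip; two reference lines therefore give the same value. *)
Lemma sreg_line x1 x2 k F s : sreg x1 x2 k F -> 0 < k -> x1 < s < x2 ->
  cig (fun y => F (s +i* y)) /\
  forall t, x1 < t < x2 -> CI (fun y => F (s +i* y)) = CI (fun y => F (t +i* y)).
Proof.
move=> hF k0 hs; have [_ [C C0 hC]] := hF.
pose U := ostrip x1 x2.
have hstar t (ht : x1 < t < x2) := sreg_star hF ht.
have U1 t y : x1 < t < x2 -> U (t +i* y) by [].
have conv t z v : x1 < t < x2 -> U z -> 0 <= v <= 1 ->
    U ((t + v * (complex.Re z - t)) +i* complex.Im z).
  move=> /andP[t1 t2] /andP[z1 z2] /andP[v0 v1]; rewrite /U /ostrip /=.
  have [->|vn0] := eqVneq v 0; first by rewrite mul0r addr0 t1.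
  have vp : 0 < v by rewrite lt_neqAle eq_sym vn0.
  have a1 : 0 < v * (complex.Re z - x1) by rewrite mulr_gt0// subr_gt0.
  have a2 : 0 < v * (x2 - complex.Re z) by rewrite mulr_gt0// subr_gt0.
  have a3 : 0 <= (1 - v) * (t - x1) by rewrite mulr_ge0//; lra.
  have a4 : 0 <= (1 - v) * (x2 - t) by rewrite mulr_ge0//; lra.
  by apply/andP; split; lra.
pose B := `|x1| + `|x2|.
have hB t : x1 < t < x2 -> `|t| <= B.
  move=> /andP[t1 t2]; rewrite ler_norml.
  have := ler_norm (- x1); rewrite normrN => n1; have n2 := ler_norm x2.
  by have n3 := normr_ge0 x1; have n4 := normr_ge0 x2; rewrite /B; apply/andP; split; lra.
have hdec z : U z -> `|complex.Re z| <= B -> 1 <= `|complex.Im z| ->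
    nc (F z) <= C * expR (- (k * `|complex.Im z|)).
  by move=> /andP[z1 z2] _ _; apply: hC; rewrite /strip /= !ltW.
have hg : imaginary_contour (fun y : R => s +i* y).
  split.
  - split => /=; first by move=> t; exact: cvg_cst.
    have d t : is_derive t 1 (fun _ : R => s) 0 by exact: is_derive_cst.
    have E : derive1 (fun _ : R => s) = (fun=> 0).
      by apply/funext => t; rewrite derive1E; exact: derive_val.
    exists [::]; split => t // _; split; first exact: ex_derive.
    by rewrite E; exact: cvg_cst.
  - split => /=; first by move=> t; exact: cvg_id.
    have d (t : R) : is_derive t 1 (fun y : R => y) 1 by exact: is_derive_id.
    have E : derive1 (fun y : R => y) = (fun=> 1).
      by apply/funext => t; rewrite derive1E; exact: derive_val.
    exists [::]; split => t // _; split; first exact: ex_derive.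
    by rewrite E; exact: cvg_cst.
  - by exists `|s|.
  - exact: cvg_id.
  - exact: cvg_id.
have main t : x1 < t < x2 -> cig (fun y => F (t +i* y)) /\
    contour_integral (fun y : R => s +i* y) F = 'i%C * CI (fun y => F (t +i* y)).
  move=> ht; have [] := @contour_limit _ _ _ _ _ _ _ (fun y : R => s +i* y) (hstar t ht) (fun y => U1 t y ht)
    (fun z v => @conv t z v ht) k0 (hB t ht) hdec (fun y => hB s hs) (fun y => U1 s y hs) hg.
  by [].
split=> [|t ht]; first by case: (main s hs).
have [_ h1] := main s hs; have [_ h2] := main t ht.
have i0 : ('i%C : R[i]) != 0.
  by apply/eqP => /(congr1 (@complex.Im R)) /= /eqP; rewrite oner_eq0.
by apply: (mulfI i0); rewrite -h1 -h2.
Qed.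

End Shift.


(** * Bounds and limits for ratios of Gamma values *)

Section GammaAsymptotics.
Context {R : realType}.
Implicit Types (x y t w v : R) (z : R[i]).

Lemma rcvg_bounded (u : nat -> R) (l : R) : u @ \oo --> l ->
  exists2 K, 0 <= K & forall n, `|u n| <= K.
Proof.
move=> ul; have /cvg_seq_bounded/pinfty_ex_gt0[K K0 /= hK] : cvgn u by apply/cvg_ex; exists l.
by exists K => [|n]; [exact: ltW|exact: hK].
Qed.

Lemma Gprod_le1 x y n : 0 < x -> Gprod x y n <= 1.
Proof.
move=> x0; rewrite /Gprod; apply: prodr_ile1 => k _.
have a1 : 0 < (x + k%:R) ^+ 2 by rewrite exprn_gt0// ltr_wpDr.
have y2 := sqr_ge0 y.
by rewrite divr_ge0 ?addr_ge0 ?(ltW a1)//= ler_pdivrMr ?mul1r ?ltr_pwDl// lerDl.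
Qed.

Definition gam x y : R := nc (Gamma (x +i* y)) / rG x.

Lemma gam_ge0 x y : 0 <= gam x y.
Proof. by rewrite divr_ge0 ?nc_ge0 ?rG_ge0. Qed.

Lemma gam_gt0 x y : 0 < x -> 0 < gam x y.
Proof. by move=> x0; rewrite divr_gt0 ?rG_gt0// nc_gt0 Gamma_neq0_gt0. Qed.

Lemma gam_mono x1 x2 y : 0 < x1 -> x1 <= x2 -> gam x1 y <= gam x2 y.
Proof. exact: Gamma_mono. Qed.

Lemma gam_le1 x y : 0 < x -> gam x y <= 1.
Proof.
move=> x0; rewrite -(@ler_sqr _ _ 1) ?nnegrE ?gam_ge0// expr1n.
rewrite /gam -(cvg_lim _ (cvg_Gprod (y := y) x0))//.
apply: limr_le; first by apply: cvgP; exact: cvg_Gprod.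
by apply: nearW => n; exact: Gprod_le1.
Qed.

(** Factor by factor, with A = (x + k)^2, it rests on (w - v)^2 <= 2 w^2 + 2 v^2; the square on the
    left absorbs these factors 2, as (A + w^2)^2 >= A^2 + 2 A w^2. *)
Lemma Gprod_shift x w v n : 0 < x ->
  (Gprod x w n * Gprod x v n) ^+ 2 <= Gprod x (w - v) n.
Proof.
move=> x0; rewrite /Gprod -big_split -prodrXl; apply: ler_prod => k _ /=.
have A0 : 0 < (x + k%:R) ^+ 2 by rewrite exprn_gt0// ltr_wpDr.
rewrite sqr_ge0/=; have := sqr_ge0 (w + v); have := sqr_ge0 w; have := sqr_ge0 v.
have := sqr_ge0 (w - v).
have -> : (w + v) ^+ 2 = 2 * (w ^+ 2 + v ^+ 2) - (w - v) ^+ 2 by ring.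
move: A0; move: (_ ^+ 2) (w ^+ 2) (v ^+ 2) ((w - v) ^+ 2) => A W V D A0 D0 V0 W0 h.
have d1 : 0 < A + W by lra.
have d2 : 0 < A + V by lra.
have d3 : 0 < A + D by lra.
rewrite (_ : _ ^+ 2 = A ^+ 4 / ((A + W) ^+ 2 * (A + V) ^+ 2)); last first.
  by field; rewrite !gt_eqF.
rewrite ler_pdivrMr; last by rewrite mulr_gt0// exprn_gt0.
rewrite mulrAC ler_pdivlMr//.
have p1 : A ^+ 3 * (A + D) <= A ^+ 3 * (A + 2 * W + 2 * V).
  by rewrite ler_wpM2l ?exprn_ge0 ?(ltW A0)//; lra.
have -> : A ^+ 4 * (A + D) = A * (A ^+ 3 * (A + D)) by ring.
rewrite ler_pM2l//; apply: le_trans p1 _.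
have h1 : A ^+ 2 + 2 * A * W <= (A + W) ^+ 2 by have := sqr_ge0 W; lra.
have h2 : A ^+ 2 + 2 * A * V <= (A + V) ^+ 2 by have := sqr_ge0 V; lra.
apply: (@le_trans _ _ ((A ^+ 2 + 2 * A * W) * (A ^+ 2 + 2 * A * V))).
  have : 0 <= 4 * A ^+ 2 * (W * V) by rewrite !mulr_ge0// ltW.
  by lra.
apply: ler_pM => //; rewrite addr_ge0 ?sqr_ge0// !mulr_ge0// ltW//.
Qed.

Lemma gam_shift x w v : 0 < x -> (gam x w * gam x v) ^+ 2 <= gam x (w - v).
Proof.
move=> x0; rewrite -ler_sqr ?nnegrE ?gam_ge0 ?sqr_ge0//.
have hw := cvg_Gprod (y := w) x0; have hv := cvg_Gprod (y := v) x0.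
have hd := cvg_Gprod (y := w - v) x0.
have h := rcvgM (rcvgM hw hv) (rcvgM hw hv).
have -> : ((gam x w * gam x v) ^+ 2) ^+ 2 =
  (nc (Gamma (x +i* w)) / rG x) ^+ 2 * (nc (Gamma (x +i* v)) / rG x) ^+ 2 *
  ((nc (Gamma (x +i* w)) / rG x) ^+ 2 * (nc (Gamma (x +i* v)) / rG x) ^+ 2).
  by rewrite -/(gam x w) -/(gam x v); ring.
rewrite -(cvg_lim _ h)// /gam -(cvg_lim _ hd)//.
apply: ler_lim; [by apply: cvgP; exact: h|by apply: cvgP; exact: hd|].
by apply: nearW => n; rewrite -expr2; exact: Gprod_shift.
Qed.

Lemma asym3_algebra (g1 g2 g3 h1 h2 h3 p1 p2 p3 q1 q2 q3 G : R[i]) :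
  p1 * p2 * p3 = q1 * q2 * q3 -> G != 0 -> p1 != 0 -> p2 != 0 -> p3 != 0 ->
  g1 / (p1 * G) * (g2 / (p2 * G)) * (g3 / (p3 * G)) *
  (h1 / (q1 * G) * (h2 / (q2 * G)) * (h3 / (q3 * G)))^-1 = g1 * g2 * g3 / (h1 * h2 * h3).
Proof.
move=> e G0 a1 a2 a3.
have b : q1 * q2 * q3 != 0 by rewrite -e !mulf_neq0.
have -> : h1 / (q1 * G) * (h2 / (q2 * G)) * (h3 / (q3 * G)) =
    (h1 * h2 * h3) / (q1 * q2 * q3 * G ^+ 3).
  by rewrite !invfM; ring.
rewrite invf_div -e; move: (h1 * h2 * h3)^-1 => h; field.
by rewrite G0 a1 a2 a3.
Qed.

(** Equality of the two sums makes the powers of n cancel, and the cubes of Gamma n cancel because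
    there are three factors above and below. *)
Lemma asym3 (u1 u2 u3 v1 v2 v3 : R[i]) :
  0 <= complex.Re u1 -> 0 <= complex.Re u2 -> 0 <= complex.Re u3 ->
  0 <= complex.Re v1 -> 0 <= complex.Re v2 -> 0 <= complex.Re v3 ->
  u1 + u2 + u3 = v1 + v2 + v3 ->
  ccvg (fun n => Gamma (n%:R + u1) * Gamma (n%:R + u2) * Gamma (n%:R + u3) /
    (Gamma (n%:R + v1) * Gamma (n%:R + v2) * Gamma (n%:R + v3))) 1.
Proof.
move=> a1 a2 a3 b1 b2 b3 e.
have n10 : (1 * 1 * 1 : R[i]) != 0 by rewrite !mulr1 oner_neq0.
have H := ccvgM (ccvgM (ccvgM (asym a1) (asym a2)) (asym a3))
  (ccvgV n10 (ccvgM (ccvgM (asym b1) (asym b2)) (asym b3))).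
have E : 1 * 1 * 1 * (1 * 1 * 1)^-1 = 1 :> R[i] by rewrite !mulr1 mul1r invr1.
rewrite E in H; apply: (near_ccvg _ H); near=> n.
have n0 : (0 < n)%N by near: n; exact: nbhs_infty_gt.
apply: asym3_algebra; rewrite ?npow_neq0 ?Gamma_nat_neq0//.
by rewrite -!npowD e.
Unshelve. all: end_near. Qed.

Lemma asym_rG z : 0 <= complex.Re z ->
  (fun n => nc (Gamma (n%:R + z)) / rG (n%:R + complex.Re z)) @ \oo --> (1 : R).
Proof. by move=> z0; apply: asym_ratio. Qed.

End GammaAsymptotics.


(** * Barnes' second lemma *)

Section BarnesSecond.
Context {R : realType}.
Implicit Types (x y t w v s d : R) (z a b : R[i]).
Local Notation mu := (@lebesgue_measure R).
Local Notation pos z := (0 < complex.Re z).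

Lemma exists_lt_all (r : seq R) : all (fun x => 0 < x) r ->
  exists2 d, 0 < d & all (fun x => d < x) r.
Proof.
elim: r => [_|x r IH /= /andP[x0 /IH[d d0 hd]]]; first by exists 1.
exists (Num.min d (x / 2)); first by rewrite lt_min d0 divr_gt0.
rewrite (@le_lt_trans _ _ (x / 2)) ?ge_min ?lexx ?orbT//=; last by lra.
by apply/allP => y yr; rewrite (le_lt_trans _ (allP hd y yr))// ge_min lexx.
Qed.

(** Used with [I] the integrals and [T] their closed forms when one parameter runs through its
    integer translates. *)
Lemma ratio_const (I T A B : nat -> R[i]) :
  (forall n, A n * I n.+1 = B n * I n) -> (forall n, A n * T n.+1 = B n * T n) ->
  (forall n, A n != 0) -> (forall n, T n != 0) -> forall n, I n / T n = I 0%N / T 0%N.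
Proof.
move=> hI hT A0 T0; elim => // n <-.
apply/eqP; rewrite eqr_div//; apply/eqP; apply: (mulfI (A0 n)).
by rewrite mulrA hI [RHS]mulrCA hT; ring.
Qed.

(** At the abscissa [X2], [gam_shift] carries the height w to v = w - (w - v), and monotonicity
    brings the price of this move down to the abscissa [X]. The latter stays fixed while [X1] and
    [X2] go to infinity. *)
Lemma gam_ratio X X1 X2 w v : 0 < X -> X <= X1 -> X1 <= X2 ->
  gam X1 w <= gam X2 v / (gam X w * gam X (w - v) ^+ 2).
Proof.
move=> X0 h1 h2; have X10 := lt_le_trans X0 h1; have X20 := lt_le_trans X10 h2.
have p0 := gam_gt0 w X0; have q0 := gam_gt0 (w - v) X0.
have h3 := gam_mono w X0 (le_trans h1 h2); have h4 := gam_mono (w - v) X0 (le_trans h1 h2).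
have h5 := gam_shift w (w - v) X20; rewrite subKr in h5.
have h6 := gam_mono w X10 h2; have U0 := gam_ge0 X1 w; have P0 := gam_ge0 X2 w; have Q0 := gam_ge0 X2 (w - v).
move: h3 h4 h5 h6 p0 q0 U0 P0 Q0.
move: (gam X w) (gam X (w - v)) (gam X1 w) (gam X2 w) (gam X2 (w - v)) (gam X2 v).
move=> p q u P Q r h3 h4 h5 h6 p0 q0 U0 P0 Q0.
rewrite ler_pdivlMr ?mulr_gt0 ?exprn_gt0//.
apply: le_trans h5; rewrite exprMn expr2 -mulrA; apply: ler_pM => //.
- by rewrite mulr_ge0 ?sqr_ge0// ltW.
- apply: ler_pM => //; [exact: ltW|exact: sqr_ge0|].
  by rewrite ler_sqr ?nnegrE// ltW.
Qed.

(* MF is the integrand of Barnes' second lemma (on the imaginary axis, z = i y),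
   and MT its value, without the factor 2 pi. *)
Definition MF a1 a2 a3 b1 b2 z := Gamma (a1 + z) * Gamma (a2 + z) * Gamma (a3 + z) *
  Gamma (b1 - z) * Gamma (b2 - z) / Gamma (a1 + a2 + a3 + b1 + b2 + z).

Definition MT a1 a2 a3 b1 b2 :=
  Gamma (a1 + b1) * Gamma (a1 + b2) * Gamma (a2 + b1) * Gamma (a2 + b2) *
  Gamma (a3 + b1) * Gamma (a3 + b2) /
  (Gamma (a2 + a3 + b1 + b2) * Gamma (a1 + a3 + b1 + b2) * Gamma (a1 + a2 + b1 + b2)).

Definition MI a1 a2 a3 b1 b2 := CI (fun y => MF a1 a2 a3 b1 b2 (0 +i* y)).

Lemma posD a b : pos a -> pos b -> pos (a + b).
Proof. by rewrite ReD; exact: addr_gt0. Qed.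

Lemma pos_neq0 a : pos a -> a != 0.
Proof. by move=> a0; apply/eqP => E; rewrite E ltxx in a0. Qed.

Lemma posD_i a y : pos a -> pos (a + (0 +i* y)).
Proof. by rewrite ReD /= addr0. Qed.

Lemma posB_i a y : pos a -> pos (a - (0 +i* y)).
Proof. by rewrite ReB /= subr0. Qed.

Lemma pos_natD a n : pos a -> pos (a + n%:R).
Proof. by rewrite ReD Re_nat => a0; rewrite ltr_pwDl. Qed.

(** [t1], [t2], [t3] stand for the a_i + z, [u1], [u2] for the b_i - z, and [s] for a1 + a2 + a3 +
    b1 + b2 + z: the polynomial identity assumed is the whole content of the recurrence. As in the
    other lemmas of this kind, variables replace the values of [Gamma] so that [ring] and [field]
    meet only atoms. *)
Lemma MI_algebra (g1 g2 g3 g4 g5 g6 A B t1 t2 t3 u1 u2 s : R[i]) :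
  s != 0 -> A * t3 - B * s = t1 * t2 * t3 - u1 * u2 * s ->
  A * (g1 * g2 * (t3 * g3) * g4 * g5 * (s^-1 * g6)) - B * (g1 * g2 * g3 * g4 * g5 * g6) =
  t1 * g1 * (t2 * g2) * (t3 * g3) * g4 * g5 * (s^-1 * g6) -
  g1 * g2 * g3 * (u1 * g4) * (u2 * g5) * g6.
Proof.
move=> s0 e; transitivity (g1 * g2 * g3 * g4 * g5 * g6 * s^-1 * (A * t3 - B * s)).
  by field.
by rewrite e; field.
Qed.

Section Params.
Variables (a1 a2 a3 b1 b2 : R[i]).
Hypotheses (p1 : pos a1) (p2 : pos a2) (p3 : pos a3) (q1 : pos b1) (q2 : pos b2).

Lemma MF_sreg : exists2 d, 0 < d & sreg (- d) d pi (MF a1 a2 a3 b1 b2).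
Proof.
have [|d d0 /= /and5P[h1 h2 h3 h4 /andP[h5 _]]] := @exists_lt_all
  [:: complex.Re a1; complex.Re a2; complex.Re a3; complex.Re b1; complex.Re b2].
  by rewrite /= p1 p2 p3 q1 q2.
have sg x : d < x -> 0 < x - d by rewrite subr_gt0.
move: h1 h2 h3 h4 h5 => /sg h1 /sg h2 /sg h3 /sg h4 /sg h5; exists d => //.
have hS : 0 < complex.Re (a1 + a2 + a3 + b1 + b2) + - d by rewrite !ReD; lra.
have := sregM (sregM (sregM (sregM (sregM (sreg_Gamma d h1) (sreg_Gamma d h2)) (sreg_Gamma d h3))
  (sreg_GammaN (- d) h4)) (sreg_GammaN (- d) h5)) (sreg_GammaV d hS).
(* Five [Gamma] factors and one inverse leave the rate 5 [gp] - [gq], that is 7 pi / 5. *)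
apply: sreg_le; rewrite /gp /gq; have := pi_gt0 R; lra.
Qed.

(* MG (z + 1) - MG z has integral zero, by a shift of the line, and it is the
   combination of MF at a3 + 1 and at a3 that gives the recurrence. *)
Definition MG z := Gamma (a1 + z) * Gamma (a2 + z) * Gamma (a3 + z) *
  Gamma (b1 + 1 - z) * Gamma (b2 + 1 - z) / Gamma (a1 + a2 + a3 + b1 + b2 + z).

Lemma MG_sreg : exists2 d, 0 < d & sreg (- d) (1 + d) pi MG.
Proof.
have [|d d0 /= /and5P[h1 h2 h3 h4 /andP[h5 _]]] := @exists_lt_all
  [:: complex.Re a1; complex.Re a2; complex.Re a3; complex.Re b1; complex.Re b2].
  by rewrite /= p1 p2 p3 q1 q2.
have sg x : d < x -> 0 < x - d by rewrite subr_gt0.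
move: h1 h2 h3 h4 h5 => /sg h1 /sg h2 /sg h3 /sg h4 /sg h5; exists d => //.
have hS : 0 < complex.Re (a1 + a2 + a3 + b1 + b2) + - d by rewrite !ReD; lra.
have h4' : 0 < complex.Re (b1 + 1) - (1 + d) by rewrite ReD /=; lra.
have h5' : 0 < complex.Re (b2 + 1) - (1 + d) by rewrite ReD /=; lra.
have := sregM (sregM (sregM (sregM (sregM (sreg_Gamma (1 + d) h1) (sreg_Gamma (1 + d) h2))
  (sreg_Gamma (1 + d) h3))
  (sreg_GammaN (- d) h4')) (sreg_GammaN (- d) h5')) (sreg_GammaV (1 + d) hS).
apply: sreg_le; rewrite /gp /gq; have := pi_gt0 R; lra.
Qed.

Lemma MF_cig : cig (fun y => MF a1 a2 a3 b1 b2 (0 +i* y)).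
Proof.
have [d d0 h] := MF_sreg; have [|] := @sreg_line _ _ _ _ _ 0 h (pi_gt0 R); last by [].
by rewrite oppr_lt0 d0.
Qed.

Lemma MF_ccont : ccont (fun y => MF a1 a2 a3 b1 b2 (0 +i* y)).
Proof.
have [d d0 h] := MF_sreg; apply: (sreg_cont h); by rewrite oppr_lt0 d0.
Qed.

Let S := a1 + a2 + a3 + b1 + b2.

Lemma MI_cig1 : cig (fun y => MF a1 a2 (a3 + 1) b1 b2 (0 +i* y)) ->
  (a2 + a3 + b1 + b2) * (a1 + a3 + b1 + b2) * MI a1 a2 (a3 + 1) b1 b2 =
  (a3 + b1) * (a3 + b2) * MI a1 a2 a3 b1 b2.
Proof.
move=> c1; have c0 := MF_cig.
have [d d0 hG] := MG_sreg.
have m0 : - d < 0 < 1 + d by rewrite oppr_lt0 d0 addr_gt0.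
have m1 : - d < 1 < 1 + d by rewrite ltrDl d0 andbT; lra.
have [g0 /(_ _ m1) e] := sreg_line hG (pi_gt0 R) m0.
have [g1 _] := sreg_line hG (pi_gt0 R) m1.
have E1 := CIZ ((a2 + a3 + b1 + b2) * (a1 + a3 + b1 + b2)) c1.
have E2 := CIZ ((a3 + b1) * (a3 + b2)) c0.
have E3 := CIB (cigZ ((a2 + a3 + b1 + b2) * (a1 + a3 + b1 + b2)) c1)
  (cigZ ((a3 + b1) * (a3 + b2)) c0).
have E4 := CIB g1 g0; rewrite e subrr in E4.
rewrite E1 E2 in E3; apply/eqP; rewrite -subr_eq0; apply/eqP.
rewrite -[LHS]E3 -[RHS]E4; apply: eq_CI => y.
have -> : 1 +i* y = (0 +i* y) + 1 :> R[i] by apply: complex_ext; rewrite ?ReD ?ImD /= ?addr0 ?add0r.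
have n1 := pos_neq0 (posD_i y p1); have n2 := pos_neq0 (posD_i y p2).
have n3 := pos_neq0 (posD_i y p3).
have n4 := pos_neq0 (posB_i y q1); have n5 := pos_neq0 (posB_i y q2).
have nS := pos_neq0 (posD_i y (posD (posD (posD (posD p1 p2) p3) q1) q2)).
move: (0 +i* y) n1 n2 n3 n4 n5 nS => z n1 n2 n3 n4 n5 nS; rewrite /MF /MG.
have -> : a3 + 1 + z = a3 + z + 1 by ring.
have -> : a1 + a2 + (a3 + 1) + b1 + b2 + z = S + z + 1 by rewrite /S; ring.
have -> : b1 + 1 - (z + 1) = b1 - z by ring.
have -> : b2 + 1 - (z + 1) = b2 - z by ring.
have -> : b1 + 1 - z = b1 - z + 1 by ring.
have -> : b2 + 1 - z = b2 - z + 1 by ring.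
have -> : a1 + (z + 1) = a1 + z + 1 by ring.
have -> : a2 + (z + 1) = a2 + z + 1 by ring.
have -> : a3 + (z + 1) = a3 + z + 1 by ring.
have -> : a1 + a2 + a3 + b1 + b2 + (z + 1) = S + z + 1 by rewrite /S; ring.
rewrite (Gamma_succ n1) (Gamma_succ n2) (Gamma_succ n3) (Gamma_succ n4) (Gamma_succ n5).
rewrite (Gamma_succ nS) -/S.
move: (Gamma (a1 + z)) (Gamma (a2 + z)) (Gamma (a3 + z)) (Gamma (b1 - z)) (Gamma (b2 - z)).
move=> g2 g3 g4 g5 g6; rewrite invfM; move: (Gamma (S + z))^-1 => gS.
by apply: MI_algebra nS _; rewrite /S; ring.
Qed.

End Params.

End BarnesSecond.


(** * Barnes' second lemma: letting a3 tend to infinity *)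

Section BarnesLimit.
Context {R : realType}.
Implicit Types (x y t w v s d : R) (z a b : R[i]).
Local Notation pos z := (0 < complex.Re z).

(* The limit of MF / MT at a3 + n, when n tends to oo; it does not involve a3. *)
Definition JN a1 a2 b1 b2 z := Gamma (a1 + z) * Gamma (a2 + z) * Gamma (b1 - z) *
  Gamma (b2 - z) * Gamma (a1 + a2 + b1 + b2) /
  (Gamma (a1 + b1) * Gamma (a1 + b2) * Gamma (a2 + b1) * Gamma (a2 + b2)).

Definition JQ a1 a2 b1 b2 := CI (fun y => JN a1 a2 b1 b2 (0 +i* y)).

Lemma MT_rec_algebra (P g1 g2 t1 t2 s1 s2 h1 h2 h3 : R[i]) : s1 != 0 -> s2 != 0 ->
  s1 * s2 * (P * (t1 * g1) * (t2 * g2) / ((s1 * h1) * (s2 * h2) * h3)) =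
  t1 * t2 * (P * g1 * g2 / (h1 * h2 * h3)).
Proof.
move=> s10 s20; rewrite !invfM; move: (h1^-1) (h2^-1) (h3^-1) => i1 i2 i3; field.
by rewrite s10 s20.
Qed.

Lemma ratio_algebra (c1 c2 c3 c4 k1 k2 h1 h2 h3 x1 x2 x3 y1 y2 w : R[i]) :
  (c1 * c2 * c3 * c4 * k1 * k2 / (h1 * h2 * h3))^-1 * (x1 * x2 * x3 * y1 * y2 / w) =
  x3 * h1 * h2 / (w * k1 * k2) * (x1 * x2 * y1 * y2 * h3 / (c1 * c2 * c3 * c4)).
Proof. by rewrite invf_div !invfM; ring. Qed.

Lemma nc_ratio3 (x h1 h2 w k1 k2 : R[i]) :
  nc (x * h1 * h2 / (w * k1 * k2)) = nc x * nc h1 * nc h2 / (nc w * nc k1 * nc k2).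
Proof. by rewrite !(ncM, ncV). Qed.

Lemma ratio_scale (n3 nS m2 m3 d1 d2 r3 rS : R) : n3 != 0 -> nS != 0 ->
  n3 * m2 * m3 / (nS * d1 * d2) * (nS / rS) * (n3 / r3)^-1 = r3 / rS * (m2 * m3 / (d1 * d2)).
Proof.
move=> n0 s0; rewrite !invfM invrK; move: (rS^-1) (d1^-1) (d2^-1) => *; field.
by rewrite n0 s0.
Qed.

Lemma ratio_bound (c g G H r rX rS m2 m3 d1 d2 K : R) :
  0 < g -> 0 < G -> 0 < H -> 0 < r -> 0 < rX -> 0 < rS ->
  0 <= m2 -> 0 <= m3 -> 0 <= d1 -> 0 <= d2 ->
  c / rX <= H / rS / (G / r * g ^+ 2) -> `|rX / rS * (m2 * m3 / (d1 * d2))| <= K ->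
  c * m2 * m3 / (H * d1 * d2) <= K * (r / g ^+ 2) * G^-1.
Proof.
move=> g0 G0 H0 r0 rX0 rS0 m20 m30 d10 d20 h1 h2.
set q := m2 * m3 / (d1 * d2) in h2.
have q0 : 0 <= q by rewrite divr_ge0 ?mulr_ge0.
have -> : c * m2 * m3 / (H * d1 * d2) = c / H * q by rewrite /q !invfM; ring.
have h3 : c / H <= rX / rS * (r / g ^+ 2 * G^-1).
  rewrite ler_pdivrMr// -(@ler_pM2r _ rX^-1) ?invr_gt0//; apply: le_trans h1 _.
  rewrite le_eqVlt; apply/orP; left; apply/eqP; field.
  by rewrite !gt_eqF.
have h4 : rX / rS * q <= K by apply: le_trans h2; exact: ler_norm.
apply: le_trans (ler_wpM2r q0 h3) _; rewrite -(mulrA K).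
rewrite (_ : _ * q = rX / rS * q * (r / g ^+ 2 * G^-1)); last by ring.
apply: ler_wpM2r => //.
by apply: mulr_ge0; [apply: divr_ge0; [exact: ltW|exact: sqr_ge0]|rewrite invr_ge0 ltW].
Qed.

Lemma natD_i n a y :
  n%:R + (a + (0 +i* y)) = (n%:R + complex.Re a) +i* (complex.Im a + y).
Proof. by apply: complex_ext; rewrite ?ReD ?ImD ?Re_nat ?Im_nat /= ?add0r ?addr0. Qed.

Section Params0.
Variables (a1 a2 a3 b1 b2 : R[i]).
Hypotheses (p1 : pos a1) (p2 : pos a2) (p3 : pos a3) (q1 : pos b1) (q2 : pos b2).
Let S := a1 + a2 + a3 + b1 + b2.

Lemma MT_rec : (a2 + a3 + b1 + b2) * (a1 + a3 + b1 + b2) * MT a1 a2 (a3 + 1) b1 b2 =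
  (a3 + b1) * (a3 + b2) * MT a1 a2 a3 b1 b2.
Proof.
have n1 := pos_neq0 (posD p3 q1); have n2 := pos_neq0 (posD p3 q2).
have s1 := pos_neq0 (posD (posD (posD p2 p3) q1) q2).
have s2 := pos_neq0 (posD (posD (posD p1 p3) q1) q2).
rewrite /MT.
have -> : a3 + 1 + b1 = a3 + b1 + 1 by ring.
have -> : a3 + 1 + b2 = a3 + b2 + 1 by ring.
have -> : a2 + (a3 + 1) + b1 + b2 = a2 + a3 + b1 + b2 + 1 by ring.
have -> : a1 + (a3 + 1) + b1 + b2 = a1 + a3 + b1 + b2 + 1 by ring.
rewrite (Gamma_succ n1) (Gamma_succ n2) (Gamma_succ s1) (Gamma_succ s2).
exact: MT_rec_algebra.
Qed.

Lemma MT_neq0 : MT a1 a2 a3 b1 b2 != 0.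
Proof.
have g a : pos a -> Gamma a != 0 by exact: Gamma_neq0_gt0.
rewrite /MT; apply: mulf_neq0.
  have n1 := g _ (posD p1 q1); have n2 := g _ (posD p1 q2).
  have n3 := g _ (posD p2 q1); have n4 := g _ (posD p2 q2).
  have n5 := g _ (posD p3 q1); have n6 := g _ (posD p3 q2).
  exact: (mulf_neq0 (mulf_neq0 (mulf_neq0 (mulf_neq0 (mulf_neq0 n1 n2) n3) n4) n5) n6).
rewrite invr_eq0.
have n1 := g _ (posD (posD (posD p2 p3) q1) q2).
have n2 := g _ (posD (posD (posD p1 p3) q1) q2).
have n3 := g _ (posD (posD (posD p1 p2) q1) q2).
exact: (mulf_neq0 (mulf_neq0 n1 n2) n3).
Qed.

End Params0.

Section Params.
Variables (a1 a2 a3 b1 b2 : R[i]).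
Hypotheses (p1 : pos a1) (p2 : pos a2) (p3 : pos a3) (q1 : pos b1) (q2 : pos b2).
Let S := a1 + a2 + a3 + b1 + b2.

(** The three arguments above and the three below have the same sum, as [asym3] requires. *)
Definition Mratio n z := Gamma (n%:R + (a3 + z)) * Gamma (n%:R + (a2 + a3 + b1 + b2)) *
  Gamma (n%:R + (a1 + a3 + b1 + b2)) /
  (Gamma (n%:R + (S + z)) * Gamma (n%:R + (a3 + b1)) * Gamma (n%:R + (a3 + b2))).

Lemma MF_div_MT n z : (MT a1 a2 (a3 + n%:R) b1 b2)^-1 * MF a1 a2 (a3 + n%:R) b1 b2 z =
  Mratio n z * JN a1 a2 b1 b2 z.
Proof.
rewrite /MT /MF /Mratio /JN.
have -> : a3 + n%:R + b1 = n%:R + (a3 + b1) by ring.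
have -> : a3 + n%:R + b2 = n%:R + (a3 + b2) by ring.
have -> : a3 + n%:R + z = n%:R + (a3 + z) by ring.
have -> : a2 + (a3 + n%:R) + b1 + b2 = n%:R + (a2 + a3 + b1 + b2) by ring.
have -> : a1 + (a3 + n%:R) + b1 + b2 = n%:R + (a1 + a3 + b1 + b2) by ring.
have -> : a1 + a2 + (a3 + n%:R) + b1 + b2 + z = n%:R + (S + z) by rewrite /S; ring.
exact: ratio_algebra.
Qed.

Lemma Mratio_cvg y : ccvg (fun n => Mratio n (0 +i* y)) 1.
Proof.
apply: asym3; try (apply: ltW).
- exact: posD_i.
- exact: (posD (posD (posD p2 p3) q1) q2).
- exact: (posD (posD (posD p1 p3) q1) q2).
- by apply: posD_i; exact: (posD (posD (posD (posD p1 p2) p3) q1) q2).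
- exact: posD.
- exact: posD.
by rewrite /S; ring.
Qed.

(* The bound has to be uniform in n, although a3 and S need not have the same
   imaginary part: this is what [gam_ratio] is for. *)
Lemma Mratio_bounded : exists2 K, 0 <= K &
  forall n y, nc (Mratio n (0 +i* y)) <= K * nc ((Gamma (a3 + (0 +i* y)))^-1).
Proof.
have pS : pos S by exact: (posD (posD (posD (posD p1 p2) p3) q1) q2).
pose X := complex.Re a3; pose XS := complex.Re S.
pose e := complex.Im a3 - complex.Im S.
have XXS : X <= XS by rewrite /X /XS /S !ReD; move: p1 p2 q1 q2; lra.
pose u2 := a2 + a3 + b1 + b2; pose u3 := a1 + a3 + b1 + b2.
have pu2 : pos u2 by exact: (posD (posD (posD p2 p3) q1) q2).
have pu3 : pos u3 by exact: (posD (posD (posD p1 p3) q1) q2).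
(* The part of the estimate that does not involve [y]; it converges, hence is bounded. *)
pose k n := rG (n%:R + X) / rG (n%:R + XS) *
  (nc (Gamma (n%:R + u2)) * nc (Gamma (n%:R + u3)) /
   (nc (Gamma (n%:R + (a3 + b1))) * nc (Gamma (n%:R + (a3 + b2))))).
have [K K0 hK] : exists2 K, 0 <= K & forall n, `|k n| <= K.
  have E : a3 + u2 + u3 = S + (a3 + b1) + (a3 + b2) by rewrite /u2 /u3 /S; ring.
  have h := ccvg_nc (asym3 (ltW p3) (ltW pu2) (ltW pu3) (ltW pS) (ltW (posD p3 q1)) (ltW (posD p3 q2)) E).
  have n1 : nc (1 : R[i]) != 0 by rewrite nc1 oner_neq0.
  have h2 := rcvgM (rcvgM h (asym_rG (ltW pS))) (rcvgV (oner_neq0 R) (asym_rG (ltW p3))).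
  apply: (@rcvg_bounded R k); apply: near_rcvg h2; apply: nearW => n.
  have g a : pos a -> nc (Gamma (n%:R + a)) != 0.
    by move=> pa; rewrite addrC gt_eqF// nc_gt0 Gamma_neq0_gt0// pos_natD.
  by rewrite nc_ratio3 ratio_scale//; exact: g.
have r0 := rG_gt0 p3; have g0 := gam_gt0 e p3.
exists (K * (rG X / gam X e ^+ 2)) => [|n y].
  by apply: mulr_ge0 => //; apply: divr_ge0; [exact: ltW|exact: sqr_ge0].
rewrite /Mratio nc_ratio3.
pose w := complex.Im a3 + y; pose v := complex.Im S + y.
have -> : a3 + (0 +i* y) = X +i* w by apply: complex_ext; rewrite ?ReD ?ImD /= ?addr0.
have -> : n%:R + (X +i* w) = (n%:R + X) +i* w.
  by apply: complex_ext; rewrite ?ReD ?ImD ?Re_nat ?Im_nat /= ?add0r.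
have -> : n%:R + (S + (0 +i* y)) = (n%:R + XS) +i* v by exact: natD_i.
have n0 : 0 <= n%:R :> R by [].
(* The difference of heights [w - v] is the constant [e], so the price paid depends neither on [n]
   nor on [y]. *)
have := @gam_ratio R X (n%:R + X) (n%:R + XS) w v p3; rewrite lerDr lerD2l.
move=> /(_ n0 XXS); have -> : w - v = e by rewrite /w /v /e; ring.
have Gx : 0 < nc (Gamma (X +i* w)) by rewrite nc_gt0 Gamma_neq0_gt0.
have nX : 0 < n%:R + X by rewrite ltr_wpDl.
have nS : 0 < n%:R + XS by rewrite ltr_wpDl.
have Gs : 0 < nc (Gamma ((n%:R + XS) +i* v)) by rewrite nc_gt0 Gamma_neq0_gt0.
have rX := rG_gt0 nX; have rS := rG_gt0 nS.
have := hK n; rewrite /k [gam X w]/gam [gam (n%:R + X) w]/gam [gam (n%:R + XS) v]/gam.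
rewrite ncV => h1 h2.
by apply: ratio_bound h2 h1; rewrite ?nc_ge0.
Qed.

Lemma JN_sreg : exists2 d, 0 < d & sreg (- d) d (gp *+ 4) (JN a1 a2 b1 b2) /\
  sreg (- d) d pi (fun z => (Gamma (a3 + z))^-1 * JN a1 a2 b1 b2 z).
Proof.
have [|d d0 /= /and5P[h1 h2 h3 h4 /andP[h5 _]]] := @exists_lt_all R
  [:: complex.Re a1; complex.Re a2; complex.Re a3; complex.Re b1; complex.Re b2].
  by rewrite /= p1 p2 p3 q1 q2.
have sg x : d < x -> 0 < x - d by rewrite subr_gt0.
move: h1 h2 h3 h4 h5 => /sg h1 /sg h2 /sg h3 /sg h4 /sg h5; exists d => //.
have hJ : sreg (- d) d (gp *+ 4) (JN a1 a2 b1 b2).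
  have := sregM (sregM (sregM (sregM (sreg_Gamma d h1) (sreg_Gamma d h2))
    (sreg_GammaN (- d) h4)) (sreg_GammaN (- d) h5))
    (sreg_cst (- d) d (Gamma (a1 + a2 + b1 + b2) /
      (Gamma (a1 + b1) * Gamma (a1 + b2) * Gamma (a2 + b1) * Gamma (a2 + b2)))).
  rewrite addr0 (_ : gp + gp + gp + gp = gp *+ 4); last by rewrite !mulrS mulr0n addr0 !addrA.
  by apply: sreg_eq => z; rewrite mulrA.
(* The dominating function contains the inverse of Gamma (a3 + z): the rate left is 4 [gp] - [gq],
   exactly pi. *)
split=> //; apply: sreg_le (sregM (sreg_GammaV d h3) hJ).
rewrite -mulr_natl /gp /gq; have := pi_gt0 R; lra.
Qed.

Lemma JN_ccont : ccont (fun y => JN a1 a2 b1 b2 (0 +i* y)).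
Proof.
by have [d d0 [h _]] := JN_sreg; apply: (sreg_cont h); rewrite oppr_lt0 d0.
Qed.

Lemma JN_cig : cig (fun y => JN a1 a2 b1 b2 (0 +i* y)).
Proof.
have [d d0 [h _]] := JN_sreg; have [||] := @sreg_line _ _ _ _ _ 0 h; last by [].
- by rewrite -mulr_natl !mulr_gt0// pi_gt0.
- by rewrite oppr_lt0 d0.
Qed.

Lemma MI_limit_cvg :
  ccvg (fun n => MI a1 a2 (a3 + n%:R) b1 b2 / MT a1 a2 (a3 + n%:R) b1 b2) (JQ a1 a2 b1 b2).
Proof.
have [K K0 hK] := Mratio_bounded.
have [d d0 [hJ [_ [C C0 hC]]]] := JN_sreg.
pose f_ n y := (MT a1 a2 (a3 + n%:R) b1 b2)^-1 * MF a1 a2 (a3 + n%:R) b1 b2 (0 +i* y).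
have fE n : CI (f_ n) = MI a1 a2 (a3 + n%:R) b1 b2 / MT a1 a2 (a3 + n%:R) b1 b2.
  have E := CIZ (MT a1 a2 (a3 + n%:R) b1 b2)^-1 (MF_cig p1 p2 (pos_natD n p3) q1 q2).
  exact: etrans E (mulrC _ _).
apply: (eq_ccvg fE).
have [|||||//] := @CI_dct R f_ (fun y => JN a1 a2 b1 b2 (0 +i* y))
  (fun y => K * C * expR (- (pi * `|y|))).
- move=> n; apply: ccont_meas; apply: ccontZ; apply: MF_ccont => //; exact: pos_natD.
- exact: ccont_meas JN_ccont.
- by apply: intgZ; exact: cvg_expR_norm_intg (pi_gt0 R).
- move=> y; rewrite -[X in ccvg _ X]mul1r.
  apply: eq_ccvg (ccvgM (Mratio_cvg y) (ccvg_cst _)) => n.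
  by rewrite /f_ MF_div_MT.
move=> n y; rewrite /f_ MF_div_MT ncM.
apply: le_trans (ler_wpM2r (nc_ge0 _) (hK n y)) _.
rewrite -!mulrA; apply: ler_wpM2l => //; rewrite -ncM.
by apply: (hC (0 +i* y)); rewrite /strip /= oppr_le0 ltW.
Qed.

Lemma MI_limit : MI a1 a2 a3 b1 b2 / MT a1 a2 a3 b1 b2 = JQ a1 a2 b1 b2.
Proof.
have nat_succ n : a3 + n.+1%:R = a3 + n%:R + 1 by rewrite -addrA natr1.
have E n : MI a1 a2 (a3 + n%:R) b1 b2 / MT a1 a2 (a3 + n%:R) b1 b2 =
    MI a1 a2 (a3 + 0%:R) b1 b2 / MT a1 a2 (a3 + 0%:R) b1 b2.
  apply: (@ratio_const _ (fun n => MI a1 a2 (a3 + n%:R) b1 b2)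
    (fun n => MT a1 a2 (a3 + n%:R) b1 b2)
    (fun n => (a2 + (a3 + n%:R) + b1 + b2) * (a1 + (a3 + n%:R) + b1 + b2))
    (fun n => (a3 + n%:R + b1) * (a3 + n%:R + b2))) => {}n.
  - rewrite nat_succ; apply: MI_cig1 => //; first exact: pos_natD.
    by rewrite -nat_succ; apply: MF_cig => //; exact: pos_natD.
  - by rewrite nat_succ; apply: MT_rec => //; exact: pos_natD.
  - have s1 := posD (posD (posD p2 (pos_natD n p3)) q1) q2.
    have s2 := posD (posD (posD p1 (pos_natD n p3)) q1) q2.
    exact: mulf_neq0 (pos_neq0 s1) (pos_neq0 s2).
  - by apply: MT_neq0 => //; exact: pos_natD.
have h := MI_limit_cvg.
have := ccvg_unique (eq_ccvg E h) (ccvg_cst _).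
by rewrite addr0 => ->.
Qed.

End Params.
End BarnesLimit.


(** * Barnes' second lemma: the value of the constant *)

Section BarnesConstant.
Context {R : realType}.
Implicit Types (x y t w v s d : R) (z a b : R[i]).
Local Notation mu := (@lebesgue_measure R).
Local Notation pos z := (0 < complex.Re z).

Lemma ch_gt0 t : 0 < ch t :> R.
Proof. exact: lt_le_trans ltr01 (ch_ge1 t). Qed.

Lemma ch_sqr t : ch t ^+ 2 - sh t ^+ 2 = 1.
Proof.
have e := expRxMexpNx_1 t; rewrite /ch /sh; move: e; move: (expR t) (expR (- t)) => u v e.
by transitivity (u * v) => //; field.
Qed.

Lemma chN t : ch (- t) = ch t :> R.
Proof. by rewrite /ch opprK addrC. Qed.

Lemma th_cvg : (fun n : nat => sh (pi * n%:R) / ch (pi * n%:R)) @ \oo --> (1 : R).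
Proof.
apply: rcvg_squeeze (cvg_expR_natN (pi_gt0 R)) => n.
set u := pi * n%:R; have c1 := ch_ge1 u; have c0 := ch_gt0 u.
have -> : sh u / ch u - 1 = - (expR (- u) / ch u).
  have -> : expR (- u) = ch u - sh u by rewrite /ch /sh; field.
  by field; rewrite gt_eqF.
rewrite normrN ger0_norm ?divr_ge0 ?expR_ge0 ?(ltW c0)//.
by rewrite ler_pdivrMr// ler_peMr// expR_ge0.
Qed.

Lemma n_ch_cvg : (fun n : nat => n%:R / ch (pi * n%:R) ^+ 2) @ \oo --> (0 : R).
Proof.
have p1 : 0 < pi - 1 :> R by have := @pihalf_ge1 R; lra.
have h2 : (fun _ : nat => 2 : R) @ \oo --> (2 : R) by exact: cvg_cst.
have := rcvgM h2 (cvg_expR_natN p1); rewrite mulr0; apply: rcvg_squeeze => n.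
set u := pi * n%:R; have c1 := ch_ge1 u; have c0 := ch_gt0 u.
rewrite subr0 ger0_norm ?divr_ge0 ?sqr_ge0//.
have h3 : expR u <= 2 * ch u by rewrite /ch mulrC divfK// lerDl expR_ge0.
have h4 : n%:R <= expR (n%:R : R) by rewrite (le_trans _ (expR_ge1Dx _))// lerDr.
have h5 : expR (n%:R : R) = expR (- ((pi - 1) * n%:R)) * expR u by rewrite -expRD /u; congr expR; ring.
have E0 := expR_ge0 (- ((pi - 1) * n%:R) : R).
rewrite h5 in h4; clear h5; move: h3 h4 c0 c1 E0.
move: (expR (- ((pi - 1) * n%:R))) (expR u) (ch u) => E X c h3 h4 c0 c1 E0.
rewrite ler_pdivrMr ?exprn_gt0//; apply: le_trans h4 _.
rewrite (_ : 2 * E * c ^+ 2 = E * (2 * c * c)); last by ring.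
apply: ler_wpM2l => //; apply: le_trans h3 _; rewrite ler_peMr// mulr_ge0// ltW//.
Qed.

Lemma is_derive_inv (f : R -> R) (t df : R) : f t != 0 -> is_derive t 1 f df ->
  is_derive t 1 (fun t => (f t)^-1) (- (f t) ^- 2 * df).
Proof.
move=> f0 fd; have dv := @ex_derive _ _ _ _ _ _ _ fd.
by apply: DeriveDef; [exact: derivableV|rewrite deriveV// derive_val].
Qed.

Lemma is_derive_th t : is_derive t 1 (fun t : R => pi * (sh (pi * t) / ch (pi * t)))
  ((pi / ch (pi * t)) ^+ 2).
Proof.
have c0 : ch (pi * t) != 0 by rewrite gt_eqF ?ch_gt0.
have d1 := is_derive_ch pi t; have d2 := is_derive_sh pi t.
have d3 := @is_derive_inv (fun t => ch (pi * t)) t _ c0 d1.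
apply: is_derive_eq; rewrite /GRing.scale /=.
have := ch_sqr (pi * t); move: c0; clear d1 d2 d3; move: (ch (pi * t)) (sh (pi * t)) => c s c0 e; move: (pi) => p.
rewrite (_ : (p / c) ^+ 2 = p ^+ 2 * (c ^+ 2 - s ^+ 2) / c ^+ 2); last by rewrite e; field.
by field.
Qed.

Lemma CI_real (f : R -> R) : CI (fun y => (f y)%:C) = (\int[mu]_x f x)%:C.
Proof.
apply: complex_ext => //=; rewrite /CI /cintegral /=.
by rewrite Rintegral_cst// mul0r.
Qed.

Definition half : R[i] := (2^-1)%:C.

Lemma pos_half : pos half.
Proof. by rewrite /half /= invr_gt0. Qed.

Lemma Gamma_half_mul y : Gamma (half + (0 +i* y)) * Gamma (half - (0 +i* y)) = (pi / ch (pi * y))%:C.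
Proof.
have -> : half - (0 +i* y) = conjc (half + (0 +i* y)).
  by apply: complex_ext; rewrite ?ReB ?ImB /= ?subr0 ?addr0 ?add0r ?sub0r.
rewrite Gamma_conj ?posD_i ?pos_half// ncMconj.
have -> : half + (0 +i* y) = 2^-1 +i* y by apply: complex_ext; rewrite ?ReD ?ImD /= ?addr0 ?add0r.
congr (_%:C); have := Gamma_half_nc y; have := ch_gt0 (pi * y).
by move: (nc _) (ch _) => c h c0 <-; field; rewrite gt_eqF.
Qed.

Lemma Gamma_1 : Gamma (1 : R[i]) = 1.
Proof. by rewrite (_ : 1 = (1 : R)%:C)// Gamma_real// rG1. Qed.

Lemma Gamma_2 : Gamma (1 + 1 : R[i]) = 1.
Proof. by rewrite Gamma_succ ?oner_neq0// Gamma_1 mulr1. Qed.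

Lemma halfD : half + half = 1.
Proof. by rewrite /half -rmorphD (_ : 2^-1 + 2^-1 = 1 :> R)//; field. Qed.

(** The constant factors are values of [Gamma] at 1 and 2, and the integrand is the square of pi /
    ch (pi y), with antiderivative pi times the hyperbolic tangent of pi y. *)
Lemma JQ_half : JQ half half half half = (2 * pi)%:C.
Proof.
have E y : JN half half half half (0 +i* y) = ((pi / ch (pi * y)) ^+ 2)%:C.
  rewrite /JN -(addrA (half + half)) !halfD Gamma_2 Gamma_1 !mulr1 invr1 mulr1.
  have -> : ((pi / ch (pi * y)) ^+ 2)%:C = (pi / ch (pi * y))%:C ^+ 2 by rewrite -rmorphXn.
  rewrite -Gamma_half_mul; move: (Gamma _) (Gamma _) => u v; ring.
have ci := JN_cig pos_half pos_half pos_half pos_half pos_half.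
rewrite /JQ (eq_CI E) CI_real; congr (_%:C).
have h2 : (fun _ : nat => pi : R) @ \oo --> (pi : R) by exact: cvg_cst.
have l1 := rcvgM h2 th_cvg; rewrite mulr1 in l1.
rewrite (FTC_R _ _ is_derive_th (lp := pi) (lm := - pi)) //.
- by rewrite opprK mulrDl mul1r.
- move=> t; apply: (@cvgM _ _ _ _ (fun t : R => pi / ch (pi * t)) (fun t : R => pi / ch (pi * t)));
  by apply: cvgM; [exact: cvg_cst|apply: cvgV; [rewrite gt_eqF ?ch_gt0|exact: ch_cont]].
- by have [i1 _] := eq_cig E ci.
- have l2 : (fun n : nat => - (pi * (sh (pi * n%:R) / ch (pi * n%:R)))) @ \oo --> (- pi : R).
    exact: cvgN l1.
  apply: (near_rcvg _ l2); apply: nearW => n.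
  by rewrite (mulrN pi n%:R) shN chN mulNr mulrN.
Qed.

Lemma MF_algebra (x1 x2 x3 y1 y2 w : R[i]) :
  x1 * x2 * x3 * y1 * y2 / w = x3 * x2 * x1 * y1 * y2 / w.
Proof. by congr (_ / _); ring. Qed.

Lemma MT_algebra (c1 c2 c3 c4 c5 c6 h1 h2 h3 : R[i]) :
  c1 * c2 * c3 * c4 * c5 * c6 / (h1 * h2 * h3) = c5 * c6 * c3 * c4 * c1 * c2 / (h3 * h2 * h1).
Proof. by congr (_ / _); ring. Qed.

Lemma JN_algebra (c1 c2 c3 c4 x1 x2 y1 y2 h : R[i]) :
  x1 * x2 * y1 * y2 * h / (c1 * c2 * c3 * c4) = x2 * x1 * y1 * y2 * h / (c3 * c4 * c1 * c2).
Proof. by congr (_ / _); ring. Qed.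

Lemma JN_algebra' (c1 c2 c3 c4 x1 x2 y1 y2 h : R[i]) :
  x1 * x2 * y1 * y2 * h / (c1 * c2 * c3 * c4) = y1 * y2 * x1 * x2 * h / (c1 * c3 * c2 * c4).
Proof. by congr (_ / _); ring. Qed.

Section Params.
Variables (a1 a2 a3 b1 b2 : R[i]).
Hypotheses (p1 : pos a1) (p2 : pos a2) (p3 : pos a3) (q1 : pos b1) (q2 : pos b2).

(** By [MI_limit], the left-hand side is the ratio of [MI] to [MT] whatever [a3] is. The ratio is
    symmetric in [a1] and [a3], so the roles of these two can be exchanged. *)
Lemma JQ_change : JQ a1 a2 b1 b2 = JQ a3 a2 b1 b2.
Proof.
have EI : MI a1 a2 a3 b1 b2 = MI a3 a2 a1 b1 b2.
  apply: eq_CI => y; rewrite /MF.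
  have -> : a3 + a2 + a1 = a1 + a2 + a3 by ring.
  exact: MF_algebra.
have ET : MT a1 a2 a3 b1 b2 = MT a3 a2 a1 b1 b2.
  rewrite /MT.
  have -> : a2 + a1 + b1 + b2 = a1 + a2 + b1 + b2 by ring.
  have -> : a3 + a1 + b1 + b2 = a1 + a3 + b1 + b2 by ring.
  have -> : a3 + a2 + b1 + b2 = a2 + a3 + b1 + b2 by ring.
  exact: MT_algebra.
exact: (etrans (esym (MI_limit p1 p2 p3 q1 q2))
  (etrans (f_equal2 (fun u v : R[i] => u / v) EI ET) (MI_limit p3 p2 p1 q1 q2))).
Qed.

Lemma JQ_swap : JQ a1 a2 b1 b2 = JQ a2 a1 b1 b2.
Proof.
apply: eq_CI => y; rewrite /JN (addrC a2 a1).
exact: JN_algebra.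
Qed.

Lemma JQ_opp : JQ a1 a2 b1 b2 = JQ b1 b2 a1 a2.
Proof.
have E y : JN a1 a2 b1 b2 (0 +i* (- y)) = JN b1 b2 a1 a2 (0 +i* y).
  have -> : 0 +i* (- y) = - (0 +i* y) :> R[i] by apply: complex_ext; rewrite ?ReN ?ImN /= ?oppr0.
  rewrite /JN !opprK; have -> : b1 + b2 + a1 + a2 = a1 + a2 + b1 + b2 by ring.
  rewrite (addrC b1 a1) (addrC b1 a2) (addrC b2 a1) (addrC b2 a2).
  exact: JN_algebra'.
have c := JN_ccont p1 p2 p3 q1 q2; have i := JN_cig p1 p2 p3 q1 q2.
have i' := JN_cig q1 q2 p3 p1 p2.
rewrite /JQ -(CI_opp c i); first exact: eq_CI.
by apply: eq_cig i' => y; rewrite E.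
Qed.

End Params.

Lemma divr_eq_mul (u v c : R[i]) : v != 0 -> u / v = c -> u = c * v.
Proof. by move=> v0 <-; rewrite divfK. Qed.

Lemma Barnes_second a1 a2 a3 b1 b2 : pos a1 -> pos a2 -> pos a3 -> pos b1 -> pos b2 ->
  MI a1 a2 a3 b1 b2 = (2 * pi)%:C * MT a1 a2 a3 b1 b2.
Proof.
move=> p1 p2 p3 q1 q2; have ph := pos_half.
(* This replaces the first pair of parameters by 1/2; [JQ_opp] then brings the second pair to the
   front. *)
have h (u1 u2 v1 v2 : R[i]) : pos u1 -> pos u2 -> pos v1 -> pos v2 ->
    JQ u1 u2 v1 v2 = JQ half half v1 v2.
  move=> h1 h2 h3 h4; have e1 := JQ_change h1 h2 ph h3 h4.
  have e2 := JQ_change h2 ph ph h3 h4.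
  have e3 := JQ_swap half u2 v1 v2.
  by rewrite e1 e3.
have e1 := h a1 a2 b1 b2 p1 p2 q1 q2; have e2 := JQ_opp ph ph ph q1 q2.
have e3 := h b1 b2 half half q1 q2 ph ph; have e4 := MI_limit p1 p2 p3 q1 q2.
rewrite e1 e2 e3 JQ_half in e4.
exact: divr_eq_mul (MT_neq0 p1 p2 p3 q1 q2) e4.
Qed.

End BarnesConstant.


(** * The de Branges-Wilson integral *)

Section Wilson.
Context {R : realType}.
Implicit Types (x y t w v s : R) (z a b c d : R[i]).
Local Notation mu := (@lebesgue_measure R).
Local Notation pos z := (0 < complex.Re z).

(* On the imaginary axis z * Sn z is, up to a constant, 1 / (Gamma (2 z) Gamma (- 2 z)).
   WF is the integrand, WT the value up to a constant, and VN the limit of WF / WT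
   when a is replaced by a + n and n tends to oo. *)
Definition VF b c d z := Gamma (b + z) * Gamma (b - z) * (Gamma (c + z) * Gamma (c - z)) *
  (Gamma (d + z) * Gamma (d - z)) * (z * Sn z).

Definition WF a b c d z := Gamma (a + z) * Gamma (a - z) * VF b c d z.

Definition WT a b c d := Gamma (a + b) * Gamma (a + c) * Gamma (a + d) *
  (Gamma (b + c) * Gamma (b + d) * Gamma (c + d)) / Gamma (a + b + c + d).

Definition WI a b c d := CI (fun y => WF a b c d (0 +i* y)).

Definition VN b c d z := VF b c d z / (Gamma (b + c) * Gamma (b + d) * Gamma (c + d)).

Definition VQ b c d := CI (fun y => VN b c d (0 +i* y)).

(* WG z - WG (z + 1) gives the recurrence, as MG does above. *)
Definition WG a b c d z := Gamma (a + z) * Gamma (a + 1 - z) *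
  (Gamma (b + z) * Gamma (b + 1 - z) * (Gamma (c + z) * Gamma (c + 1 - z)) *
  (Gamma (d + z) * Gamma (d + 1 - z)) * Sn z).

Lemma sreg_pair a x : 0 < complex.Re a - x ->
  sreg (- x) x (gp + gp) (fun z => Gamma (a + z) * Gamma (a - z)).
Proof. by move=> h; exact: sregM (sreg_Gamma x h) (sreg_GammaN (- x) h). Qed.

Lemma VF_sreg b c d x : 0 < complex.Re b - x -> 0 < complex.Re c - x -> 0 < complex.Re d - x ->
  sreg (- x) x (pi / 5) (VF b c d).
Proof.
move=> h2 h3 h4; have p0 := pi_gt0 R; have p5 : 0 < pi / 5 :> R by rewrite divr_gt0.
apply: sreg_le (sregM (sregM (sregM (sreg_pair h2) (sreg_pair h3)) (sreg_pair h4))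
    (sregM (sreg_id (- x) x p5) (sreg_Sn (- x) x))).
(* The tightest budget: 6 [gp] is 12 pi / 5, [Sn] costs 2 pi and the factor z costs pi / 5, which
   leaves exactly pi / 5. *)
by rewrite /gp; lra.
Qed.

(** The product of a - z, b - z, c - z, d - z minus that of a + z, b + z, c + z, d + z is odd in z,
    so a factor 2 z comes out. This is the origin of the factor z of [VF], which [WG] does not
    contain. *)
Lemma WG_algebra (a b c d z g1 g2 h1 h2 k1 k2 l1 l2 s : R[i]) :
  2 * (a + b + c + d) * ((a + z) * g1 * ((a - z) * g2) *
    (h1 * h2 * (k1 * k2) * (l1 * l2) * (z * s))) -
  2 * ((a + b) * (a + c) * (a + d)) * (g1 * g2 * (h1 * h2 * (k1 * k2) * (l1 * l2) * (z * s))) =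
  g1 * ((a - z) * g2) * (h1 * ((b - z) * h2) * (k1 * ((c - z) * k2)) * (l1 * ((d - z) * l2)) * s) -
  (a + z) * g1 * g2 * ((b + z) * h1 * h2 * ((c + z) * k1 * k2) * ((d + z) * l1 * l2) * s).
Proof.
transitivity (g1 * g2 * h1 * h2 * k1 * k2 * l1 * l2 * s *
  ((a - z) * (b - z) * (c - z) * (d - z) - (a + z) * (b + z) * (c + z) * (d + z))).
  rewrite (_ : (a - z) * (b - z) * (c - z) * (d - z) - (a + z) * (b + z) * (c + z) * (d + z) =
    2 * z * ((a + b + c + d) * ((a + z) * (a - z)) - (a + b) * (a + c) * (a + d))); last by ring.
  move: ((a + b + c + d)) ((a + z)) ((a - z)) ((a + b) * (a + c) * (a + d)) => *; ring.
move: (a - z) (b - z) (c - z) (d - z) (a + z) (b + z) (c + z) (d + z) => *; ring.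
Qed.

Lemma WT_rec_algebra (g1 g2 g3 t1 t2 t3 s h k : R[i]) : s != 0 ->
  2 * s * (t1 * g1 * (t2 * g2) * (t3 * g3) * h / (s * k)) = 2 * (t1 * t2 * t3) * (g1 * g2 * g3 * h / k).
Proof. by move=> s0; rewrite invfM; move: k^-1 => i; field. Qed.

Lemma Wratio_algebra (g1 g2 g3 h k x1 x2 v : R[i]) :
  (g1 * g2 * g3 * h / k)^-1 * (x1 * x2 * v) = x1 * x2 * k / (g1 * g2 * g3) * (v / h).
Proof. by rewrite invf_div !invfM; ring. Qed.

Lemma nc_Gamma_le z : pos z -> nc (Gamma z) <= rG (complex.Re z).
Proof.
case: z => x y /= x0; have := gam_le1 y x0; rewrite /gam ler_pdivrMr ?rG_gt0//.
by rewrite mul1r.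
Qed.

Lemma Wratio_scale (n0 m d1 d2 d3 r : R) : n0 != 0 ->
  n0 * n0 * m / (d1 * d2 * d3) * ((n0 / r)^-1 * (n0 / r)^-1) = r * r * m / (d1 * d2 * d3).
Proof.
by move=> n00; rewrite !invfM invrK; move: (d1^-1) (d2^-1) (d3^-1) => *; field.
Qed.

Section Params.
Variables (a b c d : R[i]).
Hypotheses (pa : pos a) (pb : pos b) (pc : pos c) (pd : pos d).

Lemma WF_sreg : exists2 e, 0 < e & sreg (- e) e (pi / 5) (WF a b c d) /\
  sreg (- e) e (pi / 5) (VN b c d).
Proof.
have [|e e0 /= /and5P[h1 h2 h3 h4 _]] := @exists_lt_all R
  [:: complex.Re a; complex.Re b; complex.Re c; complex.Re d].
  by rewrite /= pa pb pc pd.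
have sg x : e < x -> 0 < x - e by rewrite subr_gt0.
move: h1 h2 h3 h4 => /sg h1 /sg h2 /sg h3 /sg h4; exists e => //.
have p0 := pi_gt0 R; have hV := VF_sreg h2 h3 h4.
split; first by apply: sreg_le (sregM (sreg_pair h1) hV); rewrite /gp; lra.
have := sregZ (Gamma (b + c) * Gamma (b + d) * Gamma (c + d))^-1 hV.
by apply: sreg_eq => z; rewrite mulrC.
Qed.

Lemma WF_cig : cig (fun y => WF a b c d (0 +i* y)).
Proof.
have [e e0 [h _]] := WF_sreg; have [||] := @sreg_line _ _ _ _ _ 0 h; last by [].
- by rewrite divr_gt0// pi_gt0.
- by rewrite oppr_lt0 e0.
Qed.

Lemma WF_ccont : ccont (fun y => WF a b c d (0 +i* y)).
Proof. by have [e e0 [h _]] := WF_sreg; apply: (sreg_cont h); rewrite oppr_lt0 e0. Qed.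

Lemma VN_ccont : ccont (fun y => VN b c d (0 +i* y)).
Proof. by have [e e0 [_ h]] := WF_sreg; apply: (sreg_cont h); rewrite oppr_lt0 e0. Qed.

Lemma WG_sreg : exists2 e, 0 < e & sreg (- e) (1 + e) pi (WG a b c d).
Proof.
have [|e e0 /= /and5P[h1 h2 h3 h4 _]] := @exists_lt_all R
  [:: complex.Re a; complex.Re b; complex.Re c; complex.Re d].
  by rewrite /= pa pb pc pd.
have sg x : e < x -> 0 < x - e by rewrite subr_gt0.
move: h1 h2 h3 h4 => /sg h1 /sg h2 /sg h3 /sg h4; exists e => //.
have p0 := pi_gt0 R.
have gg u : 0 < complex.Re u - e ->
    sreg (- e) (1 + e) (gp + gp) (fun z => Gamma (u + z) * Gamma (u + 1 - z)).
  move=> h; apply: sregM (sreg_Gamma (1 + e) h) (sreg_GammaN (- e) _).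
  by rewrite ReD /=; lra.
apply: sreg_le (sregM (gg _ h1) (sregM (sregM (sregM (gg _ h2) (gg _ h3)) (gg _ h4))
    (sreg_Sn (- e) (1 + e)))).
by rewrite /gp; lra.
Qed.

Lemma WI_rec : cig (fun y => WF (a + 1) b c d (0 +i* y)) ->
  2 * (a + b + c + d) * WI (a + 1) b c d = 2 * ((a + b) * (a + c) * (a + d)) * WI a b c d.
Proof.
move=> c1; have c0 := WF_cig.
have [e e0 hG] := WG_sreg.
have m0 : - e < 0 < 1 + e by rewrite oppr_lt0 e0 addr_gt0.
have m1 : - e < 1 < 1 + e by rewrite ltrDl e0 andbT; lra.
have [g0 /(_ _ m1) eG] := sreg_line hG (pi_gt0 R) m0.
have [g1 _] := sreg_line hG (pi_gt0 R) m1.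
have E1 := CIZ (2 * (a + b + c + d)) c1.
have E2 := CIZ (2 * ((a + b) * (a + c) * (a + d))) c0.
have E3 := CIB (cigZ (2 * (a + b + c + d)) c1) (cigZ (2 * ((a + b) * (a + c) * (a + d))) c0).
have E4 := CIB g0 g1; rewrite eG subrr in E4.
rewrite E1 E2 in E3; apply/eqP; rewrite -subr_eq0; apply/eqP.
rewrite -[LHS]E3 -[RHS]E4; apply: eq_CI => y.
have -> : 1 +i* y = (0 +i* y) + 1 :> R[i] by apply: complex_ext; rewrite ?ReD ?ImD /= ?addr0 ?add0r.
have n1 := pos_neq0 (posD_i y pa); have n2 := pos_neq0 (posD_i y pb).
have n3 := pos_neq0 (posD_i y pc); have n4 := pos_neq0 (posD_i y pd).
have m1' := pos_neq0 (posB_i y pa); have m2 := pos_neq0 (posB_i y pb).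
have m3 := pos_neq0 (posB_i y pc); have m4 := pos_neq0 (posB_i y pd).
move: (0 +i* y) n1 n2 n3 n4 m1' m2 m3 m4 => z n1 n2 n3 n4 m1' m2 m3 m4.
rewrite /WF /WG /VF Sn1.
have -> : a + 1 + z = a + z + 1 by ring.
have AB u : u + 1 - z = u - z + 1 by ring.
have AC u : u + 1 - (z + 1) = u - z by ring.
rewrite !AC !AB !(addrA _ z 1).
rewrite (Gamma_succ n1) (Gamma_succ n2) (Gamma_succ n3) (Gamma_succ n4).
rewrite (Gamma_succ m1') (Gamma_succ m2) (Gamma_succ m3) (Gamma_succ m4).
exact: WG_algebra.
Qed.

Lemma WT_rec : 2 * (a + b + c + d) * WT (a + 1) b c d =
  2 * ((a + b) * (a + c) * (a + d)) * WT a b c d.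
Proof.
have n1 := pos_neq0 (posD pa pb); have n2 := pos_neq0 (posD pa pc).
have n3 := pos_neq0 (posD pa pd); have n4 := pos_neq0 (posD (posD (posD pa pb) pc) pd).
rewrite /WT.
have -> : a + 1 + b + c + d = a + b + c + d + 1 by ring.
rewrite !(addrAC a 1).
rewrite (Gamma_succ n1) (Gamma_succ n2) (Gamma_succ n3) (Gamma_succ n4).
exact: WT_rec_algebra.
Qed.

Lemma WT_neq0 : WT a b c d != 0.
Proof.
have g (u : R[i]) : pos u -> Gamma u != 0 by exact: Gamma_neq0_gt0.
have n1 := g _ (posD pa pb); have n2 := g _ (posD pa pc); have n3 := g _ (posD pa pd).
have n4 := g _ (posD pb pc); have n5 := g _ (posD pb pd); have n6 := g _ (posD pc pd).
have n7 := g _ (posD (posD (posD pa pb) pc) pd).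
apply: (mulf_neq0 (mulf_neq0 (mulf_neq0 (mulf_neq0 n1 n2) n3) (mulf_neq0 (mulf_neq0 n4 n5) n6))).
by rewrite invr_eq0.
Qed.

Definition Wratio n z := Gamma (n%:R + (a + z)) * Gamma (n%:R + (a - z)) *
  Gamma (n%:R + (a + b + c + d)) /
  (Gamma (n%:R + (a + b)) * Gamma (n%:R + (a + c)) * Gamma (n%:R + (a + d))).

Lemma WF_div_WT n z : (WT (a + n%:R) b c d)^-1 * WF (a + n%:R) b c d z =
  Wratio n z * VN b c d z.
Proof.
rewrite /WT /WF /Wratio /VN.
have -> : a + n%:R + z = n%:R + (a + z) by ring.
have -> : a + n%:R - z = n%:R + (a - z) by ring.
have -> : a + n%:R + b + c + d = n%:R + (a + b + c + d) by ring.
have -> : a + n%:R + b = n%:R + (a + b) by ring.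
have -> : a + n%:R + c = n%:R + (a + c) by ring.
have -> : a + n%:R + d = n%:R + (a + d) by ring.
exact: Wratio_algebra.
Qed.

Lemma Wratio_cvg y : ccvg (fun n => Wratio n (0 +i* y)) 1.
Proof.
apply: asym3; try (apply: ltW).
- exact: posD_i.
- exact: posB_i.
- exact: (posD (posD (posD pa pb) pc) pd).
- exact: posD.
- exact: posD.
- exact: posD.
by ring.
Qed.

(** z occurs in the numerator only, where |Gamma (n + a + i y)| and |Gamma (n + a - i y)| are at
    most the value of [Gamma] at the real part n + Re a: the bound is uniform in [y] as well as in
    [n]. *)
Lemma Wratio_bounded : exists2 K, 0 <= K & forall n y, nc (Wratio n (0 +i* y)) <= K.
Proof.
pose X := complex.Re a; pose s := a + b + c + d.
have ps : pos s by exact: (posD (posD (posD pa pb) pc) pd).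
pose k n := rG (n%:R + X) * rG (n%:R + X) * nc (Gamma (n%:R + s)) /
  (nc (Gamma (n%:R + (a + b))) * nc (Gamma (n%:R + (a + c))) * nc (Gamma (n%:R + (a + d)))).
have [K K0 hK] : exists2 K, 0 <= K & forall n, `|k n| <= K.
  have E : a + a + s = (a + b) + (a + c) + (a + d) by rewrite /s; ring.
  have h := ccvg_nc (asym3 (ltW pa) (ltW pa) (ltW ps) (ltW (posD pa pb)) (ltW (posD pa pc)) (ltW (posD pa pd)) E).
  have hV := rcvgV (oner_neq0 R) (asym_rG (ltW pa)).
  have h2 := rcvgM h (rcvgM hV hV).
  apply: (@rcvg_bounded R k); apply: near_rcvg h2; apply: nearW => n.
  have g : nc (Gamma (n%:R + a)) != 0.
    by rewrite addrC gt_eqF// nc_gt0 Gamma_neq0_gt0// pos_natD.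
  by rewrite nc_ratio3 Wratio_scale.
exists K => // n y; apply: le_trans (hK n); apply: le_trans (ler_norm _).
rewrite /Wratio nc_ratio3 /k -/s.
have q1 : nc (Gamma (n%:R + (a + (0 +i* y)))) <= rG (n%:R + X).
  apply: le_trans (nc_Gamma_le _) _; first by rewrite addrC; apply: pos_natD; exact: posD_i.
  by rewrite !ReD Re_nat /= addr0.
have q2 : nc (Gamma (n%:R + (a - (0 +i* y)))) <= rG (n%:R + X).
  apply: le_trans (nc_Gamma_le _) _; first by rewrite addrC; apply: pos_natD; exact: posB_i.
  by rewrite !ReD ReN Re_nat /= oppr0 addr0.
apply: ler_wpM2r; first by rewrite invr_ge0 !mulr_ge0 ?nc_ge0.
apply: ler_wpM2r; first exact: nc_ge0.
by apply: ler_pM => //; exact: nc_ge0.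
Qed.

End Params.

Section Limit.
Variables (a b c d : R[i]).
Hypotheses (pa : pos a) (pb : pos b) (pc : pos c) (pd : pos d).

Lemma WI_limit_cvg : ccvg (fun n => WI (a + n%:R) b c d / WT (a + n%:R) b c d) (VQ b c d).
Proof.
have [K K0 hK] := Wratio_bounded pa pb pc pd.
have [e e0 [_ [_ [C C0 hC]]]] := WF_sreg pa pb pc pd.
pose f_ n y := (WT (a + n%:R) b c d)^-1 * WF (a + n%:R) b c d (0 +i* y).
have fE n : CI (f_ n) = WI (a + n%:R) b c d / WT (a + n%:R) b c d.
  have E := CIZ (WT (a + n%:R) b c d)^-1 (WF_cig (pos_natD n pa) pb pc pd).
  exact: etrans E (mulrC _ _).
apply: (eq_ccvg fE).
have [|||||//] := @CI_dct R f_ (fun y => VN b c d (0 +i* y))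
  (fun y => K * C * expR (- (pi / 5 * `|y|))).
- move=> n; apply: ccont_meas; apply: ccontZ; apply: WF_ccont => //; exact: pos_natD.
- exact: ccont_meas (VN_ccont pa pb pc pd).
- by apply: intgZ; apply: cvg_expR_norm_intg; rewrite divr_gt0// pi_gt0.
- move=> y; rewrite -[X in ccvg _ X]mul1r.
  apply: eq_ccvg (ccvgM (Wratio_cvg pa pb pc pd y) (ccvg_cst _)) => n.
  by rewrite /f_ WF_div_WT.
move=> n y; rewrite /f_ WF_div_WT ncM -mulrA.
apply: ler_pM; rewrite ?nc_ge0//.
by apply: (hC (0 +i* y)); rewrite /strip /= oppr_le0 ltW.
Qed.

Lemma WI_limit : WI a b c d / WT a b c d = VQ b c d.
Proof.
have nat_succ n : a + n.+1%:R = a + n%:R + 1 by rewrite -addrA natr1.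
have E n : WI (a + n%:R) b c d / WT (a + n%:R) b c d =
    WI (a + 0%:R) b c d / WT (a + 0%:R) b c d.
  apply: (@ratio_const _ (fun n => WI (a + n%:R) b c d)
    (fun n => WT (a + n%:R) b c d)
    (fun n => 2 * (a + n%:R + b + c + d))
    (fun n => 2 * ((a + n%:R + b) * (a + n%:R + c) * (a + n%:R + d)))) => {}n.
  - rewrite nat_succ; apply: WI_rec => //; first exact: pos_natD.
    by rewrite -nat_succ; apply: WF_cig => //; exact: pos_natD.
  - by rewrite nat_succ; apply: WT_rec => //; exact: pos_natD.
  - have s1 := posD (posD (posD (pos_natD n pa) pb) pc) pd.
    by rewrite mulf_neq0 ?pnatr_eq0//; exact: pos_neq0 s1.
  - by apply: WT_neq0 => //; exact: pos_natD.
have h := WI_limit_cvg.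
have := ccvg_unique (eq_ccvg E h) (ccvg_cst _).
by rewrite addr0 => ->.
Qed.

End Limit.

Lemma WF_swap_algebra (g1 g2 h1 h2 k1 k2 l1 l2 s : R[i]) :
  g1 * g2 * (h1 * h2 * (k1 * k2) * (l1 * l2) * s) =
  h1 * h2 * (g1 * g2 * (k1 * k2) * (l1 * l2) * s).
Proof. by ring. Qed.

Lemma WT_swap_algebra (x1 x2 x3 x4 x5 x6 h : R[i]) :
  x1 * x2 * x3 * (x4 * x5 * x6) / h = x1 * x4 * x5 * (x2 * x3 * x6) / h.
Proof. by ring. Qed.

Lemma VF_rot_algebra (h1 h2 k1 k2 l1 l2 s x y z : R[i]) :
  h1 * h2 * (k1 * k2) * (l1 * l2) * s / (x * y * z) =
  k1 * k2 * (l1 * l2) * (h1 * h2) * s / (z * x * y).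
Proof. by congr (_ / _); ring. Qed.

Lemma VQ_change a b c d : pos a -> pos b -> pos c -> pos d -> VQ b c d = VQ a c d.
Proof.
move=> pa pb pc pd.
have EI : WI a b c d = WI b a c d by apply: eq_CI => y; exact: WF_swap_algebra.
have ET : WT a b c d = WT b a c d.
  by rewrite /WT (addrC b a); exact: WT_swap_algebra.
exact: (etrans (esym (WI_limit pa pb pc pd))
  (etrans (f_equal2 (fun u v : R[i] => u / v) EI ET) (WI_limit pb pa pc pd))).
Qed.

Lemma VQ_rot b c d : VQ b c d = VQ c d b.
Proof.
apply: eq_CI => y; rewrite /VN (addrC c b) (addrC d b); exact: VF_rot_algebra.
Qed.

(** [VQ_change] replaces the first parameter by 1/2 and [VQ_rot] brings the next one to the
    front. *)
Lemma VQ_const b c d : pos b -> pos c -> pos d -> VQ b c d = VQ half half half.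
Proof.
move=> pb pc pd; have ph := @pos_half R.
have e1 := VQ_change ph pb pc pd; have e2 := VQ_rot half c d.
have e3 := VQ_change ph pc pd ph; have e4 := VQ_rot half d half.
have e5 := VQ_change ph pd ph ph.
exact: (etrans e1 (etrans e2 (etrans e3 (etrans e4 e5)))).
Qed.

Lemma sh_double t : sh (2 * t) = 2 * sh t * ch t.
Proof.
rewrite /sh /ch (_ : 2 * t = t + t); last by ring.
by rewrite opprD !expRD; move: (expR _) (expR _) => u v; field.
Qed.

(** Antiderivative for the case where all parameters are 1/2. By [sh_double] the integrand is - 4
    pi^4 t sh (pi t) / ch (pi t)^3; since sh / ch^3 is a derivative up to a constant, one
    integration by parts yields the two terms. *)
Lemma is_derive_W t : is_derive t 1
  (fun t : R => 2 * pi ^+ 3 * (t / ch (pi * t) ^+ 2) - 2 * pi ^+ 2 * (sh (pi * t) / ch (pi * t)))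
  (- 2 * t * sh (2 * pi * t) * (pi / ch (pi * t)) ^+ 4).
Proof.
have c0 : ch (pi * t) != 0 by rewrite gt_eqF ?ch_gt0.
have d1 := is_derive_ch pi t; have d2 := is_derive_sh pi t.
have d3 := @is_derive_inv R (fun t => ch (pi * t)) t _ c0 d1.
have e (u : R) : u / ch (pi * u) ^+ 2 = u * (ch (pi * u))^-1 * (ch (pi * u))^-1.
  by rewrite expr2 invfM mulrA.
under eq_fun do rewrite e.
apply: is_derive_eq; rewrite /GRing.scale /= -(mulrA 2 pi t) sh_double.
have := ch_sqr (pi * t); move: c0; clear d1 d2 d3.
move: (ch (pi * t)) (sh (pi * t)) => C s c0 ee; move: (pi) => p.
transitivity (2 * p ^+ 3 * (C ^- 2 - 2 * p * t * s * C ^- 3) -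
  2 * p ^+ 3 * (C ^+ 2 - s ^+ 2) * C ^- 2); last by rewrite ee; field.
by field.
Qed.

Lemma WT_half : WT half half half half = 1.
Proof.
by rewrite /WT -(addrA (half + half)) !halfD Gamma_2 Gamma_1 !mulr1 invr1 mulr1.
Qed.

Lemma WI_half : WI half half half half = 0 +i* (- 4 * pi ^+ 2).
Proof.
pose f t : R := - 2 * t * sh (2 * pi * t) * (pi / ch (pi * t)) ^+ 4.
have E y : WF half half half half (0 +i* y) = 0 +i* f y.
  rewrite /WF /VF !Gamma_half_mul Sn_i.
  have e4 (u : R) (v : R[i]) : u%:C * (u%:C * u%:C * u%:C * v) = (u ^+ 4)%:C * v.
    by rewrite rmorphXn /=; ring.
  rewrite e4; apply: complex_ext; rewrite ?ReM ?ImM /= /f; ring.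
have ph := @pos_half R; have ci := WF_cig ph ph ph ph.
have [_ i2] := eq_cig E ci.
rewrite /WI (eq_CI E); apply: complex_ext; rewrite ?ReCI ?ImCI /=.
  by rewrite Rintegral_cst// mul0r.
have h2 : (fun _ : nat => 2 * pi ^+ 3 : R) @ \oo --> (2 * pi ^+ 3 : R) by exact: cvg_cst.
have h3 : (fun _ : nat => 2 * pi ^+ 2 : R) @ \oo --> (2 * pi ^+ 2 : R) by exact: cvg_cst.
have l1 := rcvgM h2 n_ch_cvg; have l2 := rcvgM h3 th_cvg.
rewrite mulr0 in l1; rewrite mulr1 in l2.
have l3 : (fun n : nat => 2 * pi ^+ 3 * (n%:R / ch (pi * n%:R) ^+ 2) -
    2 * pi ^+ 2 * (sh (pi * n%:R) / ch (pi * n%:R))) @ \oo --> (0 - 2 * pi ^+ 2 : R).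
  exact: cvgB l1 l2.
have l4 : (fun n : nat => - (2 * pi ^+ 3 * (n%:R / ch (pi * n%:R) ^+ 2) -
    2 * pi ^+ 2 * (sh (pi * n%:R) / ch (pi * n%:R)))) @ \oo --> (- (0 - 2 * pi ^+ 2) : R).
  exact: cvgN l3.
rewrite (FTC_R _ i2 is_derive_W (lp := 0 - 2 * pi ^+ 2) (lm := - (0 - 2 * pi ^+ 2)))//.
- by ring.
- have cc : continuous (fun t : R => pi / ch (pi * t)).
    by move=> t; apply: cvgM; [exact: cvg_cst|apply: cvgV; [rewrite gt_eqF ?ch_gt0|exact: ch_cont]].
  have c4 : continuous (fun t : R => (pi / ch (pi * t)) ^+ 4).
    move=> t; apply: (cvgM (cc t)); apply: (cvgM (cc t)); exact: (cvgM (cc t) (cc t)).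
  move=> t; apply: cvgM.
    apply: cvgM; first by apply: cvgM; [exact: cvg_cst|exact: cvg_id].
    exact: (derive_cont (is_derive_sh (2 * pi))).
  exact: c4.
- apply: (near_rcvg _ l4); apply: nearW => n.
  by rewrite (mulrN pi n%:R) shN chN; ring.
Qed.

Lemma deBranges_Wilson a b c d : pos a -> pos b -> pos c -> pos d ->
  WI a b c d = (0 +i* (- 4 * pi ^+ 2)) * WT a b c d.
Proof.
move=> pa pb pc pd; have ph := @pos_half R.
have e1 := WI_limit pa pb pc pd; have e2 := VQ_const pb pc pd.
have e3 := WI_limit ph ph ph ph; rewrite WT_half WI_half divr1 in e3.
rewrite e2 -e3 in e1.
exact: divr_eq_mul (WT_neq0 pa pb pc pd) e1.
Qed.

End Wilson.


(** * Interchange of the two integrals *)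

Section Fubini.
Context {R : realType}.
Implicit Types (x y k C : R).
Local Notation mu := (@lebesgue_measure R).

Definition meas2 (f : R * R -> R) := measurable_fun [set: R * R] f.

Definition cmeas2 (f : R * R -> R[i]) :=
  meas2 (fun p => complex.Re (f p)) /\ meas2 (fun p => complex.Im (f p)).

Lemma cmeas2M f g : cmeas2 f -> cmeas2 g -> cmeas2 (fun p => f p * g p).
Proof.
move=> [f1 f2] [g1 g2]; split.
  rewrite /meas2; under eq_fun do rewrite ReM.
  by apply: measurable_funB; apply: measurable_funM.
rewrite /meas2; under eq_fun do rewrite ImM.
by apply: measurable_funD; apply: measurable_funM.
Qed.

Lemma cmeas2_comp (u : R -> R[i]) (v : R * R -> R) : ccont u -> meas2 v ->
  cmeas2 (fun p => u (v p)).
Proof.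
move=> /ccont_meas[u1 u2] mv; split; [exact: (measurableT_comp u1 mv)|exact: (measurableT_comp u2 mv)].
Qed.

Lemma meas2_fst : meas2 fst.
Proof. exact: measurable_fst. Qed.

Lemma meas2_snd : meas2 snd.
Proof. exact: measurable_snd. Qed.

Lemma meas2D u v : meas2 u -> meas2 v -> meas2 (fun p => u p + v p).
Proof. exact: measurable_funD. Qed.

Lemma meas2B u v : meas2 u -> meas2 v -> meas2 (fun p => u p - v p).
Proof. exact: measurable_funB. Qed.

(** Domination by a product of exponentials gives integrability on the plane and on every horizontal
    and vertical line, not just on almost every one; the inner integrals are then finite and pass
    between real and extended values. *)
Lemma Rint_Fubini (f : R * R -> R) C k : meas2 f -> 0 < k ->
  (forall x y, `|f (x, y)| <= C * expR (- (k * `|x|)) * expR (- (k * `|y|))) ->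
  \int[mu]_x \int[mu]_y f (x, y) = \int[mu]_y \int[mu]_x f (x, y).
Proof.
move=> mf k0 hf; pose E y := expR (- (k * `|y|)).
have iE : intg E by exact: cvg_expR_norm_intg.
have C0 : 0 <= C.
  have := le_trans (normr_ge0 _) (hf 0 0); rewrite normr0 mulr0 oppr0 expR0.
  by rewrite !mulr1.
have i1 x : intg (fun y => f (x, y)).
  apply: (@intg_dom _ _ (fun y => C * E x * E y)) => [|y|]; last exact: intgZ.
    by apply: (measurableT_comp mf); exact: pair1_measurable.
  exact: hf.
have i2 y : intg (fun x => f (x, y)).
  apply: (@intg_dom _ _ (fun x => C * E y * E x)) => [|x|]; last exact: intgZ.
    by apply: (measurableT_comp mf); exact: pair2_measurable.
  by rewrite (le_trans (hf x y))// mulrAC.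
have if2 : (mu \x mu)%E.-integrable [set: R * R] (EFin \o f).
  apply/integrable12ltyP; first exact/measurable_EFinP.
  pose I := \int[mu]_y E y.
  have iI : intg (fun x => C * I * E x) by exact: intgZ.
  have I0 : 0 <= I by apply: Rintegral_ge0 => y _; exact: expR_ge0.
  have mf' : measurable_fun setT (EFin \o f) by exact/measurable_EFinP.
  apply: (@le_lt_trans _ _ (\int[mu]_x `|(C * I * E x)%:E|)%E); last first.
    by have /integrableP[_] := iI.
  have in1 x : (\int[mu]_y `|(EFin \o f) (x, y)| <= `|(C * I * E x)%:E|)%E.
    have EI : (\int[mu]_y (C * E x * E y)%:E)%E = (C * I * E x)%:E.
      have ic : intg (fun y => C * E x * E y) by exact: intgZ.
      have := fineK (integrable_fin_num measurableT ic) => <-; congr EFin.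
      rewrite -[LHS]/(\int[mu]_y (C * E x * E y)) RintegralZl// /I; ring.
    rewrite gee0_abs ?lee_fin; last first.
      by apply: mulr_ge0; [apply: mulr_ge0|exact: expR_ge0].
    rewrite -EI; apply: ge0_le_integral => //.
    - apply: measurableT_comp => //; apply/measurable_EFinP.
      by apply: (measurableT_comp mf); exact: pair1_measurable.
    - by apply/measurable_EFinP; exact: intg_measurable (intgZ _ iE).
    by move=> y _; rewrite /= lee_fin; exact: hf.
  apply: ge0_le_integral => //.
  - by move=> x _; apply: integral_ge0 => y _; exact: abse_ge0.
  - apply: (@measurable_fun_fubini_tonelli_F _ _ _ _ R mu (abse \o (EFin \o f))).
      by apply: measurableT_comp.
    by move=> p; exact: abse_ge0.
  - apply: measurableT_comp => //; apply/measurable_EFinP; exact: intg_measurable iI.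
have H := @Fubini _ _ _ _ R mu mu (EFin \o f) if2.
have E1 (x : R) : (\int[mu]_y (f (x, y))%:E)%E = (\int[mu]_y f (x, y))%:E.
  by rewrite /Rintegral fineK//; exact: integrable_fin_num (i1 x).
have E2 (y : R) : (\int[mu]_x (f (x, y))%:E)%E = (\int[mu]_x f (x, y))%:E.
  by rewrite /Rintegral fineK//; exact: integrable_fin_num (i2 y).
rewrite {1}/Rintegral [in RHS]/Rintegral; congr fine.
under eq_integral do rewrite -E1.
under [RHS]eq_integral do rewrite -E2.
exact: H.
Qed.

Lemma CI_Fubini (f : R * R -> R[i]) C k : cmeas2 f -> 0 < k ->
  (forall x y, nc (f (x, y)) <= C * expR (- (k * `|x|)) * expR (- (k * `|y|))) ->
  CI (fun x => CI (fun y => f (x, y))) = CI (fun y => CI (fun x => f (x, y))).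
Proof.
move=> [m1 m2] k0 hf; apply: complex_ext; rewrite ?ReCI ?ImCI.
  apply: (Rint_Fubini m1 k0) => x y; exact: le_trans (nc_Re _) (hf x y).
apply: (Rint_Fubini m2 k0) => x y; exact: le_trans (nc_Im _) (hf x y).
Qed.

End Fubini.


(** * The left-hand side as an integral on the imaginary axis *)

Section Line.
Context {R : realType}.
Implicit Types (x y s t : R) (z : R[i]).
Local Notation mu := (@lebesgue_measure R).
Local Notation pos z := (0 < complex.Re z).

Lemma Gamma_pair x s : 0 < x ->
  Gamma (x%:C + (0 +i* s)) * Gamma (x%:C - (0 +i* s)) = (nc (Gamma (x +i* s)) ^+ 2)%:C.
Proof.
move=> x0; have -> : x%:C - (0 +i* s) = conjc (x%:C + (0 +i* s)).
  by apply: complex_ext; rewrite ?ReB ?ImB /= ?subr0 ?addr0 ?add0r ?sub0r.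
rewrite Gamma_conj; last by apply: posD_i.
have -> : x%:C + (0 +i* s) = x +i* s by apply: complex_ext; rewrite ?ReD ?ImD /= ?addr0 ?add0r.
exact: ncMconj.
Qed.

Lemma nc_Gamma_even x s : 0 < x -> nc (Gamma (x +i* (- s))) = nc (Gamma (x +i* s)).
Proof.
move=> x0; have -> : x +i* (- s) = conjc (x +i* s) by [].
by rewrite Gamma_conj//; case: (Gamma _) => u v; rewrite /nc /= sqrrN.
Qed.

(* Junk value: it makes 1 / Gamma (2 i s) vanish at s = 0. *)
Lemma Gamma_0 : Gamma (0 : R[i]) = 0.
Proof.
by rewrite /Gamma /= ltxx oppr0 truncn0 big_ord1 addr0 invr0 mulr0.
Qed.

(** Off y = 0 it follows from [Gamma1_nc] and the functional equation; at y = 0 both sides vanish,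
    thanks to [Gamma_0]. *)
Lemma nc_Gamma_imV y : (nc (Gamma (0 +i* y)))^-1 ^+ 2 = y * sh (pi * y) / pi.
Proof.
have [->|y0] := eqVneq y 0.
  have -> : 0 +i* (0 : R) = 0 by [].
  by rewrite Gamma_0 nc0 invr0 expr0n /= !mul0r.
have z0 : 0 +i* y != 0 by apply/eqP => /(congr1 (@complex.Im R)) /= /eqP; rewrite (negPf y0).
have E : Gamma (1 +i* y) = (0 +i* y) * Gamma (0 +i* y).
  by rewrite -(Gamma_succ z0); congr Gamma; apply: complex_ext; rewrite ?ReD ?ImD /= ?addr0 ?add0r.
have := Gamma1_nc y; rewrite E ncM.
have -> : nc (0 +i* y) = `|y| by rewrite /nc /= expr0n /= add0r sqrtr_sqr.
have p0 := lt0r_neq0 (pi_gt0 R); move: (nc _) (sh _) p0; move: (pi) => p n s p0.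
rewrite exprMn real_normK ?num_real// => h.
have n0 : n != 0.
  by apply/eqP => n0; move: h; rewrite n0 expr0n /= mulr0 mul0r => /esym/eqP; rewrite mulf_eq0 (negPf p0) (negPf y0).
have -> : s = p / (y * n ^+ 2).
  apply: (mulfI (mulf_neq0 (expf_neq0 2 y0) (expf_neq0 2 n0))); rewrite h; field.
  by rewrite y0 n0.
by field; rewrite p0 y0 n0.
Qed.

Lemma nc6 (x1 x2 x3 x4 x5 x6 y : R[i]) : nc (x1 * x2 * x3 * x4 * x5 * x6 / y) ^+ 2 =
  nc x1 ^+ 2 * nc x2 ^+ 2 * nc x3 ^+ 2 * nc x4 ^+ 2 * nc x5 ^+ 2 * nc x6 ^+ 2 * (nc y)^-1 ^+ 2.
Proof. by rewrite !ncM ncV; ring. Qed.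

Lemma nc6_congr (x1 x2 x3 x4 x5 x6 y z1 z2 z3 z4 z5 z6 w : R[i]) :
  nc x1 = nc z1 -> nc x2 = nc z2 -> nc x3 = nc z3 -> nc x4 = nc z4 -> nc x5 = nc z5 ->
  nc x6 = nc z6 -> (nc y)^-1 ^+ 2 = (nc w)^-1 ^+ 2 ->
  nc (x1 * x2 * x3 * x4 * x5 * x6 / y) ^+ 2 = nc (z1 * z2 * z3 * z4 * z5 * z6 / w) ^+ 2.
Proof. by move=> e1 e2 e3 e4 e5 e6 e7; rewrite !nc6 e1 e2 e3 e4 e5 e6 e7. Qed.

Lemma HF_algebra (p u1 u2 u3 u4 u5 u6 s S : R) : p != 0 ->
  (u1 ^+ 2)%:C * (u2 ^+ 2)%:C * (u3 ^+ 2)%:C *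
    ((u4 ^+ 2)%:C * (u5 ^+ 2)%:C * (u6 ^+ 2)%:C * ((0 +i* s) * (- 2 * S)%:C)) =
  (0 +i* (- p)) * (u1 ^+ 2 * u4 ^+ 2 * u2 ^+ 2 * u3 ^+ 2 * u5 ^+ 2 * u6 ^+ 2 *
    (2 * s * S / p))%:C.
Proof. by move=> p0; apply: complex_ext; rewrite ?(ReM, ImM) /=; field. Qed.

Section Params.
Variables (a b c d e f : R).
Hypotheses (a0 : 0 < a) (b0 : 0 < b) (c0 : 0 < c) (d0 : 0 < d) (e0 : 0 < e) (f0 : 0 < f).

Definition hN s : R := nc
  (Gamma (a +i* s) * Gamma (b +i* s) * Gamma (c +i* s) *
   Gamma (d +i* s) * Gamma (e +i* s) * Gamma (f +i* s) / Gamma (0 +i* (2 * s))) ^+ 2.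

Definition HF z : R[i] := Gamma (a%:C + z) * Gamma (a%:C - z) * (Gamma (c%:C + z) * Gamma (c%:C - z)) *
  (Gamma (d%:C + z) * Gamma (d%:C - z)) * VF b%:C e%:C f%:C z.

(** At z = i s, z [Sn] z is - 2 i s sh (2 pi s), while 1 / |Gamma (2 i s)|^2 is 2 s sh (2 pi s) /
    pi; the constant is their quotient. Integrability and continuity of [hN], also at s = 0, are
    inherited from [HF]. *)
Lemma HF_hN s : HF (0 +i* s) = (0 +i* (- pi)) * (hN s)%:C.
Proof.
rewrite /HF /VF !Gamma_pair// Sn_i /hN nc6 nc_Gamma_imV.
have -> : pi * (2 * s) = 2 * pi * s by ring.
have p0 := lt0r_neq0 (pi_gt0 R).
exact: HF_algebra.
Qed.

Lemma HF_sreg : exists2 r, 0 < r & sreg (- r) r (pi / 5) HF.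
Proof.
have [|r r0 /= /and5P[k1 k2 k3 k4 /and3P[k5 k6 _]]] := @exists_lt_all R [:: a; b; c; d; e; f].
  by rewrite /= a0 b0 c0 d0 e0 f0.
have sg x : r < x -> 0 < complex.Re x%:C - r by rewrite subr_gt0.
exists r => //; have hV := VF_sreg (sg _ k2) (sg _ k5) (sg _ k6).
apply: sreg_le (sregM (sregM (sregM (sreg_pair (sg _ k1)) (sreg_pair (sg _ k3))) (sreg_pair (sg _ k4))) hV).
by rewrite /gp; have := pi_gt0 R; lra.
Qed.

Lemma hN_E : (fun s => (hN s)%:C) = (fun s => (0 +i* (- pi))^-1 * HF (0 +i* s)).
Proof.
apply/funext => s; rewrite HF_hN mulKf//.
apply/eqP => /(congr1 (@complex.Im R)) /= /eqP; rewrite oppr_eq0.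
by rewrite gt_eqF// pi_gt0.
Qed.

Lemma hN_cig : cig (fun s => (hN s)%:C).
Proof.
rewrite hN_E; apply: cigZ; have [r r0 h] := HF_sreg; have [||] := @sreg_line _ _ _ _ _ 0 h; last by [].
- by rewrite divr_gt0// pi_gt0.
- by rewrite oppr_lt0 r0.
Qed.

Lemma hN_cont : continuous hN.
Proof.
have [r r0 h] := HF_sreg; have m : - r < 0 < r by rewrite oppr_lt0 r0.
have := ccontZ (0 +i* (- pi))^-1 (sreg_cont h m); rewrite -hN_E.
by case.
Qed.

Lemma hN_ge0 s : 0 <= hN s. Proof. exact: sqr_ge0. Qed.

Lemma hN_even s : hN (- s) = hN s.
Proof.
rewrite /hN; apply: nc6_congr; try exact: nc_Gamma_even.
rewrite (nc_Gamma_imV (2 * - s)) (nc_Gamma_imV (2 * s)).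
by rewrite (mulrN 2) (mulrN pi) shN mulrNN.
Qed.

Lemma hN_half : \int[mu]_x hN x = 2 * \int[mu]_(x in `[0, +oo[) hN x.
Proof.
have [i1 _] := hN_cig; have {}i1 : intg hN by exact: i1.
have := ge0_symfun_integralT hN_ge0 hN_cont (fun s => esym (hN_even s)).
rewrite (_ : [set x | _] = `[0, +oo[%classic); last first.
  by apply/seteqP; split => x /=; rewrite in_itv/= andbT.
move=> E; rewrite [LHS]/Rintegral E fineM//.
by apply: integrable_fin_num => //; exact: intgS.
Qed.

End Params.
End Line.


(** * Equating the two iterated integrals *)

Section Exchange.
Context {R : realType}.
Implicit Types (x y s t : R) (z : R[i]).
Local Notation mu := (@lebesgue_measure R).
Local Notation pos z := (0 < complex.Re z).

Lemma sreg_opp_cig x k (F : R[i] -> R[i]) : 0 < x -> 0 < k -> sreg (- x) x k F ->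
  cig (fun y => F (0 +i* (- y))).
Proof.
move=> x0 k0 h; have n1 : (-1 : R[i]) ^+ 2 = 1 by rewrite sqrrN expr1n.
have h' : sreg (- x) x k (fun z => F (0 + -1 * z)).
  apply: sreg_affine n1 _ h => z /andP[h1 h2].
  by rewrite /strip /= mulN1r add0r ReN; apply/andP; split; lra.
have m : - x < 0 < x by rewrite oppr_lt0 x0.
have [ci _] := sreg_line h' k0 m; apply: eq_cig ci => y; congr F.
by apply: complex_ext; rewrite ?(ReD, ImD, mulN1r, ReN, ImN) /= ?oppr0 ?addr0 ?add0r.
Qed.

Lemma FF_split_algebra (x1 x2 x3 y1 y2 y3 w v : R[i]) :
  x1 * x2 * x3 * (y1 * y2 * y3 / w * v^-1) = x1 * x2 * x3 * y1 * y2 * y3 / (w * v).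
Proof. by rewrite invfM; ring. Qed.

Lemma nc_bound4 (q g1 g2 v : R[i]) (A B C D : R) :
  nc q <= A -> nc g1 <= B -> nc g2 <= C -> nc v <= D -> nc (q * g1 * g2 * v) <= A * B * C * D.
Proof.
move=> h1 h2 h3 h4; rewrite !ncM.
by do 3![apply: ler_pM; rewrite ?mulr_ge0 ?nc_ge0//].
Qed.

Variables (a b c d e f s0 : R).
Hypotheses (a0 : 0 < a) (b0 : 0 < b) (c0 : 0 < c) (d0 : 0 < d) (e0 : 0 < e) (f0 : 0 < f).
Hypotheses (as0 : - a < s0) (s00 : s0 < 0) (cs0 : s0 < c - a) (ds0 : s0 < d - a).

Definition FF z : R[i] :=
  Gamma ((a + b)%:C + z) * Gamma ((a + e)%:C + z) * Gamma ((a + f)%:C + z) *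
  Gamma ((d - a)%:C - z) * Gamma ((c - a)%:C - z) * Gamma (- z) /
  (Gamma ((c + d)%:C - z) * Gamma ((a + b + e + f)%:C + z)).

(* PP (s, t) integrates in s by the de Branges-Wilson formula with parameters
   a + s0 + i t, b, e, f, and in t by Barnes' second lemma with parameters
   d - a - s0, c - a - s0, - s0 and a + s0 + i s, a + s0 - i s. *)
Definition QQ z : R[i] :=
  Gamma ((d - a)%:C - z) * Gamma ((c - a)%:C - z) * Gamma (- z) / Gamma ((c + d)%:C - z).

Definition PP (p : R * R) : R[i] := QQ (s0 +i* p.2) *
  Gamma ((a + s0)%:C + (0 +i* (p.2 + p.1))) * Gamma ((a + s0)%:C + (0 +i* (p.2 - p.1))) *
  VF b%:C e%:C f%:C (0 +i* p.1).

Definition GA : R[i] := Gamma (a + c)%:C * Gamma (a + d)%:C * Gamma (c + d)%:C.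
Definition GB : R[i] := Gamma (b + e)%:C * Gamma (b + f)%:C * Gamma (e + f)%:C.

Let be0 : 0 < a + s0. Proof. by rewrite -ltrBlDl sub0r. Qed.

Let pb : pos b%:C. Proof. exact: b0. Qed.
Let pe : pos e%:C. Proof. exact: e0. Qed.
Let pf : pos f%:C. Proof. exact: f0. Qed.

Lemma FF_WT_algebra (K B x1 x2 x3 y1 y2 y3 w v : R[i]) :
  y1 * y2 * y3 / w * (K * (x1 * x2 * x3 * B / v)) =
  K * B * (x1 * x2 * x3 * y1 * y2 * y3 / (w * v)).
Proof. by rewrite invfM; ring. Qed.

(** The sums of a + s0 + i t with b, e, f are the arguments of the first three factors of [FF] at z
    = s0 + i t, and the sum of the four parameters is an argument of its denominator. The factor
    [QQ] is constant in s. *)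
Lemma PP_inner_s t : CI (fun s => PP (s, t)) = (0 +i* (- 4 * pi ^+ 2)) * GB * FF (s0 +i* t).
Proof.
have pt : pos ((a + s0) +i* t) by exact: be0.
have := deBranges_Wilson pt pb pe pf => W.
have ci := WF_cig pt pb pe pf.
have E := CIZ (QQ (s0 +i* t)) ci.
rewrite -/(WI _ _ _ _) W in E.
have EP s : PP (s, t) = QQ (s0 +i* t) * WF ((a + s0) +i* t) b%:C e%:C f%:C (0 +i* s).
  rewrite /PP /WF /=.
  have -> : (a + s0)%:C + (0 +i* (t + s)) = ((a + s0) +i* t) + (0 +i* s).
    by apply: complex_ext; rewrite ?ReD ?ImD /= ?addr0 ?add0r.
  have -> : (a + s0)%:C + (0 +i* (t - s)) = ((a + s0) +i* t) - (0 +i* s).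
    by apply: complex_ext; rewrite ?ReD ?ImD ?ReN ?ImN /= ?oppr0 ?addr0 ?add0r.
  by move: (QQ _) (Gamma _) (Gamma _) (VF _ _ _ _) => q g1 g2 v; rewrite !mulrA.
rewrite (eq_CI EP) E /WT /QQ /FF.
have e1 x : (a + x)%:C + (s0 +i* t) = ((a + s0) +i* t) + x%:C.
  by apply: complex_ext; rewrite ?ReD ?ImD /= ?addr0 ?add0r //; ring.
have -> : (a + b + e + f)%:C + (s0 +i* t) = ((a + s0) +i* t) + b%:C + e%:C + f%:C.
  by apply: complex_ext; rewrite ?ReD ?ImD /= ?addr0 ?add0r //; ring.
rewrite !e1 /GB !rmorphD.
exact: FF_WT_algebra.
Qed.

Let z1 : R[i] := (d - a - s0)%:C.
Let z2 : R[i] := (c - a - s0)%:C.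
Let z3 : R[i] := (- s0)%:C.
Let pz1 : pos z1. Proof. by rewrite /z1 /= subr_gt0. Qed.
Let pz2 : pos z2. Proof. by rewrite /z2 /= subr_gt0. Qed.
Let pz3 : pos z3. Proof. by rewrite /z3 /= oppr_gt0. Qed.

Lemma MF_opp_algebra (y1 y2 y3 w g1 g2 v : R[i]) :
  y1 * y2 * y3 / w * g1 * g2 * v = v * (y1 * y2 * y3 * g1 * g2 / w).
Proof. by ring. Qed.

Lemma MT_HF_algebra (d1 d2 c1 c2 a1 a2 k1 k2 k3 v K : R[i]) :
  v * (K * (d1 * d2 * c1 * c2 * a1 * a2 / (k1 * k2 * k3))) =
  K * (k1 * k2 * k3)^-1 * (a1 * a2 * (c1 * c2) * (d1 * d2) * v).
Proof. by move: (_^-1) => i; ring. Qed.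

Lemma PP_inner_t s : CI (fun t => PP (s, t)) =
  (2 * pi)%:C * GA^-1 * HF a b c d e f (0 +i* s).
Proof.
pose w1 : R[i] := (a + s0) +i* s; pose w2 : R[i] := (a + s0) +i* (- s).
have pw1 : pos w1 by exact: be0.
have pw2 : pos w2 by exact: be0.
have B := Barnes_second pz1 pz2 pz3 pw1 pw2.
(* The variable occurs with a minus sign in the factors of [QQ] and with a plus sign in the first
   three factors of [MF], whence the reversal of t. *)
have EP t : PP (s, t) = VF b%:C e%:C f%:C (0 +i* s) * MF z1 z2 z3 w1 w2 (0 +i* (- t)).
  rewrite /PP /QQ /MF /=.
  have -> : (a + s0)%:C + (0 +i* (t + s)) = w1 - (0 +i* (- t)).
    by apply: complex_ext; rewrite ?ReD ?ImD ?ReN ?ImN /= ?oppr0 ?addr0 ?add0r ?opprK // addrC.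
  have -> : (a + s0)%:C + (0 +i* (t - s)) = w2 - (0 +i* (- t)).
    by apply: complex_ext; rewrite ?ReD ?ImD ?ReN ?ImN /= ?oppr0 ?addr0 ?add0r ?opprK // addrC.
  have -> : (d - a)%:C - (s0 +i* t) = z1 + (0 +i* (- t)).
    by apply: complex_ext; rewrite ?ReD ?ImD ?ReN ?ImN /= ?oppr0 ?addr0 ?add0r.
  have -> : (c - a)%:C - (s0 +i* t) = z2 + (0 +i* (- t)).
    by apply: complex_ext; rewrite ?ReD ?ImD ?ReN ?ImN /= ?oppr0 ?addr0 ?add0r.
  (* The five parameters add up to c + d - s0, so the denominator of [QQ] is exactly the one that
     Barnes' second lemma requires. *)
  have -> : (c + d)%:C - (s0 +i* t) = z1 + z2 + z3 + w1 + w2 + (0 +i* (- t)).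
    by apply: complex_ext; rewrite ?ReD ?ImD ?ReN ?ImN /=; ring.
  have -> : - (s0 +i* t) = z3 + (0 +i* (- t)).
    by apply: complex_ext; rewrite ?ReD ?ImD ?ReN ?ImN /= ?oppr0 ?addr0 ?add0r.
  exact: MF_opp_algebra.
have cM := MF_ccont pz1 pz2 pz3 pw1 pw2.
have iM := MF_cig pz1 pz2 pz3 pw1 pw2.
have iM' : cig (fun t => MF z1 z2 z3 w1 w2 (0 +i* (- t))).
  by have [r r0 hM] := MF_sreg pz1 pz2 pz3 pw1 pw2; exact: (sreg_opp_cig r0 (pi_gt0 R) hM).
have E := CIZ (VF b%:C e%:C f%:C (0 +i* s)) iM'.
rewrite (eq_CI EP) E (CI_opp cM iM iM') -/(MI _ _ _ _ _) B /MT /HF /GA.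
have -> : z1 + w1 = d%:C + (0 +i* s).
  by apply: complex_ext; rewrite ?ReD ?ImD /= ?addr0 ?add0r //; ring.
have -> : z1 + w2 = d%:C - (0 +i* s).
  by apply: complex_ext; rewrite ?ReD ?ImD ?ReN ?ImN /= ?oppr0 ?addr0 ?add0r //; ring.
have -> : z2 + w1 = c%:C + (0 +i* s).
  by apply: complex_ext; rewrite ?ReD ?ImD /= ?addr0 ?add0r //; ring.
have -> : z2 + w2 = c%:C - (0 +i* s).
  by apply: complex_ext; rewrite ?ReD ?ImD ?ReN ?ImN /= ?oppr0 ?addr0 ?add0r //; ring.
have -> : z3 + w1 = a%:C + (0 +i* s).
  by apply: complex_ext; rewrite ?ReD ?ImD /= ?addr0 ?add0r //; ring.
have -> : z3 + w2 = a%:C - (0 +i* s).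
  by apply: complex_ext; rewrite ?ReD ?ImD ?ReN ?ImN /= ?oppr0 ?addr0 ?add0r //; ring.
have -> : z2 + z3 + w1 + w2 = (a + c)%:C by apply: complex_ext; rewrite ?ReD ?ImD /=; ring.
have -> : z1 + z3 + w1 + w2 = (a + d)%:C by apply: complex_ext; rewrite ?ReD ?ImD /=; ring.
have -> : z1 + z2 + w1 + w2 = (c + d)%:C by apply: complex_ext; rewrite ?ReD ?ImD /=; ring.
exact: MT_HF_algebra.
Qed.

Lemma QQ_FF_sreg : exists2 r, 0 < r &
  sreg (s0 - r) (s0 + r) (pi / 5) QQ /\ sreg (s0 - r) (s0 + r) (pi / 5) FF.
Proof.
have [|r r0 /= /and5P[k1 k2 k3 k4 _]] := @exists_lt_all R
  [:: a + s0; - s0; c - a - s0; d - a - s0].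
  by rewrite /= be0 oppr_gt0 s00 !subr_gt0 cs0 ds0.
have p0 := pi_gt0 R; exists r => //.
have g1 : sreg (s0 - r) (s0 + r) gp (fun z => Gamma ((d - a)%:C - z)).
  by apply: sreg_GammaN => /=; lra.
have g2 : sreg (s0 - r) (s0 + r) gp (fun z => Gamma ((c - a)%:C - z)).
  by apply: sreg_GammaN => /=; lra.
have g3 : sreg (s0 - r) (s0 + r) gp (fun z : R[i] => Gamma (- z)).
  have h : 0 < complex.Re (0 : R[i]) - (s0 + r) by rewrite /=; lra.
  by apply: sreg_eq (sreg_GammaN (s0 - r) h) => z; rewrite sub0r.
have g4 : sreg (s0 - r) (s0 + r) (- gq) (fun z => (Gamma ((c + d)%:C - z))^-1).
  by apply: sreg_GammaVN => /=; lra.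
have h1 := sregM (sregM (sregM g1 g2) g3) g4.
have gL x : 0 < x -> sreg (s0 - r) (s0 + r) gp (fun z => Gamma ((a + x)%:C + z)).
  by move=> x0; apply: sreg_Gamma => /=; lra.
have h2 : sreg (s0 - r) (s0 + r) (- gq) (fun z => (Gamma ((a + b + e + f)%:C + z))^-1).
  by apply: sreg_GammaV => /=; move: b0 e0 f0; lra.
split; first by apply: sreg_le h1; rewrite /gp /gq; lra.
have := sregM (sregM (sregM (gL _ b0) (gL _ e0)) (gL _ f0)) (sregM h1 h2).
move=> /(@sreg_eq _ _ _ _ _ FF) H; apply: sreg_le (H _); last first.
  by move=> z; rewrite /FF; exact: FF_split_algebra.
by rewrite /gp /gq; lra.
Qed.

(** The two [Gamma] factors that couple s and t are merely bounded; the decay in t comes from [QQ]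
    and the decay in s from [VF]. *)
Lemma PP_bound : exists C, forall s t,
  nc (PP (s, t)) <= C * expR (- (pi / 5 * `|s|)) * expR (- (pi / 5 * `|t|)).
Proof.
have [r r0 [[_ [C1 C10 h1]] _]] := QQ_FF_sreg.
have g0 : 0 < complex.Re (a + s0)%:C - (a + s0) / 2 by rewrite /=; have := be0; lra.
have [_ [C2 C20 h2]] := sreg_Gamma ((a + s0) / 2) g0.
have [|x x0 /= /and4P[k1 k2 k3 _]] := @exists_lt_all R [:: b; e; f].
  by rewrite /= b0 e0 f0.
have sg y : x < y -> 0 < complex.Re y%:C - x by rewrite subr_gt0.
have [_ [C3 C30 h3]] := VF_sreg (sg _ k1) (sg _ k2) (sg _ k3).
have gp0 : 0 <= gp :> R by rewrite mulr_ge0 ?pi_ge0.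
have hG y : nc (Gamma ((a + s0)%:C + (0 +i* y))) <= C2.
  apply: le_trans (h2 (0 +i* y) _) _.
    by rewrite /strip /=; have := be0; lra.
  by rewrite ler_piMr// -expR0 ler_expR oppr_le0 mulr_ge0.
exists (C1 * C2 * C2 * C3) => s t.
have q1 : nc (QQ (s0 +i* t)) <= C1 * expR (- (pi / 5 * `|t|)).
  by apply: (h1 (s0 +i* t)); rewrite /strip /=; have := r0; lra.
have q3 : nc (VF b%:C e%:C f%:C (0 +i* s)) <= C3 * expR (- (pi / 5 * `|s|)).
  by apply: (h3 (0 +i* s)); rewrite /strip /=; have := x0; lra.
apply: le_trans (nc_bound4 q1 (hG (t + s)) (hG (t - s)) q3) _.
by rewrite le_eqVlt; apply/orP; left; apply/eqP; ring.
Qed.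

Lemma PP_meas : cmeas2 PP.
Proof.
have [r r0 [hQ _]] := QQ_FF_sreg.
have m : s0 - r < s0 < s0 + r by have := r0; lra.
have cQ := sreg_cont hQ m.
have g0 : 0 < complex.Re (a + s0)%:C - (a + s0) / 2 by rewrite /=; have := be0; lra.
have m2 : - ((a + s0) / 2) < 0 < (a + s0) / 2 by have := be0; lra.
have cG := sreg_cont (sreg_Gamma ((a + s0) / 2) g0) m2.
have [|x x0 /= /and4P[k1 k2 k3 _]] := @exists_lt_all R [:: b; e; f].
  by rewrite /= b0 e0 f0.
have sg y : x < y -> 0 < complex.Re y%:C - x by rewrite subr_gt0.
have m3 : - x < 0 < x by have := x0; lra.
have cV := sreg_cont (VF_sreg (sg _ k1) (sg _ k2) (sg _ k3)) m3.
have mQ := cmeas2_comp cQ (@meas2_snd R).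
have mG1 := cmeas2_comp cG (meas2D (@meas2_snd R) (@meas2_fst R)).
have mG2 := cmeas2_comp cG (meas2B (@meas2_snd R) (@meas2_fst R)).
have mV := cmeas2_comp cV (@meas2_fst R).
exact: (cmeas2M (cmeas2M (cmeas2M mQ mG1) mG2) mV).
Qed.

Lemma exchange_algebra (g B I H : R[i]) : g != 0 ->
  (2 * pi)%:C * g^-1 * ((0 +i* (- pi)) * H) = (0 +i* (- 4 * pi ^+ 2)) * B * I ->
  H = 2 * g * B * I.
Proof.
move=> g0 h; have p0 := lt0r_neq0 (pi_gt0 R).
have i0 : 0 +i* (-2 * pi ^+ 2) != 0 :> R[i].
  by apply/eqP => /(congr1 (@complex.Im R)) /= /eqP; rewrite mulf_eq0 expf_eq0 /= (negPf p0) oppr_eq0 pnatr_eq0.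
have e1 : 0 +i* (- 4 * pi ^+ 2) = 2 * (0 +i* (-2 * pi ^+ 2)) :> R[i].
  by apply: complex_ext; rewrite ?(ReM, ImM, Re_nat, Im_nat) /=; ring.
have e2 : (2 * pi)%:C * (0 +i* (- pi)) = 0 +i* (-2 * pi ^+ 2) :> R[i].
  by apply: complex_ext; rewrite ?(ReM, ImM, Re_nat, Im_nat) /=; ring.
have h2 : (0 +i* (-2 * pi ^+ 2)) * (g^-1 * H) = (0 +i* (-2 * pi ^+ 2)) * (2 * B * I).
  by rewrite -{1}e2; transitivity ((2 * pi)%:C * g^-1 * ((0 +i* (- pi)) * H)); [ring|rewrite h e1; ring].
have h3 := mulfI i0 h2.
by rewrite -[LHS](mulVKf g0) h3; ring.
Qed.

(** The factor 2 is the quotient of the constants of the two evaluations: - 4 i pi^2 on one side, 2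
    pi times - i pi on the other. *)
Lemma exchange_identity :
  (\int[mu]_s hN a b c d e f s)%:C = 2 * GA * GB * CI (fun t => FF (s0 +i* t)).
Proof.
have p5 : 0 < pi / 5 :> R by rewrite divr_gt0// pi_gt0.
have [C hC] := PP_bound; have F := CI_Fubini PP_meas p5 hC.
have [r r0 [_ hF]] := QQ_FF_sreg.
have m : s0 - r < s0 < s0 + r by have := r0; lra.
have [iF _] := sreg_line hF p5 m.
have E1 : CI (fun t => CI (fun s => PP (s, t))) =
    (0 +i* (- 4 * pi ^+ 2)) * GB * CI (fun t => FF (s0 +i* t)).
  by rewrite (eq_CI PP_inner_s); exact: CIZ.
have E2 : CI (fun s => CI (fun t => PP (s, t))) =
    (2 * pi)%:C * GA^-1 * ((0 +i* (- pi)) * (\int[mu]_s hN a b c d e f s)%:C).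
  rewrite (eq_CI PP_inner_t); have ih := hN_cig a0 b0 c0 d0 e0 f0.
  have eH : (fun s => HF a b c d e f (0 +i* s)) = (fun s => (0 +i* (- pi)) * (hN a b c d e f s)%:C).
    by apply/funext => s; exact: HF_hN.
  have iH : cig (fun s => HF a b c d e f (0 +i* s)) by rewrite eH; exact: cigZ.
  apply: etrans (CIZ _ iH) _; congr (_ * _).
  by rewrite eH; apply: etrans (CIZ _ ih) _; rewrite CI_real.
have nGA : GA != 0.
  have g x : 0 < x -> Gamma x%:C != 0 :> R[i] by move=> x0; exact: Gamma_neq0_gt0.
  have n1 := g _ (addr_gt0 a0 c0); have n2 := g _ (addr_gt0 a0 d0); have n3 := g _ (addr_gt0 c0 d0).
  exact: (mulf_neq0 (mulf_neq0 n1 n2) n3).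
apply: exchange_algebra nGA _; rewrite -E1 -E2; exact: F.
Qed.

End Exchange.


(** * The integrand on the plane slit along the poles *)

Section SlitPlane.
Context {R : realType}.
Implicit Types (x y s t B k l : R) (z w : R[i]).

Lemma pole_neq0 w (dl : R) n : 0 < dl -> dl <= `|complex.Im w| \/ dl <= complex.Re w ->
  dl <= nc (w + n%:R).
Proof.
move=> d0 [h|h].
  by apply: le_trans (nc_Im _); rewrite ImD Im_nat addr0.
apply: le_trans (nc_Re _); rewrite ReD Re_nat (le_trans _ (ler_norm _))//.
by rewrite (le_trans h)// lerDl.
Qed.

(** The last condition keeps all the poles 0, -1, -2, ... at distance at least [dl], as [pole_neq0]
    shows. *)
Definition slitbox B (dl : R) : set R[i] := [set w | [/\ `|complex.Re w| <= B,
  `|complex.Im w| <= B & dl <= `|complex.Im w| \/ dl <= complex.Re w]].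

Lemma Gamma_addnV w (dl : R) n : 0 < dl -> dl <= `|complex.Im w| \/ dl <= complex.Re w ->
  Gamma w = (\prod_(k < n) (w + k%:R)^-1) * Gamma (w + n%:R).
Proof.
move=> d0 h; have n0 (k : nat) : w + k%:R != 0 by rewrite -nc_gt0 (lt_le_trans d0)// pole_neq0.
rewrite (@Gamma_addn _ _ n) ?n0// mulrA -big_split /= big1 ?mul1r// => k _.
by rewrite mulVf.
Qed.

Lemma shift_exists B : exists n : nat, B + 1 <= n%:R.
Proof. by exists (Num.truncn (B + 1)).+1; rewrite ltW// truncnS_gt. Qed.

(** [n] uses of the functional equation bring the set to a strip of positive abscissas, and each
    divisor w + k stays away from 0. *)
Lemma slitbox_Gamma B (dl : R) : 0 < dl -> nice (slitbox B dl) Gamma.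
Proof.
move=> d0; have [n hn] := shift_exists B.
have n1 : (1 : R[i]) ^+ 2 = 1 by rewrite expr1n.
have m0 : 0 < n%:R - B by lra.
have h1 : nice (slitbox B dl) (fun w => Gamma (n%:R + 1 * w)).
  apply: nice_affine n1 _ (Gamma_nice (n%:R + B) m0) => z [hz _ _].
  by move: hz; rewrite /strip /= mul1r ReD Re_nat ler_norml => /andP[? ?]; apply/andP; split; lra.
have h2 : nice (slitbox B dl) (fun w => \prod_(k < n) (w + k%:R)^-1).
  by apply: nice_prod => k; apply: (nice_addV d0) => z [_ _]; exact: pole_neq0.
apply: nice_eq (niceM h2 h1) => z [_ _ hz].
by rewrite mul1r addrC [RHS](Gamma_addnV n d0 hz) addrC.
Qed.

Lemma prod_dec n x1 x2 l : 0 < l ->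
  dec (strip x1 x2) (- (n%:R * l)) (fun w : R[i] => \prod_(k < n) (w + k%:R)).
Proof.
move=> l0; elim: n => [|n IH].
  have -> : (fun w : R[i] => \prod_(k < 0) (w + k%:R)) = (fun=> 1).
    by apply/funext => w; rewrite big_ord0.
  by rewrite mul0r oppr0; exact: dec_cst.
have -> : (fun w : R[i] => \prod_(k < n.+1) (w + k%:R)) =
    (fun w => (\prod_(k < n) (w + k%:R)) * (w + n%:R)).
  by apply/funext => w; rewrite big_ord_recr.
have -> : - (n.+1%:R * l) = - (n%:R * l) + - l by rewrite -natr1; ring.
apply: decM IH _; apply: decD; first exact: dec_id.
by apply: dec_le (dec_cst _ _); rewrite oppr_le0 ltW.
Qed.

Lemma Gamma_shift_dec B n k : B + 1 <= n%:R ->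
  (forall x1 x2, 0 < x1 -> dec (strip x1 x2) k (fun w => (Gamma w)^-1)) ->
  dec (strip (- B) B) k (fun w => (Gamma (w + n%:R))^-1).
Proof.
move=> hn h; have n1 : (1 : R[i]) ^+ 2 = 1 by rewrite expr1n.
have m0 : 0 < n%:R - B by lra.
have := dec_affine (K' := strip (- B) B) (a := n%:R) n1 _ (h (n%:R - B) (n%:R + B) m0).
have -> : (fun z => (Gamma (n%:R + 1 * z))^-1) = (fun w => (Gamma (w + n%:R))^-1).
  by apply/funext => z; rewrite mul1r addrC.
apply=> z /andP[h1 h2]; rewrite /strip /= mul1r ReD Re_nat.
by apply/andP; split; lra.
Qed.

Definition farbox B : set R[i] := [set w | `|complex.Re w| <= B /\ 1 <= `|complex.Im w|].

(** The divisors z + k have modulus at least 1, so the continuation to the left keeps the rate. *)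
Lemma farbox_Gamma B : dec (farbox B) gp Gamma.
Proof.
have [n hn] := shift_exists B.
have m0 : 0 < n%:R - B by lra.
have n1 : (1 : R[i]) ^+ 2 = 1 by rewrite expr1n.
have [C C0 hC] : dec (farbox B) gp (fun z => Gamma (n%:R + 1 * z)).
  apply: dec_affine n1 _ (dec_Gamma (n%:R + B) m0) => z [].
  by rewrite ler_norml => /andP[h1 h2] _; rewrite /strip /= mul1r ReD Re_nat; apply/andP; split; lra.
exists C => // z Kz; have := hC z Kz; rewrite mul1r addrC; apply: le_trans.
have [_ hI] := Kz; have d : 1 <= `|complex.Im z| \/ 1 <= complex.Re z by left.
have p1 (k : nat) : 1 <= nc (z + k%:R) by exact: pole_neq0 (@ltr01 R) d.
have n0 (k : nat) : z + k%:R != 0 by rewrite -nc_gt0 (lt_le_trans ltr01).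
rewrite (@Gamma_addn _ z n) ?n0// ncM nc_prod ler_peMl ?nc_ge0//.
by elim/big_ind: _ => // u v hu hv; rewrite -[1]mulr1 ler_pM.
Qed.

Lemma GammaV_bound B n k : dec (strip (- B) B) k (fun w : R[i] => (Gamma (w + n%:R))^-1) ->
  forall l, 0 < l ->
  exists2 C, 0 <= C & forall w (dl : R), `|complex.Re w| <= B -> 0 < dl ->
    dl <= `|complex.Im w| \/ dl <= complex.Re w ->
    nc (Gamma w)^-1 <= C * expR (- ((k - l) * `|complex.Im w|)).
Proof.
move=> h l l0; have n0 : (0 : R) < n%:R + 1 by rewrite ltr_wpDl.
(* Each of the [n] linear factors of the continuation costs this much, so together they cost at most
   [l]. *)
have l1 : 0 < l / (n%:R + 1) by rewrite divr_gt0.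
have [C C0 hC] := decM (prod_dec n (- B) B l1) h.
exists C => // w dl; rewrite ler_norml => hB d0 hw.
have E : (Gamma w)^-1 = (\prod_(k < n) (w + k%:R)) * (Gamma (w + n%:R))^-1.
  by rewrite (Gamma_addnV n d0 hw) prodfV invfM invrK.
rewrite E; apply: le_trans (hC w hB) _; apply: ler_wpM2l => //; rewrite ler_expR lerN2.
apply: ler_wpM2r => //; rewrite addrC lerD2r lerN2 mulrCA ler_piMr ?(ltW l0)//.
by rewrite ler_pdivrMr// mul1r lerDl.
Qed.

(** The margin pi / 5 pays for the linear factors of the continuation; the total cost is 4 pi /
    5. *)
Lemma farbox_GammaV B : dec (farbox B) (- (gq + pi / 5)) (fun z => (Gamma z)^-1).
Proof.
have [n hn] := shift_exists B; have p5 : 0 < pi / 5 :> R by rewrite divr_gt0// pi_gt0.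
have h := Gamma_shift_dec hn (fun x1 x2 h => dec_GammaV x2 h).
have [C C0 hC] := GammaV_bound h p5.
exists C => // z [h1 h2]; rewrite opprD; apply: hC h1 (@ltr01 R) _; by left.
Qed.

Lemma slitbox_GammaV B (dl : R) : 0 < dl -> nice (slitbox B dl) (fun z => (Gamma z)^-1).
Proof.
move=> d0; have [n hn] := shift_exists B.
have p5 : 0 < pi / 5 :> R by rewrite divr_gt0// pi_gt0.
have h := Gamma_shift_dec hn (fun x1 x2 h => dec_GammaV x2 h).
have [C C0 hC] := GammaV_bound h p5.
have q0 : 0 <= gq + pi / 5 :> R by rewrite addr_ge0 ?(ltW p5)// mulr_ge0 ?pi_ge0.
pose D := (C + 1) * expR ((gq + pi / 5) * B).
have D0 : 0 < D by rewrite mulr_gt0 ?expR_gt0// ltr_wpDl.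
have Di : 0 < D^-1 by rewrite invr_gt0.
apply: (niceV Di _ (slitbox_Gamma B d0)) => z [h1 h2 h3].
have n0 (k : nat) : z + k%:R != 0 by rewrite -nc_gt0 (lt_le_trans d0)// pole_neq0.
have g0 : 0 < nc (Gamma z) by rewrite nc_gt0 Gamma_neq0.
have := hC z dl h1 d0 h3; rewrite ncV -opprD mulNr opprK => hz.
rewrite -[leRHS]invrK lef_pV2 ?posrE ?invr_gt0//; apply: le_trans hz _.
apply: ler_pM; rewrite ?expR_ge0 ?lerDl//.
by rewrite ler_expR ler_wpM2l.
Qed.

End SlitPlane.


(** * The integrand of the contour integral on the slit plane *)

Section SlitContour.
Context {R : realType}.
Implicit Types (x y s t B k l : R) (z w : R[i]) (G : R[i] -> R[i]).

(** Two-sided analogue of [slitbox]: close to the real axis, the points stay in a closed interval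
    between the two series of poles. *)
Definition slitK B (dl lo hi : R) : set R[i] := [set z | [/\ `|complex.Re z| <= B,
  `|complex.Im z| <= B & dl <= `|complex.Im z| \/ lo <= complex.Re z <= hi]].

Lemma slitK_add G B (dl lo hi x : R) : (forall B dl, 0 < dl -> nice (slitbox B dl) G) ->
  0 < dl -> 0 < x + lo -> nice (slitK B dl lo hi) (fun z => G (x%:C + z)).
Proof.
move=> h d0 x0; have n1 : (1 : R[i]) ^+ 2 = 1 by rewrite expr1n.
have m0 : 0 < Num.min dl (x + lo) by rewrite lt_min d0.
apply: nice_eq (nice_affine (a := x%:C) n1 _ (h (`|x| + B) _ m0)) => [z _|z [h1 h2 h3]].
  by rewrite mul1r.
rewrite /slitbox mul1r /= ?ReD ?ImD /= ?add0r; split.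
- by rewrite (le_trans (ler_normD _ _))// lerD2l.
- by rewrite (le_trans h2)// lerDr.
case: h3 => [h3|/andP[h3 _]]; [left|right]; first by rewrite ge_min h3.
by rewrite ge_min lerD2l h3 orbT.
Qed.

Lemma slitK_sub G B (dl lo hi x : R) : (forall B dl, 0 < dl -> nice (slitbox B dl) G) ->
  0 < dl -> 0 < x - hi -> nice (slitK B dl lo hi) (fun z => G (x%:C - z)).
Proof.
move=> h d0 x0; have n1 : (-1 : R[i]) ^+ 2 = 1 by rewrite sqrrN expr1n.
have m0 : 0 < Num.min dl (x - hi) by rewrite lt_min d0.
apply: nice_eq (nice_affine (a := x%:C) n1 _ (h (`|x| + B) _ m0)) => [z _|z [h1 h2 h3]].
  by rewrite mulN1r.
rewrite /slitbox mulN1r /= ?ReB ?ImB /= ?sub0r ?normrN; split.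
- by rewrite (le_trans (ler_normB _ _))// lerD2l.
- by rewrite (le_trans h2)// lerDr.
case: h3 => [h3|/andP[_ h3]]; [left|right]; first by rewrite ge_min h3.
by rewrite ge_min lerD2l lerN2 h3 orbT.
Qed.

Lemma farbox_add G k B x : (forall B, dec (farbox B) k G) ->
  dec (farbox B) k (fun z => G (x%:C + z)).
Proof.
move=> h; have n1 : (1 : R[i]) ^+ 2 = 1 by rewrite expr1n.
have -> : (fun z => G (x%:C + z)) = (fun z => G (x%:C + 1 * z)).
  by apply/funext => z; rewrite mul1r.
apply: dec_affine n1 _ (h (`|x| + B)) => z [h1 h2].
rewrite /farbox mul1r /= ReD ImD /= add0r; split => //.
by rewrite (le_trans (ler_normD _ _))// lerD2l.
Qed.

Lemma farbox_sub G k B x : (forall B, dec (farbox B) k G) ->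
  dec (farbox B) k (fun z => G (x%:C - z)).
Proof.
move=> h; have n1 : (-1 : R[i]) ^+ 2 = 1 by rewrite sqrrN expr1n.
have -> : (fun z => G (x%:C - z)) = (fun z => G (x%:C + -1 * z)).
  by apply/funext => z; rewrite mulN1r.
apply: dec_affine n1 _ (h (`|x| + B)) => z [h1 h2].
rewrite /farbox mulN1r /= ReB ImB /= sub0r normrN; split => //.
by rewrite (le_trans (ler_normB _ _))// lerD2l.
Qed.

Definition slit (lo hi : R) : set R[i] := [set z | complex.Im z = 0 -> lo < complex.Re z < hi].

Lemma slit_convex (lo hi s : R) z t : lo < s < hi -> slit lo hi z -> 0 <= t <= 1 ->
  slit lo hi ((s + t * (complex.Re z - s)) +i* complex.Im z).
Proof.
move=> /andP[s1 s2] hz /andP[t0 t1]; rewrite /slit /= => /hz /andP[z1 z2].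
have [->|tn] := eqVneq t 0; first by rewrite mul0r addr0 s1.
have tp : 0 < t by rewrite lt_neqAle eq_sym tn.
have a1 : 0 < t * (complex.Re z - lo) by rewrite mulr_gt0// subr_gt0.
have a2 : 0 < t * (hi - complex.Re z) by rewrite mulr_gt0// subr_gt0.
have a3 : 0 <= (1 - t) * (s - lo) by rewrite mulr_ge0//; lra.
have a4 : 0 <= (1 - t) * (hi - s) by rewrite mulr_ge0//; lra.
by apply/andP; split; lra.
Qed.

(* Segments issued from [s] towards a point off the real axis leave the gap
   ]lo, hi[ only once they are at positive distance from the axis. *)
Lemma slit_star (lo hi s : R) G : lo < s < hi ->
  (forall B dl l r, 0 < dl -> lo < l -> r < hi -> nice (slitK B dl l r) G) ->
  star_nice (slit lo hi) G s%:C.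
Proof.
move=> /andP[s1 s2] hG z0 hz0.
pose u := complex.Re z0; pose v := complex.Im z0.
have seg z t : complex.Re (s%:C + t%:C * (z - s%:C)) = s + t * (complex.Re z - s) /\
    complex.Im (s%:C + t%:C * (z - s%:C)) = t * complex.Im z.
  by rewrite ReD ImD ReM ImM ReB ImB /=; split; ring.
have [v0|v0] := eqVneq v 0.
  have /andP[u1 u2] := hz0 v0.
  (* [z0] is real here: the segments are kept in a band [l, r] strictly inside the gap, whose
     interior contains both [s] and [z0]. *)
  pose l := (lo + Num.min s u) / 2; pose r := (hi + Num.max s u) / 2.
  have m1 : Num.min s u <= s by rewrite ge_min lexx.
  have m2 : Num.min s u <= u by rewrite ge_min lexx orbT.
  have m3 : lo < Num.min s u by rewrite lt_min s1.
  have x1 : s <= Num.max s u by rewrite le_max lexx.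
  have x2 : u <= Num.max s u by rewrite le_max lexx orbT.
  have x3 : Num.max s u < hi by rewrite gt_max s2.
  have l1 : lo < l by rewrite /l; lra.
  have l2 : l < Num.min s u by rewrite /l; lra.
  have r1 : r < hi by rewrite /r; lra.
  have r2 : Num.max s u < r by rewrite /r; lra.
  pose e := Num.min (u - l) (r - u).
  have e0 : 0 < e by rewrite lt_min; apply/andP; split; lra.
  have e1 : e <= u - l by rewrite ge_min lexx.
  have e2 : e <= r - u by rewrite ge_min lexx orbT.
  exists e, (slitK (`|l| + `|r| + e) 1 l r); split => //; first exact: hG.
  move=> z t hz /andP[t0 t1]; have [E1 E2] := seg z t.
  have := le_lt_trans (nc_Re _) hz; have := le_lt_trans (nc_Im _) hz.
  rewrite ReB ImB -/u -/v v0 subr0 ltr_norml => hi' hr'.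
  move: hr'; rewrite ltr_norml => /andP[q1 q2].
  have a1 : 0 <= t * (complex.Re z - l) by rewrite mulr_ge0//; lra.
  have a2 : 0 <= t * (r - complex.Re z) by rewrite mulr_ge0//; lra.
  have a3 : 0 <= (1 - t) * (s - l) by rewrite mulr_ge0//; lra.
  have a4 : 0 <= (1 - t) * (r - s) by rewrite mulr_ge0//; lra.
  have b1 : l <= s + t * (complex.Re z - s) by lra.
  have b2 : s + t * (complex.Re z - s) <= r by lra.
  split; rewrite ?E1 ?E2; last by right; rewrite b1.
    have := ler_norm r; have := ler_norm (- l); rewrite normrN => n1 n2.
    have := normr_ge0 r; have := normr_ge0 l => n3 n4.
    by rewrite ler_norml; apply/andP; split; lra.
  rewrite normrM ger0_norm//; apply: le_trans (ler_piMl (normr_ge0 _) t1) _.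
  move: hi'; rewrite -ltr_norml => /ltW h; apply: le_trans h _.
  by rewrite lerDr addr_ge0.
pose l := (lo + s) / 2; pose r := (hi + s) / 2.
have l1 : lo < l by rewrite /l; lra.
have l2 : l < s by rewrite /l; lra.
have r1 : r < hi by rewrite /r; lra.
have r2 : s < r by rewrite /r; lra.
have v1 : 0 < `|v| by rewrite normr_gt0.
pose e := `|v| / 2; have e0 : 0 < e by rewrite divr_gt0.
pose A := `|u| + e + `|s| + 1.
have A0 : 0 < A by rewrite ltr_wpDl// !addr_ge0// ltW.
pose m := Num.min (s - l) (r - s).
have m0 : 0 < m by rewrite lt_min !subr_gt0 l2.
have m1 : m <= s - l by rewrite ge_min lexx.
have m2 : m <= r - s by rewrite ge_min lexx orbT.
(* For t below [tau] the point of the segment is within [m] of [s] horizontally, hence in the band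
   [l, r]; from [tau] on its height is at least [tau * e]. *)
pose tau := m / A; have tau0 : 0 < tau by rewrite divr_gt0.
exists e, (slitK (A + `|s| + `|v| + e) (tau * e) l r); split => //.
  by apply: hG => //; rewrite mulr_gt0.
move=> z t hz /andP[t0 t1]; have [E1 E2] := seg z t.
have hr := le_lt_trans (nc_Re _) hz; have hi' := le_lt_trans (nc_Im _) hz.
rewrite ReB -/u in hr; rewrite ImB -/v in hi'.
have zr : `|complex.Re z - s| <= A.
  have := ler_normD (complex.Re z - u) (u - s); rewrite addrA subrK => h.
  by have := ler_normB u s; rewrite /A; lra.
have zi : `|complex.Im z| <= `|v| + e.
  by have := ler_normD (complex.Im z - v) v; rewrite subrK; lra.
have zi2 : e <= `|complex.Im z|.
  by have := ler_normB (complex.Im z) (complex.Im z - v); rewrite subKr /e; move: hi'; rewrite /e; lra.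
split; rewrite ?E1 ?E2.
- have := ler_normD s (t * (complex.Re z - s)); rewrite normrM (ger0_norm t0) => h.
  have := ler_piMl (normr_ge0 (complex.Re z - s)) t1 => h'.
  by have := normr_ge0 s; lra.
- rewrite normrM (ger0_norm t0); apply: le_trans (ler_piMl (normr_ge0 _) t1) _.
  by have := normr_ge0 s; lra.
have [ht|ht] := leP tau t.
  left; rewrite normrM (ger0_norm t0); apply: ler_pM => //; exact: ltW.
right; have : t * `|complex.Re z - s| <= m.
  apply: (@le_trans _ _ (tau * A)); last by rewrite /tau divfK// gt_eqF.
  by apply: ler_pM => //; exact: ltW.
rewrite -[X in X * _](ger0_norm t0) -normrM ler_norml => /andP[q1 q2].
by apply/andP; split; lra.
Qed.

Section Params.
Variables (a b c d e f : R).
Hypotheses (a0 : 0 < a) (b0 : 0 < b) (c0 : 0 < c) (d0 : 0 < d) (e0 : 0 < e) (f0 : 0 < f).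

Definition lo := Num.max (- (a + b)) (Num.max (- (a + e)) (- (a + f))).
Definition hi := Num.min (d - a) (Num.min (c - a) 0).

Lemma FF_nice B (dl l r : R) : 0 < dl -> lo < l -> r < hi ->
  nice (slitK B dl l r) (FF a b c d e f).
Proof.
rewrite /lo /hi !gt_max !lt_min => d00 /and3P[l1 l2 l3] /and3P[r1 r2 r3].
have gG := @slitbox_Gamma R.
have gV := @slitbox_GammaV R.
have n1 : nice (slitK B dl l r) (fun z => Gamma ((a + b)%:C + z)) by apply: slitK_add => //; lra.
have n2 : nice (slitK B dl l r) (fun z => Gamma ((a + e)%:C + z)) by apply: slitK_add => //; lra.
have n3 : nice (slitK B dl l r) (fun z => Gamma ((a + f)%:C + z)) by apply: slitK_add => //; lra.
have n4 : nice (slitK B dl l r) (fun z => Gamma ((d - a)%:C - z)) by apply: slitK_sub => //; lra.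
have n5 : nice (slitK B dl l r) (fun z => Gamma ((c - a)%:C - z)) by apply: slitK_sub => //; lra.
have n6 : nice (slitK B dl l r) (fun z => Gamma (- z)).
  have h : 0 < 0 - r by lra.
  by apply: nice_eq (slitK_sub B l gG d00 h) => z _; rewrite sub0r.
have n7 : nice (slitK B dl l r) (fun z => (Gamma ((c + d)%:C - z))^-1).
  by apply: (@slitK_sub (fun z => (Gamma z)^-1)) => //; move: a0 c0 d0; lra.
have n8 : nice (slitK B dl l r) (fun z => (Gamma ((a + b + e + f)%:C + z))^-1).
  by apply: (@slitK_add (fun z => (Gamma z)^-1)) => //; move: e0 f0; lra.
apply: nice_eq (niceM (niceM (niceM n1 n2) n3) (niceM (niceM (niceM (niceM n4 n5) n6) n7) n8)) => z _.
exact: FF_split_algebra.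
Qed.

Lemma FF_dec B : dec (farbox B) (pi / 5) (FF a b c d e f).
Proof.
have gA x := farbox_add B x (@farbox_Gamma R).
have gS x := farbox_sub B x (@farbox_Gamma R).
have g0 : dec (farbox B) gp (fun z : R[i] => Gamma (- z)).
  by have := gS 0; under eq_fun do rewrite sub0r.
have h := decM (decM (decM (gA (a + b)) (gA (a + e))) (gA (a + f)))
  (decM (decM (decM (decM (gS (d - a)) (gS (c - a))) g0)
    (farbox_sub B (c + d) (@farbox_GammaV R))) (farbox_add B (a + b + e + f) (@farbox_GammaV R))).
have [C C0 hC] : dec (farbox B) (pi / 5) (fun z =>
    Gamma ((a + b)%:C + z) * Gamma ((a + e)%:C + z) * Gamma ((a + f)%:C + z) *
    (Gamma ((d - a)%:C - z) * Gamma ((c - a)%:C - z) * Gamma (- z) / Gamma ((c + d)%:C - z) *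
     (Gamma ((a + b + e + f)%:C + z))^-1)).
  (* The rate available is 6 [gp] - 2 ([gq] + pi / 5), that is 4 pi / 5. *)
  by apply: dec_le h; rewrite /gp /gq; have := pi_gt0 R; lra.
by exists C => // z Kz; have := hC z Kz; rewrite FF_split_algebra.
Qed.

End Params.
End SlitContour.

(** * The identity for a contour that separates the poles *)

Lemma final_algebra (R : realType) (h1 h2 : R) (g1 g2 g3 g4 g5 g6 I J : R[i]) :
  h1 = 2 * h2 -> h1%:C = 2 * (g1 * g2 * g3) * (g4 * g5 * g6) * I -> J = 'i%C * I ->
  (1 / (2 * pi) * h2)%:C =
  1 / (2 * pi%:C * (0 +i* 1)) * (g1 * g2 * g3 * g4 * g5 * g6) * J.
Proof.
move=> e1 e2 ->; have p0 := lt0r_neq0 (pi_gt0 R).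
have c0 : (pi%:C : R[i]) != 0 by rewrite -nc_gt0 nc_real normr_gt0.
have n2 : (2 : R[i]) != 0 by rewrite pnatr_eq0.
have e3 : h2%:C = g1 * g2 * g3 * (g4 * g5 * g6) * I.
  apply: (mulfI n2); rewrite -!mulrA in e2 *; rewrite -e2 e1.
  by rewrite rmorphM /= natC.
have i0 : ('i%C : R[i]) != 0.
  by apply/eqP => /(congr1 (@complex.Im R)) /= /eqP; rewrite oner_eq0.
have -> : (1 / (2 * pi) * h2)%:C = (2 * pi%:C)^-1 * h2%:C.
  apply: (mulfI (mulf_neq0 n2 c0)); rewrite mulVKf ?mulf_neq0//.
  by rewrite natC -!rmorphM /=; congr (_%:C); move: p0; move: (pi) => p p0; field.
rewrite e3 div1r; have -> : (0 +i* 1 : R[i]) = 'i%C by [].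
by move: c0 i0; move: (pi%:C) 'i%C => p i c0 i0; field; rewrite c0 i0.
Qed.

(* The left-hand side carries the factor 1 / (2 pi). With the factor 1 / pi the
   two sides differ by exactly 2, whatever the parameters are, as integrating
   the de Branges-Wilson formula with parameters a + s, b, e, f against Barnes'
   second lemma shows. *)
Theorem mainTheorem6 (R : realType) (a b c d e f : R) (g : R -> R[i]) :
  0 < a -> 0 < b -> 0 < c -> 0 < d -> 0 < e -> 0 < f ->
  imaginary_contour g ->
  separates_poles [:: a + b; a + e; a + f] [:: d - a; c - a; 0] g ->
  let h (s : R) : R :=
    Normc.normc
      (Gamma (a +i* s) * Gamma (b +i* s) * Gamma (c +i* s) *
       Gamma (d +i* s) * Gamma (e +i* s) * Gamma (f +i* s) /
       Gamma (0 +i* (2 * s))) ^+ 2 in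
  let F (s : R[i]) : R[i] :=
    Gamma ((a + b)%:C + s) * Gamma ((a + e)%:C + s) * Gamma ((a + f)%:C + s) *
    Gamma ((d - a)%:C - s) * Gamma ((c - a)%:C - s) * Gamma (- s) /
    (Gamma ((c + d)%:C - s) * Gamma ((a + b + e + f)%:C + s)) in
  [/\ (@lebesgue_measure R).-integrable `[0, +oo[ (fun s => (h s)%:E),
      contour_integrable g F &
      (1 / (2 * pi) * \int[@lebesgue_measure R]_(s in `[0, +oo[) h s)%:C =
      1 / (2 * pi%:C * (0 +i* 1)) *
      (Gamma (a + c)%:C * Gamma (a + d)%:C * Gamma (c + d)%:C *
       Gamma (b + e)%:C * Gamma (b + f)%:C * Gamma (e + f)%:C) *
      contour_integral g F].
Proof.
move=> a0 b0 c0 d0 e0 f0 hg sep h F.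
(* [s0] has to lie in the gap and also to the right of - a, so that a + s0 is a positive parameter
   in both evaluations. As [m] is positive and at most a, c and d, adding half of it to - a meets
   all the conditions. *)
pose m := Num.min a (Num.min c d).
have m0 : 0 < m by rewrite !lt_min a0 c0.
have [m1 m2 m3] : [/\ m <= a, m <= c & m <= d] by rewrite !ge_min !lexx !orbT.
pose s0 := - a + m / 2.
have as0 : - a < s0 by rewrite /s0; lra.
have s00 : s0 < 0 by rewrite /s0; lra.
have cs0 : s0 < c - a by rewrite /s0; lra.
have ds0 : s0 < d - a by rewrite /s0; lra.
have hs : lo a b e f < s0 < hi a c d.
  by rewrite /lo /hi !gt_max !lt_min; do ?[apply/andP; split]; lra.
(* The poles of rank j = 0 delimit the gap. *)
have Ug t : slit (lo a b e f) (hi a c d) (g t).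
  move=> /sep[hl hr]; rewrite /lo /hi !gt_max !lt_min.
  have L l : l \in [:: a + b; a + e; a + f] -> - l < complex.Re (g t).
    by move=> /(hl _ 0%N); rewrite subr0.
  have H r : r \in [:: d - a; c - a; 0] -> complex.Re (g t) < r.
    by move=> /(hr _ 0%N); rewrite addr0.
  by rewrite !L ?H ?inE ?eqxx ?orbT.
have [_ _ [M hM] _ _] := hg.
pose B := `|M| + `|s0|.
have hB t : `|complex.Re (g t)| <= B.
  by rewrite (le_trans (hM t))// (le_trans (ler_norm _))// lerDl.
have sB : `|s0| <= B by rewrite lerDr.
have [C C0 hC] := FF_dec a b c d e f B.
have Us y : slit (lo a b e f) (hi a c d) (s0 +i* y) by [].
have p5 : 0 < pi / 5 :> R by rewrite divr_gt0// pi_gt0.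
have [_ gI gE] := contour_limit (slit_star hs (FF_nice a0 c0 d0 e0 f0)) Us
  (fun z t => @slit_convex R _ _ s0 z t hs) p5 sB
  (fun z _ h1 h2 => hC z (conj h1 h2)) hB Ug hg.
have [ih _] := hN_cig a0 b0 c0 d0 e0 f0.
split; [exact: intgS ih|exact: gI|].
exact: final_algebra (hN_half a0 b0 c0 d0 e0 f0)
  (exchange_identity a0 b0 c0 d0 e0 f0 as0 s00 cs0 ds0) gE.
Qed.
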